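(* Let $\omega:[2,\infty)\to\mathbb{R}$ be an increasing function with $\omega(t)\le 1$ for all $t$, such that $$\int_2^\infty\frac{1-\omega(t)}{t\log t}\,dt<\infty .$$ Then for each $\delta>0$ there exists a constant $C_\delta>0$ such that $$\int_T^{T+\delta}|\zeta(\sigma+it)|\,dt\ge C_\delta$$ for all $T\ge 2$ and all real $\sigma\ge\omega(T)$.
   Context: $\zeta$ is the Riemann zeta-function. The constant $C_\delta$ does not depend on $T$ or $\sigma$ (it may depend on $\delta$ and on the function $\omega$). *)

(* Defs.v *)
From Stdlib Require Import Reals ClassicalEpsilon.
From Coquelicot Require Import Coquelicot.
Open Scope R_scope.

Definition Cexp (z : C) : C :=
  (exp (Re z) * cos (Im z), exp (Re z) * sin (Im z)).

Definition analytic_at (f : C -> C) (z0 : C) : Prop :=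
  exists (a : nat -> C) (r : R), 0 < r /\
    forall z : C, Cmod (z - z0)%C < r ->
      @is_pseries C_AbsRing C_NormedModule a (z - z0)%C (f z).

(* f is the analytic continuation to C \ {1} of the Dirichlet series
   sum_{n >= 1} n^{-s}, Re s > 1; here n^{-s} = exp (- s log n), and the
   summation index is shifted by one. *)
Definition is_riemann_zeta (f : C -> C) : Prop :=
  (forall s : C, 1 < Re s ->
     @is_series C_AbsRing C_NormedModule
       (fun n : nat => Cexp (- s * RtoC (ln (INR (S n))))%C) (f s)) /\
  (forall s : C, s <> RtoC 1 -> analytic_at f s).

(* By the identity theorem is_riemann_zeta determines its argument on C \ {1};
   the value at the pole s = 1 is arbitrary. *)
Definition riemann_zeta : C -> C :=
  epsilon (inhabits (fun _ : C => RtoC 0)) is_riemann_zeta.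

(* Main.v *)
(* Averaging t |-> zeta(sigma + it) over [T, T + delta] against a compactly supported
   measure multiplies the n-th term of the Dirichlet series by the Fourier transform of that
   measure at log n.  By Ingham's construction the convergence of the integral of
   (1 - omega(t)) / (t log t) is exactly what allows this transform to beat the growth
   n^(1 - omega(T)) for n <= T^4, so that zeta is replaced, up to o(1), by an exponential sum
   with leading coefficient 1 and absolutely bounded total mass.  In the half-plane Re s > sigma
   such a sum is bounded and tends to its leading coefficient, so by a two-constants argument
   it cannot be small on a whole boundary interval; only the first term matters, and neither
   the Euler product nor zeros of zeta enter.  For bounded T one uses compactness and the
   identity theorem.

   The continuation of zeta, needed to know that riemann_zeta is not a junk value of epsilon,
   is obtained from Landau's recursion; the same double series yields the approximation of
   zeta by partial sums. *)

Require Import Defs.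
From Stdlib Require Import ZArith Reals Lra Lia Classical ClassicalEpsilon.
From Stdlib Require Import FunctionalExtensionality.
From Coquelicot Require Import Coquelicot.
Open Scope R_scope.

(** * Series *)

(** The obstacle is the fixed length of the interval: all averagings together may use width at most
    [delta / 2], yet frequency log n must be damped by n^(-eta), eta = 1 - omega(T), for every n up
    to a power of T. An average of width rho has multiplier at most 4 / (x rho) at frequency x, so
    widths 12 e_i / i gain a factor 1/3 as long as i <= x e_i, and they cost the sum of e_i / i.
    Sampling e_i = 1 - omega(exp(i / 8)) bounds that sum by the given integral, since log log t
    grows by about 1 / i per step; monotonicity of omega gives e_i >= eta for all i <= 8 log T.
    Three more averages of fixed width supply (log n)^(-3): two logarithms make the sum of 1 / (n
    log^2 n) converge, the third pays for a derivative, by which largeness at one point spreads to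
    an interval. Averages are finite equally spaced means, so multipliers are geometric sums and no
    Fourier integral occurs. Analyticity is mostly carried by power series with bounded absolute
    sums; products and Landau's series then reduce to interchanges of absolutely convergent double
    series. *)

Fixpoint rsum (f : nat -> R) (n : nat) : R :=
  match n with O => 0 | S m => rsum f m + f m end.

Fixpoint csum (f : nat -> C) (n : nat) : C :=
  match n with O => RtoC 0 | S m => (csum f m + f m)%C end.

Definition csums (f : nat -> C) (l : C) : Prop :=
  forall eps : R, 0 < eps -> exists N : nat, forall n : nat, (N <= n)%nat ->
    Cmod (csum f n - l) < eps.

Lemma rsum_ext (f g : nat -> R) n :
  (forall k, (k < n)%nat -> f k = g k) -> rsum f n = rsum g n.
Proof.
  induction n as [|n IH]; intros H; simpl; [reflexivity|].
  rewrite IH by (intros; apply H; lia). rewrite H by lia. reflexivity.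
Qed.

Lemma csum_ext (f g : nat -> C) n :
  (forall k, (k < n)%nat -> f k = g k) -> csum f n = csum g n.
Proof.
  induction n as [|n IH]; intros H; simpl; [reflexivity|].
  rewrite IH by (intros; apply H; lia). rewrite H by lia. reflexivity.
Qed.

Lemma rsum_le (f g : nat -> R) n :
  (forall k, (k < n)%nat -> f k <= g k) -> rsum f n <= rsum g n.
Proof.
  induction n as [|n IH]; intros H; simpl; [lra|].
  apply Rplus_le_compat; [apply IH; intros; apply H; lia|apply H; lia].
Qed.

Lemma rsum_plus f g n : rsum (fun k => f k + g k) n = rsum f n + rsum g n.
Proof. induction n as [|n IH]; simpl; [|rewrite IH]; ring. Qed.

Lemma rsum_scal c f n : rsum (fun k => c * f k) n = c * rsum f n.
Proof. induction n as [|n IH]; simpl; [|rewrite IH]; ring. Qed.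

Lemma rsum_const c n : rsum (fun _ => c) n = INR n * c.
Proof. induction n as [|n IH]; [simpl|rewrite S_INR; simpl; rewrite IH]; ring. Qed.

Lemma rsum_nonneg f n : (forall k, (k < n)%nat -> 0 <= f k) -> 0 <= rsum f n.
Proof.
  intros H. induction n as [|n IH]; simpl; [lra|].
  apply Rplus_le_le_0_compat; [apply IH; intros; apply H; lia|apply H; lia].
Qed.

Lemma rsum_mono f n m :
  (forall k, 0 <= f k) -> (n <= m)%nat -> rsum f n <= rsum f m.
Proof.
  intros H Hnm. induction Hnm; [lra|]. simpl. specialize (H m). lra.
Qed.

Lemma rsum_split f n m :
  rsum f (n + m) = rsum f n + rsum (fun k => f (n + k)%nat) m.
Proof.
  induction m as [|m IH]; [rewrite Nat.add_0_r; simpl; ring|].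
  rewrite Nat.add_succ_r. simpl. rewrite IH. ring.
Qed.

Lemma rsum_swap (f : nat -> nat -> R) n m :
  rsum (fun i => rsum (f i) m) n = rsum (fun k => rsum (fun i => f i k) n) m.
Proof.
  induction n as [|n IH]; simpl.
  - rewrite rsum_const. ring.
  - rewrite IH, <- rsum_plus. reflexivity.
Qed.

Lemma csum_plus f g n : csum (fun k => f k + g k)%C n = (csum f n + csum g n)%C.
Proof. induction n as [|n IH]; simpl; [|rewrite IH]; ring. Qed.

Lemma csum_scal c f n : csum (fun k => c * f k)%C n = (c * csum f n)%C.
Proof. induction n as [|n IH]; simpl; [|rewrite IH]; ring. Qed.

Lemma csum_0 n : csum (fun _ => RtoC 0) n = 0.
Proof. induction n as [|n IH]; simpl; [|rewrite IH]; ring. Qed.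

Lemma csum_RtoC f n : csum (fun k => RtoC (f k)) n = RtoC (rsum f n).
Proof.
  induction n as [|n IH]; simpl; [reflexivity|]. rewrite IH, RtoC_plus. reflexivity.
Qed.

Lemma csum_split f n m :
  csum f (n + m) = (csum f n + csum (fun k => f (n + k)%nat) m)%C.
Proof.
  induction m as [|m IH]; [rewrite Nat.add_0_r; simpl; ring|].
  rewrite Nat.add_succ_r. simpl. rewrite IH. ring.
Qed.

Lemma csum_swap (f : nat -> nat -> C) n m :
  csum (fun i => csum (f i) m) n = csum (fun k => csum (fun i => f i k) n) m.
Proof.
  induction n as [|n IH]; simpl.
  - rewrite csum_0. reflexivity.
  - rewrite IH, <- csum_plus. reflexivity.
Qed.

Lemma csum_Cmod f n : Cmod (csum f n) <= rsum (fun k => Cmod (f k)) n.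
Proof.
  induction n as [|n IH]; simpl; [rewrite Cmod_0; lra|].
  eapply Rle_trans; [apply Cmod_triangle|lra].
Qed.

Lemma csum_Cmod_diff f n m : (n <= m)%nat ->
  Cmod (csum f m - csum f n)
    <= rsum (fun k => Cmod (f k)) m - rsum (fun k => Cmod (f k)) n.
Proof.
  intros H. replace m with (n + (m - n))%nat by lia.
  rewrite csum_split, rsum_split.
  replace (csum f n + csum (fun k => f (n + k)%nat) (m - n) - csum f n)%C
    with (csum (fun k => f (n + k)%nat) (m - n)) by ring.
  pose proof (csum_Cmod (fun k => f (n + k)%nat) (m - n)). lra.
Qed.

Lemma Cmod_sub_sym (a b : C) : Cmod (a - b) = Cmod (b - a).
Proof. rewrite <- (Cmod_opp (a - b)). f_equal. ring. Qed.

Lemma Cmod_triangle3 (a b c : C) : Cmod (a - c) <= Cmod (a - b) + Cmod (b - c).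
Proof.
  replace (a - c)%C with ((a - b) + (b - c))%C by ring. apply Cmod_triangle.
Qed.

Lemma Cmod_triangle_minus (a b : C) : Cmod a - Cmod b <= Cmod (a + b).
Proof.
  pose proof (Cmod_triangle (a + b) (- b)) as H. rewrite Cmod_opp in H.
  replace (a + b + - b)%C with a in H by ring. lra.
Qed.

Lemma Cmod_small_0 (a : C) : (forall eps, 0 < eps -> Cmod a < eps) -> a = 0.
Proof.
  intros H. apply Cmod_eq_0. destruct (Cmod_ge_0 a) as [H0|H0]; [|auto].
  specialize (H _ H0). lra.
Qed.

Lemma csums_unique f l l' : csums f l -> csums f l' -> l = l'.
Proof.
  intros H H'. apply Ceq_minus. apply Cmod_small_0. intros eps He.
  destruct (H (eps / 2)) as [N HN]; [lra|]. destruct (H' (eps / 2)) as [N' HN']; [lra|].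
  specialize (HN (N + N')%nat ltac:(lia)). specialize (HN' (N + N')%nat ltac:(lia)).
  pose proof (Cmod_triangle3 l (csum f (N + N')) l').
  rewrite (Cmod_sub_sym l (csum _ _)) in H0. lra.
Qed.

Lemma csums_ext f g l : (forall k, f k = g k) -> csums f l -> csums g l.
Proof.
  intros H Hf eps He. destruct (Hf eps He) as [N HN]. exists N. intros n Hn.
  rewrite <- (csum_ext f) by auto. auto.
Qed.

Lemma csums_plus f g a b :
  csums f a -> csums g b -> csums (fun k => f k + g k)%C (a + b)%C.
Proof.
  intros H H' eps He.
  destruct (H (eps / 2)) as [N HN]; [lra|]. destruct (H' (eps / 2)) as [N' HN']; [lra|].
  exists (N + N')%nat. intros n Hn.
  specialize (HN n ltac:(lia)). specialize (HN' n ltac:(lia)).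
  rewrite csum_plus.
  replace (csum f n + csum g n - (a + b))%C
    with ((csum f n - a) + (csum g n - b))%C by ring.
  eapply Rle_lt_trans; [apply Cmod_triangle|lra].
Qed.

Lemma csums_scal c f a : csums f a -> csums (fun k => c * f k)%C (c * a)%C.
Proof.
  intros H eps He. pose proof (Cmod_ge_0 c).
  destruct (H (eps / (Cmod c + 1))) as [N HN]; [apply Rdiv_lt_0_compat; lra|].
  exists N. intros n Hn. specialize (HN n Hn). rewrite csum_scal.
  replace (c * csum f n - c * a)%C with (c * (csum f n - a))%C by ring.
  rewrite Cmod_mult.
  apply Rle_lt_trans with ((Cmod c) * (eps / (Cmod c + 1))).
  - apply Rmult_le_compat_l; lra.
  - replace (Cmod c * (eps / (Cmod c + 1))) with (eps - eps / (Cmod c + 1)) by (field; lra).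
    assert (0 < eps / (Cmod c + 1)) by (apply Rdiv_lt_0_compat; lra). lra.
Qed.

Lemma csums_shift n f l :
  csums (fun k => f (n + k)%nat) l <-> csums f (csum f n + l)%C.
Proof.
  split; intros H eps He; destruct (H eps He) as [N HN].
  - exists (n + N)%nat. intros m Hm. replace m with (n + (m - n))%nat by lia.
    rewrite csum_split. specialize (HN (m - n)%nat ltac:(lia)).
    match goal with |- Cmod ?a < _ => match type of HN with Cmod ?b < _ =>
      replace a with b by ring end end. exact HN.
  - exists N. intros m Hm. specialize (HN (n + m)%nat ltac:(lia)).
    rewrite csum_split in HN.
    match goal with |- Cmod ?a < _ => match type of HN with Cmod ?b < _ =>
      replace a with b by ring end end. exact HN.
Qed.

Lemma Cmod_limit_le f l B :
  csums f l -> (forall N, exists n, (N <= n)%nat /\ Cmod (csum f n) <= B) -> Cmod l <= B.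
Proof.
  intros H HB. apply Rnot_lt_le. intros Hlt.
  destruct (H (Cmod l - B)) as [N HN]; [lra|].
  destruct (HB N) as [n [Hn Hb]]. specialize (HN n Hn).
  pose proof (Cmod_triangle_minus l (csum f n - l)) as Ht.
  replace (l + (csum f n - l))%C with (csum f n) in Ht by ring. lra.
Qed.

Lemma csums_Cmod_le f l S :
  csums f l -> (forall N, rsum (fun k => Cmod (f k)) N <= S) -> Cmod l <= S.
Proof.
  intros H HS. apply (Cmod_limit_le f); [exact H|]. intros N. exists N. split; [lia|].
  eapply Rle_trans; [apply csum_Cmod|apply HS].
Qed.

Lemma rsum_tail (M : nat -> R) S : (forall n, 0 <= M n) -> (forall N, rsum M N <= S) ->
  forall eps, 0 < eps -> exists N, forall m n, (N <= m)%nat -> (m <= n)%nat ->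
    rsum M n - rsum M m <= eps.
Proof.
  intros H0 HS eps He.
  destruct (growing_cv (rsum M)) as [l Hl].
  - intros n. simpl. specialize (H0 n). lra.
  - exists S. intros x [n ->]. apply HS.
  - destruct (Hl (eps / 2)) as [N HN]; [lra|]. exists N. intros m n Hm Hn.
    pose proof (HN m ltac:(lia)) as A. pose proof (HN n ltac:(lia)) as B.
    unfold Rdist in A, B.
    apply Rabs_def2 in A. apply Rabs_def2 in B. lra.
Qed.

Lemma csums_ex (f : nat -> C) S :
  (forall N, rsum (fun k => Cmod (f k)) N <= S) -> exists l, csums f l.
Proof.
  intros HS.
  assert (Hc : forall g : nat -> R, (forall m n, (m <= n)%nat ->
      Rabs (g n - g m) <= rsum (fun k => Cmod (f k)) n - rsum (fun k => Cmod (f k)) m) ->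
      exists l, Un_cv g l).
  { intros g Hg. destruct (Rcomplete.R_complete g) as [l Hl]; [|exists l; exact Hl].
    intros eps He.
    destruct (rsum_tail (fun k => Cmod (f k)) S (fun n => Cmod_ge_0 _) HS (eps / 2))
      as [N HN]; [lra|].
    exists N. intros n m Hn Hm. unfold Rdist.
    destruct (Compare_dec.le_ge_dec n m) as [H|H].
    - rewrite Rabs_minus_sym. eapply Rle_lt_trans; [apply Hg; lia|].
      specialize (HN n m ltac:(lia) ltac:(lia)). lra.
    - eapply Rle_lt_trans; [apply Hg; lia|].
      specialize (HN m n ltac:(lia) ltac:(lia)). lra. }
  destruct (Hc (fun n => Re (csum f n))) as [x Hx].
  { intros m n Hmn. eapply Rle_trans; [|apply csum_Cmod_diff; exact Hmn].
    eapply Rle_trans; [|apply re_le_Cmod]. right. reflexivity. }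
  destruct (Hc (fun n => Im (csum f n))) as [y Hy].
  { intros m n Hmn. eapply Rle_trans; [|apply csum_Cmod_diff; exact Hmn].
    eapply Rle_trans; [|apply Rmax_Cmod].
    eapply Rle_trans; [|apply Rmax_r]. right. reflexivity. }
  exists (x, y). intros eps He.
  destruct (Hx (eps / 2)) as [N HN]; [lra|]. destruct (Hy (eps / 2)) as [N' HN']; [lra|].
  exists (N + N')%nat. intros n Hn.
  specialize (HN n ltac:(lia)). specialize (HN' n ltac:(lia)). unfold Rdist in *.
  pose proof (Cmod_2Rmax (csum f n - (x, y))%C) as Hm.
  assert (Rmax (Rabs (fst (csum f n - (x, y))%C)) (Rabs (snd (csum f n - (x, y))%C)) < eps / 2).
  { apply Rmax_lub_lt; assumption. }
  assert (sqrt 2 < 2).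
  { apply Rsqr_incrst_0; [rewrite Rsqr_sqrt; unfold Rsqr; lra|apply sqrt_pos|lra]. }
  pose proof (sqrt_pos 2).
  assert (0 <= Rmax (Rabs (fst (csum f n - (x, y))%C)) (Rabs (snd (csum f n - (x, y))%C))).
  { eapply Rle_trans; [apply Rabs_pos|apply Rmax_l]. }
  nra.
Qed.

(** Dominated convergence for series: the common majorant [M] makes all tails beyond some [N] small
    at once, and the first [N] terms converge one by one. The limit terms [w] inherit the
    majorant. *)
Lemma csums_tannery (v : nat -> nat -> C) (w : nat -> C) (M : nat -> R) S l :
  (forall n, 0 <= M n) -> (forall N, rsum M N <= S) ->
  (forall K n, Cmod (v K n) <= M n) ->
  (forall n eps, 0 < eps -> exists K0, forall K, (K0 <= K)%nat -> Cmod (v K n - w n) < eps) ->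
  csums w l ->
  forall eps, 0 < eps -> exists K0, forall K, (K0 <= K)%nat ->
    forall s, csums (v K) s -> Cmod (s - l) < eps.
Proof.
  intros H0 HS Hv Hw Hl eps He.
  destruct (rsum_tail M S H0 HS (eps / 8)) as [N HN]; [lra|].
  assert (Hw' : forall n, Cmod (w n) <= M n).
  { intros n. apply Rnot_lt_le. intros Hlt.
    destruct (Hw n (Cmod (w n) - M n)) as [K0 HK]; [lra|].
    specialize (HK K0 ltac:(lia)). specialize (Hv K0 n).
    pose proof (Cmod_triangle_minus (w n) (v K0 n - w n)) as Ht.
    replace (w n + (v K0 n - w n))%C with (v K0 n) in Ht by ring. lra. }
  assert (Hfin : exists K0, forall K, (K0 <= K)%nat -> Cmod (csum (v K) N - csum w N) < eps / 4).
  { clear HN. assert (He' : 0 < eps / 4) by lra. revert He'. generalize (eps / 4).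
    induction N as [|N IH]; intros e He'.
    - exists 0%nat. intros K _. simpl. replace (0 - 0)%C with (RtoC 0) by ring.
      rewrite Cmod_0. lra.
    - destruct (IH (e / 2)) as [K1 H1]; [lra|].
      destruct (Hw N (e / 2)) as [K2 H2]; [lra|].
      exists (K1 + K2)%nat. intros K HK. simpl.
      specialize (H1 K ltac:(lia)). specialize (H2 K ltac:(lia)).
      replace (csum (v K) N + v K N - (csum w N + w N))%C
        with ((csum (v K) N - csum w N) + (v K N - w N))%C by ring.
      eapply Rle_lt_trans; [apply Cmod_triangle|lra]. }
  assert (Htail : forall u s, (forall n, Cmod (u n) <= M n) -> csums u s ->
      Cmod (s - csum u N) <= eps / 8).
  { intros u s Hu Hs.
    apply (csums_Cmod_le (fun k => u (N + k)%nat)).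
    - apply csums_shift. replace (csum u N + (s - csum u N))%C with s by ring. exact Hs.
    - intros m. eapply Rle_trans; [apply (rsum_le _ (fun k => M (N + k)%nat)); auto|].
      specialize (HN N (N + m)%nat ltac:(lia) ltac:(lia)). rewrite rsum_split in HN. lra. }
  destruct Hfin as [K0 HK0]. exists K0. intros K HK s Hs. specialize (HK0 K HK).
  pose proof (Htail (v K) s (Hv K) Hs) as A. pose proof (Htail w l Hw' Hl) as B.
  pose proof (Cmod_triangle3 s (csum (v K) N) l).
  pose proof (Cmod_triangle3 (csum (v K) N) (csum w N) l).
  rewrite Cmod_sub_sym in B. lra.
Qed.

Lemma term_le_of_rsum_le (M : nat -> R) S k : (forall n, 0 <= M n) ->
  (forall N, rsum M N <= S) -> M k <= S.
Proof.
  intros H0 HS. specialize (HS (k + 1)%nat). rewrite rsum_split in HS. simpl in HS.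
  pose proof (rsum_nonneg M k (fun n _ => H0 n)). rewrite Nat.add_0_r in HS. lra.
Qed.

(** Interchange of summation, obtained by Tannery's theorem applied to the row sums truncated at
    [K], which are dominated by [M n] and tend to the full row sums. *)
Lemma csums_double (u : nat -> nat -> C) (M : nat -> R) S :
  (forall n K, rsum (fun k => Cmod (u n k)) K <= M n) ->
  (forall N, rsum M N <= S) ->
  exists (r c : nat -> C) (l : C),
    (forall n, csums (u n) (r n)) /\ (forall k, csums (fun n => u n k) (c k)) /\
    csums r l /\ csums c l /\ (forall K, rsum (fun k => Cmod (c k)) K <= S).
Proof.
  intros HM HS.
  assert (H0 : forall n, 0 <= M n).
  { intros n. exact (HM n 0%nat). }
  assert (Huk : forall n k, Cmod (u n k) <= M n).
  { intros n k. apply (term_le_of_rsum_le (fun k => Cmod (u n k))); [intros; apply Cmod_ge_0|apply HM]. }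
  assert (Hr : forall n, exists s, csums (u n) s).
  { intros n. apply (csums_ex _ (M n)). apply HM. }
  assert (Hc : forall k, exists s, csums (fun n => u n k) s).
  { intros k. apply (csums_ex _ S). intros N. eapply Rle_trans; [|apply (HS N)].
    apply rsum_le. auto. }
  set (r := fun n => proj1_sig (constructive_indefinite_description _ (Hr n))).
  set (c := fun k => proj1_sig (constructive_indefinite_description _ (Hc k))).
  assert (Er : forall n, csums (u n) (r n)).
  { intros n. unfold r. apply proj2_sig. }
  assert (Ec : forall k, csums (fun n => u n k) (c k)).
  { intros n. unfold c. apply proj2_sig. }
  destruct (csums_ex r S) as [l Hl].
  { intros N. eapply Rle_trans; [|apply (HS N)]. apply rsum_le. intros n _.
    apply (csums_Cmod_le (u n)); auto. }
  assert (Hfin : forall K, csums (fun n => csum (u n) K) (csum c K)).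
  { induction K as [|K IH]; simpl.
    - intros eps He. exists 0%nat. intros n _. rewrite csum_0.
      replace (0 - 0)%C with (RtoC 0) by ring. rewrite Cmod_0. exact He.
    - apply csums_plus; auto. }
  exists r, c, l. repeat split; auto.
  - intros eps He.
    destruct (csums_tannery (fun K n => csum (u n) K) r M S l H0 HS) with (eps := eps)
      as [K0 HK0]; auto.
    + intros K n. eapply Rle_trans; [apply csum_Cmod|apply HM].
    + exists K0. intros K HK. apply (HK0 K HK). apply Hfin.
  - intros K.
    (* The bound on the column sums holds for columns cut at [N] rows, where the finite sums swap;
       it survives as [N] grows because only [K] columns are involved. *)
    assert (forall N, rsum (fun k => Cmod (csum (fun n => u n k) N)) K <= S).
    { intros N. eapply Rle_trans; [|apply (HS N)].
      eapply Rle_trans; [apply rsum_le; intros; apply csum_Cmod|].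
      rewrite <- (rsum_swap (fun n k => Cmod (u n k))). apply rsum_le. auto. }
    apply Rnot_lt_le. intros Hlt.
    assert (HN : forall eps, 0 < eps -> exists N,
        rsum (fun k => Cmod (c k)) K <= rsum (fun k => Cmod (csum (fun n => u n k) N)) K + eps).
    { clear Hlt H. intros eps He.
      assert (exists N0, forall N, (N0 <= N)%nat ->
        rsum (fun k => Cmod (c k)) K <= rsum (fun k => Cmod (csum (fun n => u n k) N)) K + eps)
        as [N0 HN0]; [|exists N0; apply HN0; lia].
      revert eps He. induction K as [|K IH]; intros eps He.
      - exists 0%nat. intros. simpl. lra.
      - destruct (IH (eps / 2)) as [N1 H1]; [lra|].
        destruct (Ec K (eps / 2)) as [N2 H2]; [lra|].
        exists (N1 + N2)%nat. intros N HN. specialize (H1 N ltac:(lia)).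
        specialize (H2 N ltac:(lia)). simpl.
        pose proof (Cmod_triangle_minus (c K) (csum (fun n => u n K) N - c K)) as Ht.
        replace (c K + (csum (fun n => u n K) N - c K))%C
          with (csum (fun n => u n K) N) in Ht by ring. lra. }
    destruct (HN ((rsum (fun k => Cmod (c k)) K - S) / 2)) as [N HN']; [lra|].
    specialize (H N). lra.
Qed.

Lemma sum_n_csum (f : nat -> C) n : @sum_n C_AbelianMonoid f n = csum f (S n).
Proof.
  induction n as [|n IH].
  - rewrite sum_O. simpl. ring.
  - rewrite sum_Sn, IH. reflexivity.
Qed.

(** [sum_n] includes its upper index while [csum] stops before it, so the thresholds differ by
    one. *)
Lemma csums_is_series (f : nat -> C) l :
  csums f l <-> @is_series C_AbsRing C_NormedModule f l.
Proof.
  split.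
  - intros H. apply filterlim_locally_ball_norm. intros eps.
    destruct (H eps (cond_pos eps)) as [N HN]. exists N. intros n Hn.
    unfold ball_norm. change (norm (minus ?a l)) with (Cmod (a - l)%C).
    pose proof (sum_n_csum f n) as E. specialize (HN (S n) ltac:(lia)).
    rewrite <- E in HN. exact HN.
  - intros H eps He.
    pose proof (proj1 (filterlim_locally_ball_norm _ _) H (mkposreal eps He)) as [N HN].
    exists (S N). intros n Hn. destruct n as [|n]; [lia|].
    specialize (HN n ltac:(lia)). rewrite <- sum_n_csum. exact HN.
Qed.

(** * The exponential and binomial series *)

Lemma Ceq (a b : C) : Re a = Re b -> Im a = Im b -> a = b.
Proof. destruct a, b; simpl; intros; subst; reflexivity. Qed.

Lemma Cexp_plus (a b : C) : Cexp (a + b) = (Cexp a * Cexp b)%C.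
Proof.
  destruct a as [x y], b as [x' y']. unfold Cexp; simpl.
  rewrite exp_plus, cos_plus, sin_plus. apply Ceq; simpl; ring.
Qed.

Lemma Cmod_Cexp (z : C) : Cmod (Cexp z) = exp (Re z).
Proof.
  unfold Cexp, Cmod; simpl.
  replace (exp (Re z) * cos (Im z) * (exp (Re z) * cos (Im z) * 1) +
    exp (Re z) * sin (Im z) * (exp (Re z) * sin (Im z) * 1))
    with (Rsqr (exp (Re z)) * (Rsqr (sin (Im z)) + Rsqr (cos (Im z)))) by (unfold Rsqr; ring).
  rewrite sin2_cos2, Rmult_1_r. apply sqrt_Rsqr. left. apply exp_pos.
Qed.

Lemma Cexp_0 : Cexp 0 = 1.
Proof. unfold Cexp; simpl. rewrite exp_0, cos_0, sin_0. apply Ceq; simpl; ring. Qed.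

Lemma Cexp_RtoC (x : R) : Cexp (RtoC x) = RtoC (exp x).
Proof. unfold Cexp; simpl. rewrite cos_0, sin_0. apply Ceq; simpl; ring. Qed.

(** * Derivative estimates along a real parameter *)

Definition Cderiv (F : R -> C) (x : R) (d : C) : Prop :=
  is_derive (fun t => Re (F t)) x (Re d) /\ is_derive (fun t => Im (F t)) x (Im d).

Lemma Cderiv_const c x : Cderiv (fun _ => c) x 0.
Proof. split; simpl; apply @is_derive_const. Qed.

Lemma Cderiv_plus F G x a b :
  Cderiv F x a -> Cderiv G x b -> Cderiv (fun t => F t + G t)%C x (a + b)%C.
Proof.
  intros [H1 H2] [H3 H4]; split; simpl.
  - apply (is_derive_plus (fun t => Re (F t)) (fun t => Re (G t))); assumption.
  - apply (is_derive_plus (fun t => Im (F t)) (fun t => Im (G t))); assumption.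
Qed.

Lemma Cderiv_scal c F x a : Cderiv F x a -> Cderiv (fun t => c * F t)%C x (c * a)%C.
Proof.
  intros [H1 H2]; split; simpl.
  - apply (is_derive_minus (fun t => fst c * Re (F t)) (fun t => snd c * Im (F t)));
      apply @is_derive_scal; assumption.
  - apply (is_derive_plus (fun t => fst c * Im (F t)) (fun t => snd c * Re (F t)));
      apply @is_derive_scal; assumption.
Qed.

Lemma Cderiv_RtoC (f : R -> R) x d : is_derive f x d -> Cderiv (fun t => RtoC (f t)) x (RtoC d).
Proof. intros H; split; simpl; [exact H|apply @is_derive_const]. Qed.

Lemma Cderiv_Cexp c (f : R -> R) x d : is_derive f x d ->
  Cderiv (fun t => Cexp (c * RtoC (f t))) x (c * RtoC d * Cexp (c * RtoC (f x)))%C.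
Proof.
  intros H. destruct c as [a b]. split; simpl.
  - evar_last.
    + apply (is_derive_ext (fun t => exp (a * f t) * cos (b * f t))).
      { intros t. f_equal; f_equal; ring. }
      apply @is_derive_mult; [| |intros; apply Rmult_comm].
      * apply (is_derive_comp exp (fun t => a * f t)); [apply is_derive_exp|].
        apply @is_derive_scal, H.
      * apply (is_derive_comp cos (fun t => b * f t)); [apply is_derive_cos|].
        apply @is_derive_scal, H.
    + unfold plus, mult, scal; simpl. unfold mult; simpl.
      replace (a * f x - b * 0) with (a * f x) by ring.
      replace (a * 0 + b * f x) with (b * f x) by ring. ring.
  - evar_last.
    + apply (is_derive_ext (fun t => exp (a * f t) * sin (b * f t))).
      { intros t. f_equal; f_equal; ring. }
      apply @is_derive_mult; [| |intros; apply Rmult_comm].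
      * apply (is_derive_comp exp (fun t => a * f t)); [apply is_derive_exp|].
        apply @is_derive_scal, H.
      * apply (is_derive_comp sin (fun t => b * f t)); [apply is_derive_sin|].
        apply @is_derive_scal, H.
    + unfold plus, mult, scal; simpl. unfold mult; simpl.
      replace (a * f x - b * 0) with (a * f x) by ring.
      replace (a * 0 + b * f x) with (b * f x) by ring. ring.
Qed.

Lemma is_derive_nondecr (f df : R -> R) a b : a <= b ->
  (forall x, a <= x <= b -> is_derive f x (df x)) ->
  (forall x, a <= x <= b -> 0 <= df x) -> f a <= f b.
Proof.
  intros Hab Hd H0.
  destruct (MVT_gen f a b df) as [c [Hc E]].
  - intros x Hx. rewrite Rmin_left, Rmax_right in Hx by lra. apply Hd; lra.
  - intros x Hx. rewrite Rmin_left, Rmax_right in Hx by lra.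
    apply continuity_pt_filterlim. apply @ex_derive_continuous. eexists. apply Hd; lra.
  - rewrite Rmin_left, Rmax_right in Hc by lra. specialize (H0 c Hc).
    assert (0 <= df c * (b - a)) by (apply Rmult_le_pos; lra). lra.
Qed.

Lemma Cmod_sqr (z : C) : Cmod z * Cmod z = Re z * Re z + Im z * Im z.
Proof. replace (Cmod z * Cmod z) with (Cmod z ^ 2) by ring. rewrite Cmod2_alt. ring. Qed.

Lemma Re_conj_mult_le (u v : C) : Re u * Re v + Im u * Im v <= Cmod u * Cmod v.
Proof.
  pose proof (re_le_Cmod (Cconj u * v)%C) as H. rewrite Cmod_mult, Cmod_conj in H.
  destruct u, v; simpl in *.
  apply Rabs_le_between in H.
  destruct H. simpl in *. lra.
Qed.

(* Projecting F onto the direction of F b reduces this to the real mean value theorem. *)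
Lemma Cmod_le_of_derivative (F F' : R -> C) (B B' : R -> R) b : 0 <= b ->
  (forall x, 0 <= x <= b -> Cderiv F x (F' x)) ->
  (forall x, 0 <= x <= b -> is_derive B x (B' x)) ->
  (forall x, 0 <= x <= b -> Cmod (F' x) <= B' x) ->
  Cmod (F 0) <= B 0 -> Cmod (F b) <= B b.
Proof.
  intros Hb HF HB Hle H0.
  assert (HB0 : B 0 <= B b).
  { apply (is_derive_nondecr B B'); auto. intros x Hx. eapply Rle_trans; [apply Cmod_ge_0|auto]. }
  set (u := F b).
  assert (H : Cmod u * B 0 - (Re u * Re (F 0) + Im u * Im (F 0))
     <= Cmod u * B b - (Re u * Re (F b) + Im u * Im (F b))).
  { apply (is_derive_nondecr
      (fun x => Cmod u * B x - (Re u * Re (F x) + Im u * Im (F x)))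
      (fun x => Cmod u * B' x - (Re u * Re (F' x) + Im u * Im (F' x)))); auto.
    - intros x Hx. destruct (HF x Hx) as [H1 H2].
      apply (is_derive_minus (fun x => Cmod u * B x)
               (fun x => Re u * Re (F x) + Im u * Im (F x))).
      + apply @is_derive_scal; auto.
      + apply (is_derive_plus (fun x => Re u * Re (F x)) (fun x => Im u * Im (F x)));
          apply @is_derive_scal; auto.
    - intros x Hx. pose proof (Re_conj_mult_le u (F' x)). specialize (Hle x Hx).
      pose proof (Cmod_ge_0 u). nra. }
  fold u. pose proof (Re_conj_mult_le u (F 0)). pose proof (Cmod_ge_0 u).
  pose proof (Cmod_sqr u). fold u in H.
  assert (0 <= Cmod u * (B 0 - Cmod (F 0))) by (apply Rmult_le_pos; lra).
  assert (Cmod u * Cmod u <= Cmod u * B b) by lra.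
  destruct (Req_dec (Cmod u) 0) as [E|E].
  - rewrite E. pose proof (Cmod_ge_0 (F 0)). lra.
  - apply Rmult_le_reg_l with (Cmod u); lra.
Qed.

Lemma csums_of_geometric_error (l : C) (f : nat -> C) (t B : R) : 0 <= t < 1 ->
  (forall K, Cmod (csum f K - l) <= t ^ K * B) -> csums f l.
Proof.
  intros Ht H eps He.
  assert (HB : 0 <= B).
  { specialize (H 0%nat). simpl in H. pose proof (Cmod_ge_0 (0 - l)). lra. }
  destruct (pow_lt_1_zero t) with (y := eps / (B + 1)) as [N HN].
  - rewrite Rabs_pos_eq; lra.
  - apply Rdiv_lt_0_compat; lra.
  - exists N. intros n Hn. specialize (HN n Hn). specialize (H n).
    rewrite Rabs_pos_eq in HN by (apply pow_le; lra).
    assert (0 <= t ^ n) by (apply pow_le; lra).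
    apply Rle_lt_trans with (t ^ n * (B + 1)); [nra|].
    apply Rmult_lt_reg_r with (/ (B + 1)); [apply Rinv_0_lt_compat; lra|].
    rewrite Rmult_assoc, Rinv_r, Rmult_1_r by lra. exact HN.
Qed.

Lemma csum_S_head (f : nat -> C) K : csum f (S K) = (f O + csum (fun k => f (S k)) K)%C.
Proof.
  change (S K) with (1 + K)%nat. rewrite csum_split. simpl. ring.
Qed.

Lemma Cderiv_monomial (c : C) (k : nat) x :
  Cderiv (fun x => c * RtoC (x ^ S k))%C x (c * RtoC (INR (S k) * x ^ k))%C.
Proof.
  apply Cderiv_scal, Cderiv_RtoC. auto_derive; [trivial|].
  replace (pred (S k)) with k by reflexivity. rewrite S_INR. simpl.
  destruct k; [simpl; ring|rewrite S_INR; ring].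
Qed.

Definition expc (z : C) (k : nat) : C := (z ^ k * RtoC (/ INR (Factorial.fact k)))%C.

Lemma RtoC_neq (x : R) : x <> 0 -> RtoC x <> 0.
Proof. intros H E. apply H. apply RtoC_inj. exact E. Qed.

Lemma expc_S z k : (expc z (S k) * RtoC (INR (S k)))%C = (z * expc z k)%C.
Proof.
  unfold expc. rewrite Cpow_S. change (Factorial.fact (S k)) with (S k * Factorial.fact k)%nat.
  rewrite mult_INR, !RtoC_inv, RtoC_mult.
  - field. split; apply RtoC_neq; [apply INR_fact_neq_0|apply not_0_INR; lia].
  - apply INR_fact_neq_0.
  - apply Rmult_integral_contrapositive_currified; [apply not_0_INR; lia|apply INR_fact_neq_0].
Qed.

Lemma Cderiv_ext F G x d : (forall t, F t = G t) -> Cderiv F x d -> Cderiv G x d.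
Proof.
  intros H [H1 H2]; split.
  - eapply is_derive_ext; [|exact H1]. intros t; simpl. rewrite H. reflexivity.
  - eapply is_derive_ext; [|exact H2]. intros t; simpl. rewrite H. reflexivity.
Qed.

Lemma Cderiv_power_sum (c : nat -> C) K x :
  Cderiv (fun x => csum (fun k => c k * RtoC (x ^ k)) (S K))%C x
         (csum (fun k => c (S k) * RtoC (INR (S k)) * RtoC (x ^ k)) K)%C.
Proof.
  induction K as [|K IH].
  - simpl. apply (Cderiv_ext (fun _ => c O)); [intros; simpl; ring|apply Cderiv_const].
  - change (Cderiv (fun x => csum (fun k => c k * RtoC (x ^ k)) (S K) + c (S K) * RtoC (x ^ S K))%C x
         (csum (fun k => c (S k) * RtoC (INR (S k)) * RtoC (x ^ k)) K
           + c (S K) * RtoC (INR (S K)) * RtoC (x ^ K))%C).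
    apply Cderiv_plus; [exact IH|].
    replace (c (S K) * RtoC (INR (S K)) * RtoC (x ^ K))%C
      with (c (S K) * RtoC (INR (S K) * x ^ K))%C by (rewrite RtoC_mult; ring).
    apply Cderiv_monomial.
Qed.

Lemma csum_power_0 (c : nat -> C) K : csum (fun k => c k * RtoC (0 ^ k))%C (S K) = c O.
Proof.
  induction K as [|K IH]; [simpl; ring|].
  change (csum (fun k => c k * RtoC (0 ^ k))%C (S K) + c (S K) * RtoC (0 ^ S K) = c O)%C.
  rewrite IH. rewrite pow_i by lia. ring.
Qed.

Lemma Cderiv_to (f : R -> C) x d d' : Cderiv f x d -> d = d' -> Cderiv f x d'.
Proof. intros H <-; exact H. Qed.

(* The parameter t carries the geometric decay: differentiating in x lowers K by one
   and produces one factor t. *)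
Lemma exp_remainder (z : C) (t : R) K : 0 <= t <= 1 -> forall x, 0 <= x ->
  Cmod (Cexp (z * RtoC (t * x)) - csum (fun k => expc (z * RtoC t) k * RtoC (x ^ k))%C K)
    <= t ^ K * exp (Cmod z * x).
Proof.
  intros Ht. induction K as [|K IH]; intros x Hx.
  - simpl. replace (Cexp (z * RtoC (t * x)) - 0)%C with (Cexp (z * RtoC (t * x))) by ring.
    rewrite Cmod_Cexp, Rmult_1_l.
    assert (Hm : Re (z * RtoC (t * x))%C <= Cmod z * x).
    { eapply Rle_trans; [apply Rle_abs|]. eapply Rle_trans; [apply re_le_Cmod|].
      rewrite Cmod_mult, Cmod_R, Rabs_pos_eq by nra. apply Rmult_le_compat_l; [apply Cmod_ge_0|nra]. }
    destruct Hm as [Hm| ->]; [left; apply exp_increasing; exact Hm|right; reflexivity].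
  - apply (Cmod_le_of_derivative
      (fun x => Cexp (z * RtoC (t * x)) + (- (1)) * csum (fun k => expc (z * RtoC t) k * RtoC (x ^ k))%C (S K))%C
      (fun x => (z * RtoC t) * (Cexp (z * RtoC (t * x)) - csum (fun k => expc (z * RtoC t) k * RtoC (x ^ k))%C K))%C
      (fun x => t ^ S K * exp (Cmod z * x))
      (fun x => Cmod z * t * (t ^ K * exp (Cmod z * x)))) in Hx as H.
    + replace (Cexp (z * RtoC (t * x)) - csum (fun k => expc (z * RtoC t) k * RtoC (x ^ k))%C (S K))%C
        with (Cexp (z * RtoC (t * x)) + (- (1)) * csum (fun k => expc (z * RtoC t) k * RtoC (x ^ k))%C (S K))%C by ring.
      exact H.
    + intros y Hy. eapply Cderiv_to.
      * apply Cderiv_plus; [apply (Cderiv_Cexp z (fun x => t * x) y t)|apply Cderiv_scal, Cderiv_power_sum].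
        auto_derive; [trivial|ring].
      * rewrite (csum_ext (fun k => expc (z * RtoC t) (S k) * RtoC (INR (S k)) * RtoC (y ^ k))%C
          (fun k => (z * RtoC t) * (expc (z * RtoC t) k * RtoC (y ^ k)))%C).
        2:{ intros k _. rewrite expc_S. ring. }
        rewrite csum_scal. ring.
    + intros y Hy. auto_derive; [trivial|]. simpl. ring.
    + intros y Hy. rewrite !Cmod_mult, Cmod_R, (Rabs_pos_eq t) by lra.
      apply Rmult_le_compat_l; [apply Rmult_le_pos; [apply Cmod_ge_0|lra]|].
      apply IH; lra.
    + rewrite csum_power_0. unfold expc. simpl.
      replace (z * RtoC (t * 0))%C with (RtoC 0) by (rewrite Rmult_0_r; ring).
      rewrite Cexp_0. rewrite Rinv_1.
      match goal with |- Cmod ?a <= _ => replace a with (RtoC 0) by ring end.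
      rewrite Cmod_0. apply Rmult_le_pos; [apply Rmult_le_pos; [lra|apply pow_le; lra]|left; apply exp_pos].
Qed.

Lemma csums_Cexp (z : C) : csums (expc z) (Cexp z).
Proof.
  (* The remainder estimate is used with t = 1/2 and x = 2: then t x = 1, so the series is that of
     [Cexp z], while t^K still decays. *)
  apply (csums_of_geometric_error _ _ (1 / 2) (exp (Cmod z * 2))); [lra|]. intros K.
  pose proof (exp_remainder z (1 / 2) K ltac:(lra) 2 ltac:(lra)) as H.
  rewrite Cmod_sub_sym.
  replace (z * RtoC (1 / 2 * 2))%C with z in H
    by (replace (1 / 2 * 2) with 1 by field; ring).
  rewrite (csum_ext _ (expc z)) in H; [exact H|].
  intros k _. unfold expc. rewrite Cpow_mult_l, <- RtoC_pow.
  replace (z ^ k * RtoC ((1 / 2) ^ k) * RtoC (/ INR (Factorial.fact k)) * RtoC (2 ^ k))%C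
    with (z ^ k * RtoC (/ INR (Factorial.fact k)) * (RtoC ((1 / 2) ^ k) * RtoC (2 ^ k)))%C by ring.
  rewrite <- RtoC_mult, <- Rpow_mult_distr. replace (1 / 2 * 2) with 1 by field.
  rewrite pow1. ring.
Qed.

Lemma exp_partial_le (x : R) K : 0 <= x ->
  rsum (fun k => x ^ k * / INR (Factorial.fact k)) K <= exp x.
Proof.
  intros Hx.
  assert (Hn : forall k, 0 <= x ^ k * / INR (Factorial.fact k)).
  { intros k. apply Rmult_le_pos; [apply pow_le; exact Hx|].
    left. apply Rinv_0_lt_compat, INR_fact_lt_0. }
  apply Rnot_lt_le. intros Hlt.
  destruct (csums_Cexp (RtoC x) (rsum (fun k => x ^ k * / INR (Factorial.fact k)) K - exp x))
    as [N HN]; [lra|].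
  specialize (HN (N + K)%nat ltac:(lia)).
  rewrite (csum_ext _ (fun k => RtoC (x ^ k * / INR (Factorial.fact k)))) in HN.
  2:{ intros k _. unfold expc. rewrite <- RtoC_pow, <- RtoC_mult. reflexivity. }
  rewrite csum_RtoC, Cexp_RtoC, <- RtoC_minus, Cmod_R in HN.
  apply Rabs_def2 in HN.
  pose proof (rsum_mono _ K (N + K) Hn ltac:(lia)). lra.
Qed.

(* (a)_k / k!, so that (1 - x)^(-a) = sum of cbin a k * x^k for |x| < 1. *)
Fixpoint cbin (a : C) (k : nat) : C :=
  match k with
  | O => RtoC 1
  | S j => (cbin a j * ((a + RtoC (INR j)) * RtoC (/ INR (S j))))%C
  end.

Fixpoint rbin (a : R) (k : nat) : R :=
  match k with
  | O => 1
  | S j => rbin a j * ((a + INR j) * / INR (S j))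
  end.

Lemma rbin_nonneg a k : 0 <= a -> 0 <= rbin a k.
Proof.
  intros Ha. induction k as [|k IH]; [simpl; lra|].
  change (0 <= rbin a k * ((a + INR k) * / INR (S k))).
  apply Rmult_le_pos; [exact IH|]. apply Rmult_le_pos; [pose proof (pos_INR k); lra|].
  left. apply Rinv_0_lt_compat, lt_0_INR. lia.
Qed.

Lemma cbin_RtoC a k : cbin (RtoC a) k = RtoC (rbin a k).
Proof.
  induction k as [|k IH]; [reflexivity|].
  change (cbin (RtoC a) k * ((RtoC a + RtoC (INR k)) * RtoC (/ INR (S k)))
    = RtoC (rbin a k * ((a + INR k) * / INR (S k))))%C.
  rewrite IH, !RtoC_mult, RtoC_plus. reflexivity.
Qed.

Lemma cbin_le (a : C) b k : Cmod a <= b -> Cmod (cbin a k) <= rbin b k.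
Proof.
  intros Ha. induction k as [|k IH]; [simpl; rewrite Cmod_1; lra|].
  change (Cmod (cbin a k * ((a + RtoC (INR k)) * RtoC (/ INR (S k))))
     <= rbin b k * ((b + INR k) * / INR (S k))).
  rewrite !Cmod_mult, (Cmod_R (/ _)).
  assert (0 < / INR (S k)) by (apply Rinv_0_lt_compat, lt_0_INR; lia).
  rewrite (Rabs_pos_eq (/ _)) by lra.
  apply Rmult_le_compat; try apply Cmod_ge_0; auto.
  - apply Rmult_le_pos; [apply Cmod_ge_0|lra].
  - apply Rmult_le_compat_r; [lra|]. eapply Rle_trans; [apply Cmod_triangle|].
    rewrite Cmod_R, Rabs_pos_eq by apply pos_INR. lra.
Qed.

(** The coefficient form of the fact that (1 - x)^(-a) has derivative a (1 - x)^(-a-1). *)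
Lemma cbin_S_shift (a : C) k : (cbin a (S k) * RtoC (INR (S k)) = a * cbin (a + 1) k)%C.
Proof.
  assert (Hk : forall k, (cbin a (S k) * RtoC (INR (S k)) = cbin a k * (a + RtoC (INR k)))%C).
  { intros j. change (cbin a j * ((a + RtoC (INR j)) * RtoC (/ INR (S j))) * RtoC (INR (S j))
      = cbin a j * (a + RtoC (INR j)))%C.
    rewrite RtoC_inv by (apply not_0_INR; lia). field. apply RtoC_neq, not_0_INR; lia. }
  induction k as [|k IH]; [simpl; rewrite Rinv_1; ring|].
  rewrite Hk.
  change (cbin (a + 1) (S k))
    with (cbin (a + 1) k * ((a + 1 + RtoC (INR k)) * RtoC (/ INR (S k))))%C.
  assert (HS : RtoC (INR (S k)) <> 0) by (apply RtoC_neq, not_0_INR; lia).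
  replace (cbin a (S k)) with (a * cbin (a + 1) k / RtoC (INR (S k)))%C
    by (rewrite <- IH; field; exact HS).
  rewrite RtoC_inv by (apply not_0_INR; lia).
  rewrite S_INR at 2. rewrite RtoC_plus. field. exact HS.
Qed.

Lemma is_derive_ln_one_minus t x : t * x < 1 ->
  is_derive (fun x => ln (1 - t * x)) x (- t / (1 - t * x)).
Proof. intros H. auto_derive; [lra|]. field. lra. Qed.

Lemma exp_mono x y : x <= y -> exp x <= exp y.
Proof. intros [H| ->]; [left; apply exp_increasing; exact H|right; reflexivity]. Qed.

(** Same scheme as [exp_remainder]. Differentiation in x lowers K but raises a to a + 1, so [a] and
    its majorant [b] must be quantified after the induction on K is set up. *)
Lemma binomial_remainder (t : R) K : 0 <= t <= 1 -> forall (a : C) (b x : R),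
  Cmod a <= b -> 0 <= x < 1 ->
  Cmod (Cexp (- a * RtoC (ln (1 - t * x))) - csum (fun k => cbin a k * RtoC (t ^ k) * RtoC (x ^ k))%C K)
    <= t ^ K * exp (- b * ln (1 - x)).
Proof.
  intros Ht. induction K as [|K IH]; intros a b x Hab Hx.
  - simpl. match goal with |- Cmod (?u - _) <= _ => replace (u - 0)%C with u by ring end.
    rewrite Cmod_Cexp, Rmult_1_l. apply exp_mono.
    assert (Hln : ln (1 - x) <= ln (1 - t * x) <= 0).
    { split; [apply ln_le; nra|]. rewrite <- ln_1. apply ln_le; nra. }
    rewrite re_scal_r, re_opp.
    assert (Re a <= b).
    { eapply Rle_trans; [apply Rle_abs|]. eapply Rle_trans; [apply re_le_Cmod|exact Hab]. }
    assert (0 <= b) by (eapply Rle_trans; [apply Cmod_ge_0|exact Hab]). nra.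
  - set (F := fun x => (Cexp (- a * RtoC (ln (1 - t * x)))
        + (- (1)) * csum (fun k => cbin a k * RtoC (t ^ k) * RtoC (x ^ k))%C (S K))%C).
    assert (H : Cmod (F x) <= t ^ S K * exp (- b * ln (1 - x))).
    { apply (Cmod_le_of_derivative F
      (fun x => a * RtoC t * (Cexp (- (a + 1) * RtoC (ln (1 - t * x)))
          - csum (fun k => cbin (a + 1) k * RtoC (t ^ k) * RtoC (x ^ k)) K))%C
      (fun x => t ^ S K * exp (- b * ln (1 - x)))
      (fun x => b * t * (t ^ K * exp (- (b + 1) * ln (1 - x))))); [lra| | | |].
      + intros y Hy. assert (Hty : t * y < 1) by nra.
        eapply Cderiv_to.
        * apply Cderiv_plus; [apply (Cderiv_Cexp (- a) (fun x => ln (1 - t * x)) y (- t / (1 - t * y)))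
            |apply Cderiv_scal, Cderiv_power_sum].
          apply is_derive_ln_one_minus; exact Hty.
        * rewrite (csum_ext (fun k => cbin a (S k) * RtoC (t ^ S k) * RtoC (INR (S k)) * RtoC (y ^ k))%C
            (fun k => (a * RtoC t) * (cbin (a + 1) k * RtoC (t ^ k) * RtoC (y ^ k)))%C).
          2:{ intros k _.
              replace (cbin a (S k) * RtoC (t ^ S k) * RtoC (INR (S k)) * RtoC (y ^ k))%C
                with ((cbin a (S k) * RtoC (INR (S k))) * RtoC (t ^ S k) * RtoC (y ^ k))%C by ring.
              rewrite cbin_S_shift. simpl pow. rewrite RtoC_mult. ring. }
          rewrite csum_scal.
          replace (- (a + 1) * RtoC (ln (1 - t * y)))%C
            with (- a * RtoC (ln (1 - t * y)) + RtoC (- ln (1 - t * y)))%C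
            by (rewrite RtoC_opp; ring).
          rewrite Cexp_plus, Cexp_RtoC, exp_Ropp, exp_ln by lra.
          unfold Rdiv. rewrite RtoC_mult, RtoC_opp. ring.
      + intros y Hy. auto_derive; [lra|].
        replace (- (b + 1) * ln (1 - y)) with (- b * ln (1 - y) + - ln (1 - y)) by ring.
        rewrite exp_plus, exp_Ropp, exp_ln by lra. simpl. replace (1 + - y) with (1 - y) by ring. field. lra.
      + intros y Hy. rewrite !Cmod_mult, Cmod_R, (Rabs_pos_eq t) by lra.
        apply Rmult_le_compat; [|apply Cmod_ge_0| |].
        * apply Rmult_le_pos; [apply Cmod_ge_0|lra].
        * apply Rmult_le_compat_r; lra.
        * apply IH; [|lra]. eapply Rle_trans; [apply Cmod_triangle|]. rewrite Cmod_1. lra.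
      + unfold F.
        rewrite (csum_power_0 (fun k => cbin a k * RtoC (t ^ k))%C). simpl.
        rewrite Rmult_0_r, Rminus_0_r, ln_1.
        replace (- a * 0)%C with (RtoC 0) by ring. rewrite Cexp_0.
        match goal with |- Cmod ?a <= _ => replace a with (RtoC 0) by ring end.
        rewrite Cmod_0.
        apply Rmult_le_pos; [apply Rmult_le_pos; [lra|apply pow_le; lra]|left; apply exp_pos]. }
    unfold F in H.
    match goal with |- Cmod ?a <= _ => match type of H with Cmod ?b <= _ =>
      replace a with b by ring end end. exact H.
Qed.

Lemma binomial_series (a : C) (x : R) : 0 <= x < 1 ->
  csums (fun k => cbin a k * RtoC (x ^ k))%C (Cexp (- a * RtoC (ln (1 - x)))).
Proof.
  intros Hx.
  (* A point strictly between x and 1 leaves room for a ratio t < 1 with t y = x, which gives the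
     geometric decay t^K. *)
  set (y := (1 + x) / 2). set (t := x / y).
  assert (Hy : x < y < 1 /\ 0 < y) by (unfold y; lra).
  assert (Ht : t * y = x) by (unfold t; field; lra).
  assert (H01 : 0 <= t < 1).
  { split; [unfold t; apply Rdiv_le_0_compat; lra|].
    apply Rmult_lt_reg_r with y; lra. }
  apply (csums_of_geometric_error _ _ t (exp (- Cmod a * ln (1 - y)))); [exact H01|]. intros K.
  pose proof (binomial_remainder t K ltac:(lra) a (Cmod a) y ltac:(lra) ltac:(lra)) as H.
  rewrite Ht in H. rewrite Cmod_sub_sym.
  rewrite (csum_ext _ (fun k => cbin a k * RtoC (x ^ k))%C) in H; [exact H|].
  intros k _. rewrite <- Cmult_assoc, <- RtoC_mult, <- Rpow_mult_distr, Ht. reflexivity.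
Qed.

Lemma rbin_partial_le (b x : R) K : 0 <= b -> 0 <= x < 1 ->
  rsum (fun k => rbin b k * x ^ k) K <= exp (- b * ln (1 - x)).
Proof.
  intros Hb Hx.
  assert (Hn : forall k, 0 <= rbin b k * x ^ k).
  { intros k. apply Rmult_le_pos; [apply rbin_nonneg; exact Hb|apply pow_le; lra]. }
  apply Rnot_lt_le. intros Hlt.
  destruct (binomial_series (RtoC b) x Hx
     (rsum (fun k => rbin b k * x ^ k) K - exp (- b * ln (1 - x)))) as [N HN]; [lra|].
  specialize (HN (N + K)%nat ltac:(lia)).
  rewrite (csum_ext _ (fun k => RtoC (rbin b k * x ^ k))) in HN.
  2:{ intros k _. rewrite cbin_RtoC, <- RtoC_mult. reflexivity. }
  rewrite csum_RtoC, <- RtoC_opp, <- RtoC_mult, Cexp_RtoC, <- RtoC_minus, Cmod_R in HN.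
  apply Rabs_def2 in HN.
  pose proof (rsum_mono _ K (N + K) Hn ltac:(lia)). lra.
Qed.

(** * Majorized power series *)

(** The bound is on the absolute sum of the expansion rather than on the supremum of f: it passes to
    sums, products and series without Cauchy's estimates, and it implies the supremum bound on the
    closed disc. *)
Definition maj (f : C -> C) (z0 : C) (r M : R) : Prop :=
  exists a : nat -> C,
    (forall N, rsum (fun k => Cmod (a k) * r ^ k) N <= M) /\
    (forall h, Cmod h <= r -> csums (fun k => a k * h ^ k)%C (f (z0 + h)%C)).

Lemma maj_analytic f z0 r M : 0 < r -> maj f z0 r M -> analytic_at f z0.
Proof.
  intros Hr [a [_ Ha]]. exists a, r. split; [exact Hr|]. intros z Hz.
  specialize (Ha (z - z0)%C ltac:(lra)).
  replace (z0 + (z - z0))%C with z in Ha by ring.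
  apply csums_is_series in Ha. unfold is_pseries.
  eapply is_series_ext; [|exact Ha]. intros n. simpl.
  change (a n * (z - z0) ^ n = (z - z0) ^ n * a n)%C. ring.
Qed.

Lemma maj_ext f g z0 r M :
  (forall h, Cmod h <= r -> f (z0 + h)%C = g (z0 + h)%C) -> maj f z0 r M -> maj g z0 r M.
Proof.
  intros H [a [H1 H2]]. exists a. split; [exact H1|]. intros h Hh. rewrite <- H by exact Hh. auto.
Qed.

Lemma maj_le f z0 r M M' : M <= M' -> maj f z0 r M -> maj f z0 r M'.
Proof.
  intros H [a [H1 H2]]. exists a. split; [|exact H2]. intros N. specialize (H1 N). lra.
Qed.

Lemma maj_translate f z0 w r M :
  maj f (z0 + w)%C r M -> maj (fun s => f (s + w)%C) z0 r M.
Proof.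
  intros [a [H1 H2]]. exists a. split; [exact H1|]. intros h Hh.
  replace (z0 + h + w)%C with (z0 + w + h)%C by ring. auto.
Qed.

Lemma maj_nonneg f z0 r M : maj f z0 r M -> 0 <= M.
Proof. intros [a [H _]]. exact (H O). Qed.

Lemma csums_fin (f : nat -> C) n : (forall k, (n <= k)%nat -> f k = RtoC 0) -> csums f (csum f n).
Proof.
  intros H eps He. exists n. intros m Hm. replace m with (n + (m - n))%nat by lia.
  rewrite csum_split. rewrite (csum_ext (fun k => f (n + k)%nat) (fun _ => RtoC 0)), csum_0 by (intros; apply H; lia).
  match goal with |- Cmod ?a < _ => replace a with (RtoC 0) by ring end.
  rewrite Cmod_0. exact He.
Qed.

Lemma maj_const c z0 r : 0 <= r -> maj (fun _ => c) z0 r (Cmod c).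
Proof.
  intros Hr. exists (fun k => match k with O => c | _ => RtoC 0 end). split.
  - intros N. destruct N as [|N]; [simpl; apply Cmod_ge_0|].
    induction N as [|N IH]; [unfold rsum; rewrite Rmult_1_r, Rplus_0_l; apply Rle_refl|].
    change (rsum (fun k => Cmod (match k with O => c | _ => RtoC 0 end) * r ^ k) (S N)
      + Cmod 0 * r ^ (S N) <= Cmod c). rewrite Cmod_0, Rmult_0_l, Rplus_0_r. exact IH.
  - intros h _.
    match goal with |- csums ?f _ => apply (eq_ind (csum f 1) (csums f)); [|simpl; ring] end.
    apply csums_fin. intros k Hk. destruct k; [lia|]. ring.
Qed.

(** Weierstrass's convergence theorem by interchange: the coefficients of the sum are the column
    sums of the double series of coefficients. *)
Lemma maj_series (u : nat -> C -> C) (F : C -> C) z0 r (M : nat -> R) S : 0 < r ->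
  (forall n, maj (u n) z0 r (M n)) -> (forall N, rsum M N <= S) ->
  (forall h, Cmod h <= r -> csums (fun n => u n (z0 + h)%C) (F (z0 + h)%C)) ->
  maj F z0 r S.
Proof.
  intros Hr Hu HS HF.
  set (a := fun n => proj1_sig (constructive_indefinite_description _ (Hu n))).
  assert (Ha : forall n, (forall N, rsum (fun k => Cmod (a n k) * r ^ k) N <= M n) /\
    (forall h, Cmod h <= r -> csums (fun k => a n k * h ^ k)%C (u n (z0 + h)%C))).
  { intros n. unfold a. apply proj2_sig. }
  assert (D : forall h, Cmod h <= r -> exists (r c : nat -> C) (l : C),
    (forall n, csums (fun k => a n k * h ^ k)%C (r n)) /\
    (forall k, csums (fun n => a n k * h ^ k)%C (c k)) /\
    csums r l /\ csums c l /\ (forall K, rsum (fun k => Cmod (c k)) K <= S)).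
  { intros h Hh. apply (csums_double (fun n k => a n k * h ^ k)%C M S); [|exact HS].
    intros n K. eapply Rle_trans; [|apply (proj1 (Ha n) K)].
    apply rsum_le. intros k _. rewrite Cmod_mult, Cmod_pow.
    apply Rmult_le_compat_l; [apply Cmod_ge_0|].
    apply pow_incr. split; [apply Cmod_ge_0|exact Hh]. }
  assert (Hr' : Cmod (RtoC r) = r) by (rewrite Cmod_R; apply Rabs_pos_eq; lra).
  assert (Hrn : RtoC r <> 0) by (apply RtoC_neq; lra).
  (* The coefficients are read off at the single point h = r, where the double series is largest;
     uniqueness of sums then identifies the columns at every other h. *)
  destruct (D (RtoC r)) as [rows [c [l [_ [Hc [_ [_ Hb]]]]]]]; [lra|].
  set (b := fun k => (c k / RtoC r ^ k)%C).
  assert (Hbk : forall k, csums (fun n => a n k) (b k)).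
  { intros k. specialize (Hc k). apply (csums_scal (/ RtoC r ^ k)%C) in Hc.
    unfold b. replace (c k / RtoC r ^ k)%C with (/ RtoC r ^ k * c k)%C by (unfold Cdiv; ring).
    eapply csums_ext; [|exact Hc]. intros n. simpl. field. apply Cpow_nz. exact Hrn. }
  exists b. split.
  + intros N. eapply Rle_trans; [|apply (Hb N)]. right. apply rsum_ext. intros k _.
    unfold b. rewrite Cmod_div by (apply Cpow_nz; exact Hrn). rewrite Cmod_pow, Hr'.
    field. apply pow_nonzero. lra.
  + intros h Hh. destruct (D h Hh) as [rows' [c' [l' [Hr2 [Hc2 [Hl1 [Hl2 _]]]]]]].
    assert (E : l' = F (z0 + h)%C).
    { apply (csums_unique rows'); [exact Hl1|]. eapply csums_ext; [|apply HF; exact Hh].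
      intros n. simpl. apply (csums_unique (fun k => a n k * h ^ k)%C); [apply (Ha n); exact Hh|auto]. }
    rewrite <- E. eapply csums_ext; [|exact Hl2]. intros k. simpl.
    apply (csums_unique (fun n => a n k * h ^ k)%C); [apply Hc2|].
    specialize (Hbk k). apply (csums_scal (h ^ k)%C) in Hbk.
    replace (b k * h ^ k)%C with (h ^ k * b k)%C by ring.
    eapply csums_ext; [|exact Hbk]. intros n; simpl; ring.
Qed.

Lemma maj_plus f g z0 r M M' : 0 <= r -> maj f z0 r M -> maj g z0 r M' ->
  maj (fun s => f s + g s)%C z0 r (M + M').
Proof.
  intros Hr [a [H1 H2]] [b [H3 H4]]. exists (fun k => a k + b k)%C. split.
  - intros N. apply Rle_trans with
      (rsum (fun k => Cmod (a k) * r ^ k) N + rsum (fun k => Cmod (b k) * r ^ k) N).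
    + rewrite <- rsum_plus.
      apply rsum_le. intros k _. pose proof (Cmod_triangle (a k) (b k)).
      pose proof (pow_le r k Hr). nra.
    + specialize (H1 N). specialize (H3 N). lra.
  - intros h Hh. eapply csums_ext; [|apply csums_plus; [apply H2|apply H4]; exact Hh].
    intros k; simpl; ring.
Qed.

Lemma maj_scal c f z0 r M : maj f z0 r M -> maj (fun s => c * f s)%C z0 r (Cmod c * M).
Proof.
  intros [a [H1 H2]]. exists (fun k => c * a k)%C. split.
  - intros N. rewrite (rsum_ext _ (fun k => Cmod c * (Cmod (a k) * r ^ k))).
    + rewrite rsum_scal. apply Rmult_le_compat_l; [apply Cmod_ge_0|apply H1].
    + intros k _. rewrite Cmod_mult. ring.
  - intros h Hh. eapply csums_ext; [|apply csums_scal, H2, Hh]. intros k; simpl; ring.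
Qed.

Lemma rsum_S_head (f : nat -> R) K : rsum f (S K) = f O + rsum (fun k => f (S k)) K.
Proof. change (S K) with (1 + K)%nat. rewrite rsum_split. simpl. ring. Qed.

Lemma maj_shift f z0 r M : 0 <= r -> maj f z0 r M ->
  maj (fun s => (s - z0) * f s)%C z0 r (r * M).
Proof.
  intros Hr Hf. pose proof (maj_nonneg _ _ _ _ Hf) as HM. destruct Hf as [a [H1 H2]].
  exists (fun k => match k with O => RtoC 0 | S j => a j end). split.
  - intros N. destruct N as [|N]; [simpl; apply Rmult_le_pos; assumption|].
    rewrite rsum_S_head, Cmod_0, Rmult_0_l, Rplus_0_l.
    rewrite (rsum_ext _ (fun k => r * (Cmod (a k) * r ^ k))).
    + rewrite rsum_scal. apply Rmult_le_compat_l; auto.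
    + intros k _. simpl. ring.
  - intros h Hh.
    replace ((z0 + h - z0) * f (z0 + h))%C
      with (csum (fun k => match k with O => RtoC 0 | S j => a j end * h ^ k) 1 + h * f (z0 + h))%C
      by (simpl; ring).
    apply csums_shift. eapply csums_ext; [|apply (csums_scal h), H2, Hh].
    intros k. simpl. ring.
Qed.

Lemma maj_monomial_mult f z0 r M n : 0 <= r -> maj f z0 r M ->
  maj (fun s => (s - z0) ^ n * f s)%C z0 r (r ^ n * M).
Proof.
  intros Hr Hf. induction n as [|n IH].
  - simpl. rewrite Rmult_1_l. eapply maj_ext; [|exact Hf]. intros; simpl; ring.
  - simpl. rewrite Rmult_assoc. eapply maj_ext; [|apply maj_shift; [exact Hr|exact IH]].
    intros; simpl; ring.
Qed.

(** No Cauchy product is formed: only f is expanded, and the product is treated as the majorized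
    series of the functions a_n (s - z0)^n g(s). *)
Lemma maj_mult f g z0 r M M' : 0 < r -> maj f z0 r M -> maj g z0 r M' ->
  maj (fun s => f s * g s)%C z0 r (M * M').
Proof.
  intros Hr [a [H1 H2]] Hg. pose proof (maj_nonneg _ _ _ _ Hg) as HM.
  apply (maj_series (fun n s => a n * ((s - z0) ^ n * g s))%C _ z0 r
     (fun n => Cmod (a n) * (r ^ n * M'))); [exact Hr| | |].
  - intros n. apply maj_scal, maj_monomial_mult; [lra|exact Hg].
  - intros N. rewrite (rsum_ext _ (fun n => M' * (Cmod (a n) * r ^ n))) by (intros; ring).
    rewrite rsum_scal, Rmult_comm. apply Rmult_le_compat_r; auto.
  - intros h Hh. replace (f (z0 + h) * g (z0 + h))%C with (g (z0 + h) * f (z0 + h))%C by ring.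
    eapply csums_ext; [|apply csums_scal, H2, Hh]. intros n; simpl.
    replace (z0 + h - z0)%C with h by ring. ring.
Qed.

Lemma maj_id_minus c z0 r : 0 <= r -> maj (fun s => s - c)%C z0 r (Cmod (z0 - c) + r).
Proof.
  intros Hr.
  apply (maj_ext (fun s => (z0 - c) + (s - z0) * 1)%C); [intros; ring|].
  apply maj_plus; [exact Hr|apply maj_const; exact Hr|].
  replace r with (r * Cmod 1) at 2 by (rewrite Cmod_1; ring).
  apply (maj_shift (fun _ => RtoC 1)); [exact Hr|]. apply maj_const; exact Hr.
Qed.

Lemma maj_Cexp (c z0 : C) r : 0 <= r ->
  maj (fun s => Cexp (c * s)) z0 r (exp (Re (c * z0)) * exp (Cmod c * r)).
Proof.
  intros Hr.
  apply (maj_ext (fun s => Cexp (c * z0) * Cexp (c * (s - z0)))%C).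
  { intros h _. rewrite <- Cexp_plus. f_equal. ring. }
  rewrite <- Cmod_Cexp. apply (maj_scal (Cexp (c * z0)) (fun s => Cexp (c * (s - z0)))).
  exists (fun k => expc c k). split.
  - intros N. eapply Rle_trans; [|apply (exp_partial_le (Cmod c * r) N)].
    + right. apply rsum_ext. intros k _. unfold expc.
      rewrite Cmod_mult, Cmod_pow, Cmod_R, Rabs_pos_eq, Rpow_mult_distr; [ring|].
      left. apply Rinv_0_lt_compat, INR_fact_lt_0.
    + apply Rmult_le_pos; [apply Cmod_ge_0|exact Hr].
  - intros h _. replace (z0 + h - z0)%C with h by ring.
    eapply csums_ext; [|apply (csums_Cexp (c * h))]. intros k. unfold expc.
    rewrite Cpow_mult_l. ring.
Qed.

Lemma rsum_geom_le (q : R) N : 0 <= q < 1 -> rsum (fun k => q ^ k) N <= / (1 - q).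
Proof.
  intros Hq. assert (H : rsum (fun k => q ^ k) N = (1 - q ^ N) / (1 - q)).
  { induction N as [|N IH]; [simpl; field; lra|]. simpl rsum. rewrite IH. simpl. field. lra. }
  rewrite H. unfold Rdiv. rewrite <- (Rmult_1_l (/ (1 - q))) at 2.
  apply Rmult_le_compat_r; [left; apply Rinv_0_lt_compat; lra|].
  pose proof (pow_le q N ltac:(lra)). lra.
Qed.

Lemma csums_geom (q : C) : Cmod q < 1 -> csums (fun k => q ^ k)%C (/ (1 - q))%C.
Proof.
  intros Hq.
  assert (H1 : (1 - q)%C <> 0).
  { intros E. assert (q = 1) as ->.
    { replace q with (1 - (1 - q))%C by ring. rewrite E. ring. }
    rewrite Cmod_1 in Hq. lra. }
  apply (csums_of_geometric_error _ _ (Cmod q) (/ Cmod (1 - q))); [split; [apply Cmod_ge_0|exact Hq]|].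
  intros K. right.
  assert (E : csum (fun k => q ^ k)%C K = ((1 - q ^ K) / (1 - q))%C).
  { induction K as [|K IH]; [simpl; field; exact H1|]. simpl csum. rewrite IH. simpl. field. exact H1. }
  rewrite E. replace ((1 - q ^ K) / (1 - q) - / (1 - q))%C with (- (q ^ K * / (1 - q)))%C
    by (field; exact H1).
  rewrite Cmod_opp, Cmod_mult, Cmod_pow, Cmod_inv by exact H1. reflexivity.
Qed.

(** Geometric series in -h / (z0 - c); the pole must lie outside the closed disc. *)
Lemma maj_inv (c z0 : C) r : 0 <= r -> r < Cmod (z0 - c) ->
  maj (fun s => / (s - c))%C z0 r (/ (Cmod (z0 - c) - r)).
Proof.
  intros Hr Hlt.
  assert (Hn : (z0 - c)%C <> 0) by (apply Cmod_gt_0; lra).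
  exists (fun k => / (z0 - c) * (- / (z0 - c)) ^ k)%C.
  assert (Hq : forall h, Cmod (- / (z0 - c) * h) = Cmod h / Cmod (z0 - c)).
  { intros h. rewrite Cmod_mult, Cmod_opp, Cmod_inv by exact Hn. unfold Rdiv. ring. }
  split.
  - intros N. rewrite (rsum_ext _ (fun k => / Cmod (z0 - c) * (r / Cmod (z0 - c)) ^ k)).
    + rewrite rsum_scal.
      apply Rle_trans with (/ Cmod (z0 - c) * / (1 - r / Cmod (z0 - c))).
      * apply Rmult_le_compat_l; [left; apply Rinv_0_lt_compat; lra|].
        apply rsum_geom_le. split; [apply Rdiv_le_0_compat; lra|].
        apply Rmult_lt_reg_r with (Cmod (z0 - c)); [lra|]. field_simplify; lra.
      * right. field. lra.
    + intros k _. rewrite Cmod_mult, Cmod_pow, Cmod_opp, Cmod_inv by exact Hn.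
      unfold Rdiv. rewrite Rpow_mult_distr. ring.
  - intros h Hh.
    assert (Hqh : Cmod (- / (z0 - c) * h) < 1).
    { rewrite Hq. apply Rmult_lt_reg_r with (Cmod (z0 - c)); [lra|]. field_simplify; lra. }
    pose proof (csums_scal (/ (z0 - c))%C _ _ (csums_geom _ Hqh)) as H.
    assert (Hn2 : (z0 + h - c)%C <> 0).
    { intros E. assert (h = - (z0 - c))%C as ->.
      { replace h with ((z0 + h - c) - (z0 - c))%C by ring. rewrite E. ring. }
      rewrite Cmod_opp in Hh. lra. }
    replace (/ (z0 + h - c))%C with (/ (z0 - c) * / (1 - - / (z0 - c) * h))%C.
    + eapply csums_ext; [|exact H]. intros k. simpl. rewrite Cpow_mult_l. ring.
    + field. repeat split; auto.
Qed.

Lemma maj_bound f z0 r M h : 0 <= r -> maj f z0 r M -> Cmod h <= r -> Cmod (f (z0 + h)%C) <= M.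
Proof.
  intros Hr [a [H1 H2]] Hh. apply (csums_Cmod_le _ _ _ (H2 h Hh)). intros N.
  eapply Rle_trans; [|apply (H1 N)]. apply rsum_le. intros k _.
  rewrite Cmod_mult, Cmod_pow. apply Rmult_le_compat_l; [apply Cmod_ge_0|].
  apply pow_incr. split; [apply Cmod_ge_0|exact Hh].
Qed.

Lemma maj_cbin (c z0 : C) r k : 0 < r ->
  maj (fun s => cbin (s - c) k) z0 r (rbin (Cmod (z0 - c) + r) k).
Proof.
  intros Hr. induction k as [|k IH].
  - simpl. apply (maj_le _ _ _ (Cmod 1)); [rewrite Cmod_1; lra|].
    apply (maj_const (RtoC 1)). lra.
  - change (maj (fun s => cbin (s - c) k * ((s - c + RtoC (INR k)) * RtoC (/ INR (S k))))%C z0 r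
      (rbin (Cmod (z0 - c) + r) k * ((Cmod (z0 - c) + r + INR k) * / INR (S k)))).
    apply maj_mult; [exact Hr|exact IH|].
    assert (0 < / INR (S k)) by (apply Rinv_0_lt_compat, lt_0_INR; lia).
    apply (maj_ext (fun s => RtoC (/ INR (S k)) * ((s - c) + RtoC (INR k)))%C); [intros; ring|].
    apply (maj_le _ _ _ (Cmod (RtoC (/ INR (S k))) * (Cmod (z0 - c) + r + Cmod (RtoC (INR k))))).
    { rewrite !Cmod_R, !Rabs_pos_eq; [lra|apply pos_INR|lra]. }
    apply (maj_scal _ (fun s => s - c + RtoC (INR k))%C).
    apply (maj_plus (fun s => s - c)%C (fun _ => RtoC (INR k))); [lra|apply maj_id_minus; lra|].
    apply maj_const; lra.
Qed.

(** * Analytic continuation of zeta *)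

Definition rp (n : nat) (x : R) : R := exp (- x * ln (INR n)).
Definition npow (n : nat) (s : C) : C := Cexp (- s * RtoC (ln (INR n)))%C.

Lemma Cmod_npow n s : Cmod (npow n s) = rp n (Re s).
Proof. unfold npow, rp. rewrite Cmod_Cexp, re_scal_r, re_opp. reflexivity. Qed.

Lemma rp_plus n x y : rp n (x + y) = rp n x * rp n y.
Proof. unfold rp. rewrite <- exp_plus. f_equal. ring. Qed.

Lemma rp_pos n x : 0 < rp n x.
Proof. apply exp_pos. Qed.

Lemma npow_plus n x y : npow n (x + y)%C = (npow n x * npow n y)%C.
Proof. unfold npow. rewrite <- Cexp_plus. f_equal. ring. Qed.

Lemma npow_1 s : npow 1 s = 1.
Proof. unfold npow. simpl. rewrite ln_1. replace (- s * 0)%C with (RtoC 0) by ring. apply Cexp_0. Qed.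

Lemma rp_INR n k : (1 <= n)%nat -> rp n (INR k) = (/ INR n) ^ k.
Proof.
  intros Hn. assert (0 < INR n) by (apply lt_0_INR; lia).
  induction k as [|k IH].
  - unfold rp. simpl. rewrite Ropp_0, Rmult_0_l. apply exp_0.
  - rewrite S_INR, rp_plus, IH. simpl. unfold rp.
    replace (-(1) * ln (INR n)) with (- ln (INR n)) by ring.
    rewrite exp_Ropp, exp_ln by assumption. ring.
Qed.

Lemma npow_INR n k : (1 <= n)%nat -> npow n (RtoC (INR k)) = RtoC ((/ INR n) ^ k).
Proof.
  intros Hn. rewrite <- rp_INR by exact Hn. unfold npow, rp.
  rewrite <- RtoC_opp, <- RtoC_mult, Cexp_RtoC. reflexivity.
Qed.

Lemma ln_INR_nonneg n : 0 <= ln (INR n).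
Proof.
  destruct n as [|n].
  (* At n = 0 the library's logarithm takes its default value 0. *)
  - unfold ln. simpl. destruct (Rlt_dec 0 0) as [H|H]; [exfalso; exact (Rlt_irrefl _ H)|apply Rle_refl].
  - rewrite <- ln_1. apply ln_le; [lra|]. rewrite S_INR. pose proof (pos_INR n). lra.
Qed.

Lemma rp_anti n x y : x <= y -> rp n y <= rp n x.
Proof. intros H. apply exp_mono. pose proof (ln_INR_nonneg n). nra. Qed.

Lemma ln_le_sub_1 x : 0 < x -> ln x <= x - 1.
Proof. intros Hx. pose proof (exp_ineq1_le (ln x)) as H. rewrite exp_ln in H by exact Hx. lra. Qed.

Lemma ln_succ_ge n : (1 <= n)%nat -> / INR (S n) <= ln (INR (S n)) - ln (INR n).
Proof.
  intros Hn. assert (0 < INR n) by (apply lt_0_INR; lia).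
  rewrite S_INR. rewrite <- (Rinv_inv (INR n)) at 3. rewrite ln_Rinv by (apply Rinv_0_lt_compat; lra).
  assert (E : ln (INR n + 1) - - ln (/ INR n) = - ln (INR n / (INR n + 1))).
  { rewrite ln_div by lra. rewrite ln_Rinv by lra. ring. }
  rewrite E.
  assert (Hp : 0 < INR n / (INR n + 1)) by (apply Rdiv_lt_0_compat; lra).
  pose proof (ln_le_sub_1 _ Hp) as Hl.
  replace (INR n / (INR n + 1) - 1) with (- / (INR n + 1)) in Hl by (field; lra). lra.
Qed.

(** Replaces the integral test: log(n+1) - log n >= 1/(n+1) and e^u >= 1 + u give n^(-x) >=
    (n+1)^(-x) (1 + x/(n+1)), so the tails telescope. *)
Lemma rp_telescope n x : (1 <= n)%nat -> 0 < x ->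
  rp (S n) (x + 1) <= (rp n x - rp (S n) x) / x.
Proof.
  intros Hn Hx. pose proof (ln_succ_ge n Hn) as Hl.
  assert (E : rp n x = rp (S n) x * exp (x * (ln (INR (S n)) - ln (INR n)))).
  { unfold rp. rewrite <- exp_plus. f_equal. ring. }
  assert (E1 : rp (S n) 1 = / INR (S n)).
  { change 1 with (INR 1). rewrite rp_INR by lia. simpl. ring. }
  rewrite rp_plus, E1, E. pose proof (rp_pos (S n) x).
  pose proof (exp_ineq1_le (x * (ln (INR (S n)) - ln (INR n)))).
  apply Rmult_le_reg_r with x; [exact Hx|].
  match goal with |- _ <= ?a / x * x => replace (a / x * x) with a by (field; lra) end.
  assert (/ INR (S n) * x <= x * (ln (INR (S n)) - ln (INR n))) by nra.
  assert (rp (S n) x * (/ INR (S n) * x) <=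
    rp (S n) x * (exp (x * (ln (INR (S n)) - ln (INR n))) - 1)).
  { apply Rmult_le_compat_l; lra. }
  lra.
Qed.

Lemma rp_tail m x K : (1 <= m)%nat -> 0 < x ->
  rsum (fun k => rp (S (m + k)) (x + 1)) K <= rp m x / x.
Proof.
  intros Hm Hx.
  assert (rsum (fun k => rp (S (m + k)) (x + 1)) K <= (rp m x - rp (m + K) x) / x).
  { induction K as [|K IH].
    - rewrite Nat.add_0_r. simpl. unfold Rdiv. rewrite Rminus_diag_eq, Rmult_0_l by reflexivity. lra.
    - simpl. pose proof (rp_telescope (m + K) x ltac:(lia) Hx). rewrite Nat.add_succ_r.
      unfold Rdiv in *. lra. }
  eapply Rle_trans; [exact H|]. unfold Rdiv. apply Rmult_le_compat_r.
  - left. apply Rinv_0_lt_compat, Hx.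
  - pose proof (rp_pos (m + K) x). lra.
Qed.

Lemma rp_1 x : rp 1 x = 1.
Proof. unfold rp. simpl. rewrite ln_1, Rmult_0_r. apply exp_0. Qed.

(** A total sum operator, meaningful only where convergence is proved. It lets the recursion
    [landau] be defined on all of C before its region of validity is known. *)
Definition csum_lim (f : nat -> C) : C := epsilon (inhabits (RtoC 0)) (csums f).

Lemma csum_lim_eq f l : csums f l -> csum_lim f = l.
Proof.
  intros H. apply (csums_unique f); [|exact H]. unfold csum_lim. apply epsilon_spec.
  exists l. exact H.
Qed.

Lemma maj_csum_lim (u : nat -> C -> C) z0 r (M : nat -> R) S : 0 < r ->
  (forall n, maj (u n) z0 r (M n)) -> (forall N, rsum M N <= S) ->
  maj (fun s => csum_lim (fun n => u n s)) z0 r S.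
Proof.
  intros Hr Hu HS. apply (maj_series u _ z0 r M S Hr Hu HS).
  intros h Hh. unfold csum_lim. apply epsilon_spec. apply (csums_ex _ S). intros N.
  eapply Rle_trans; [|apply (HS N)]. apply rsum_le. intros n _.
  eapply maj_bound; [|apply Hu|exact Hh]. lra.
Qed.

(** This is zeta(s) - 1. Without its first term the series decays like 2^(-k) at s + k, and that
    decay makes Landau's series converge. *)
Definition dirichlet_tail (s : C) : C := csum_lim (fun n => npow (n + 2) s).

Lemma dirichlet_tail_csums s : 1 < Re s -> csums (fun n => npow (n + 2) s) (dirichlet_tail s).
Proof.
  intros Hs. unfold dirichlet_tail, csum_lim. apply epsilon_spec.
  apply (csums_ex _ (rp 1 (Re s - 1) / (Re s - 1))). intros N.
  eapply Rle_trans; [|apply (rp_tail 1 (Re s - 1) N); [lia|lra]].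
  right. apply rsum_ext. intros k _. rewrite Cmod_npow. f_equal; [lia|ring].
Qed.

Lemma maj_npow n z0 r : 0 <= r -> maj (npow n) z0 r (rp n (Re z0 - r)).
Proof.
  intros Hr. apply (maj_ext (fun s => Cexp (RtoC (- ln (INR n)) * s)%C)).
  { intros h _. unfold npow. f_equal. rewrite RtoC_opp. ring. }
  eapply maj_le; [|apply maj_Cexp; exact Hr]. right.
  rewrite Cmod_R, Rabs_Ropp, (Rabs_pos_eq (ln _)) by apply ln_INR_nonneg.
  rewrite re_scal_l. unfold rp. rewrite <- exp_plus. f_equal. ring.
Qed.

Lemma maj_dirichlet_tail z0 r k : 0 < r -> 1 < Re z0 - r ->
  maj dirichlet_tail (z0 + RtoC (INR k))%C r ((1 / 2) ^ k / (Re z0 - r - 1)).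
Proof.
  intros Hr Hx. apply (maj_csum_lim _ _ _ (fun n => rp (n + 2) (Re (z0 + RtoC (INR k))%C - r))); [exact Hr| |].
  - intros n. apply maj_npow. lra.
  - intros N.
    apply Rle_trans with ((1 / 2) ^ k * rsum (fun n => rp (S (1 + n)) (Re z0 - r - 1 + 1)) N).
    + rewrite <- rsum_scal. apply rsum_le. intros n _. rewrite re_plus, re_RtoC.
      replace (Re z0 + INR k - r) with (INR k + (Re z0 - r - 1 + 1)) by ring.
      rewrite rp_plus. replace (S (1 + n)) with (n + 2)%nat by lia.
      apply Rmult_le_compat_r; [left; apply rp_pos|].
      rewrite rp_INR by lia. apply pow_incr.
      assert (2 <= INR (n + 2)) by (rewrite plus_INR; simpl; pose proof (pos_INR n); lra).
      split; [left; apply Rinv_0_lt_compat; lra|].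
      unfold Rdiv. rewrite Rmult_1_l. apply Rinv_le_contravar; lra.
    + unfold Rdiv at 2. apply Rmult_le_compat_l; [apply pow_le; lra|].
      eapply Rle_trans; [apply rp_tail; [lia|lra]|]. rewrite rp_1. unfold Rdiv. lra.
Qed.

(** In the binomial expansion the coefficient of zeta(s+k+1) - 1 is [cbin (s - 1) (2 + k)]. Its last
    factor s + k is absorbed into f, which stands for (s - 1)(zeta(s) - 1), so the pole never enters
    the recursion. *)
Definition landau_term (f : C -> C) (k : nat) (s : C) : C :=
  (cbin (s - 1) (S k) * RtoC (/ INR (S (S k))) * f (s + RtoC (INR (S k))))%C.

(* Expanding (n-1)^(1-s) in powers of 1/n in the telescoping sum over n >= 2 of
   (n-1)^(1-s) - n^(1-s) expresses (s-1) (zeta(s) - 1) through the same function at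
   s+1, s+2, ...; each use of this relation gains a strip of width one. *)
Fixpoint landau (m : nat) (s : C) : C :=
  match m with
  | O => ((s - 1) * dirichlet_tail s)%C
  | S j => (1 - csum_lim (fun k => landau_term (landau j) k s))%C
  end.

(** Decay known only from shift K on is extended down to shift 0 by enlarging the constant, one
    shift at a time. *)
Lemma maj_geometric_extend f z0 r q : 0 < q ->
  (forall k, exists M, maj f (z0 + RtoC (INR k))%C r M) ->
  forall K, (exists A, forall k, maj f (z0 + RtoC (INR (K + k)))%C r (A * q ^ k)) ->
  exists A, forall k, maj f (z0 + RtoC (INR k))%C r (A * q ^ k).
Proof.
  intros Hq H. induction K as [|K IH]; intros [A HA]; [exists A; exact HA|].
  apply IH. destruct (H K) as [M HM].
  pose proof (maj_nonneg _ _ _ _ HM) as HM0.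
  pose proof (maj_nonneg _ _ _ _ (HA O)) as HA0. simpl in HA0. rewrite Rmult_1_r in HA0.
  assert (0 <= A / q) by (apply Rdiv_le_0_compat; lra).
  exists (M + A / q). intros [|k].
  - rewrite Nat.add_0_r. eapply maj_le; [|exact HM]. simpl. lra.
  - replace (K + S k)%nat with (S K + k)%nat by lia. eapply maj_le; [|apply HA].
    simpl. replace (A * q ^ k) with (A / q * (q * q ^ k)) by (field; lra).
    apply Rmult_le_compat_r; [|lra]. apply Rmult_le_pos; [lra|apply pow_le; lra].
Qed.

Lemma maj_landau_0 z0 r : 0 < r -> 1 < Re z0 - r ->
  exists A, forall k, maj (landau 0) (z0 + RtoC (INR k))%C r (A * (3 / 4) ^ k).
Proof.
  intros Hr Hx. set (b := Cmod (z0 - 1) + r).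
  exists ((b + 2) / (Re z0 - r - 1)). intros k.
  assert (Hi : 0 < / (Re z0 - r - 1)) by (apply Rinv_0_lt_compat; lra).
  assert (Hb : 0 <= b) by (unfold b; pose proof (Cmod_ge_0 (z0 - 1)); lra).
  eapply maj_le; [|apply maj_mult; [exact Hr|apply maj_id_minus; lra|apply maj_dirichlet_tail; assumption]].
  assert (Hk : Cmod (z0 + RtoC (INR k) - 1) + r <= b + INR k).
  { unfold b. replace (z0 + RtoC (INR k) - 1)%C with ((z0 - 1) + RtoC (INR k))%C by ring.
    pose proof (Cmod_triangle (z0 - 1) (RtoC (INR k))) as H.
    rewrite (Cmod_R (INR k)), (Rabs_pos_eq (INR k)) in H by apply pos_INR. lra. }
  (* Bernoulli's inequality: the linear growth of s - 1 is absorbed by weakening the decay ratio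
     from 1/2 to 3/4, still below the radius 1 of the binomial series. *)
  assert (Hp : b + INR k <= (b + 2) * (3 / 2) ^ k).
  { assert (H1 : 1 + INR k * (1 / 2) <= (3 / 2) ^ k).
    { replace (3 / 2) with (1 + 1 / 2) by field. apply poly. lra. }
    pose proof (pos_INR k). nra. }
  replace ((3 / 4) ^ k) with ((3 / 2) ^ k * (1 / 2) ^ k)
    by (rewrite <- Rpow_mult_distr; f_equal; field).
  unfold Rdiv at 1 3.
  replace ((b + 2) * / (Re z0 - r - 1) * ((3 / 2) ^ k * (1 / 2) ^ k))
    with ((b + 2) * (3 / 2) ^ k * ((1 / 2) ^ k * / (Re z0 - r - 1))) by ring.
  apply Rmult_le_compat_r; [|lra]. apply Rmult_le_pos; [apply pow_le; lra|lra].
Qed.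

Definition telescope_term (n : nat) (s : C) : C :=
  (npow n (s - 1) - npow (S n) (s - 1) - (s - 1) * npow (S n) s)%C.

Lemma telescope_term_series s n : (1 <= n)%nat ->
  csums (fun k => cbin (s - 1) (2 + k) * npow (S n) (s + RtoC (INR (S k))))%C (telescope_term n s).
Proof.
  intros Hn. set (x := / INR (S n)).
  assert (HSn : 2 <= INR (S n)) by (change 2 with (INR 2); apply le_INR; lia).
  assert (Hx : 0 <= x < 1).
  { unfold x. split; [left; apply Rinv_0_lt_compat; lra|].
    rewrite <- Rinv_1 at 1. apply Rinv_lt_contravar; lra. }
  pose proof (binomial_series (s - 1) x Hx) as H.
  apply (csums_scal (npow (S n) (s - 1))) in H.
  assert (E : (npow (S n) (s - 1) * Cexp (- (s - 1) * RtoC (ln (1 - x))))%C = npow n (s - 1)).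
  { unfold npow. rewrite <- Cexp_plus. f_equal.
    replace (1 - x) with (INR n / INR (S n)).
    - rewrite ln_div by (apply lt_0_INR; lia). rewrite RtoC_minus. ring.
    - unfold x. rewrite S_INR. field. pose proof (pos_INR n). lra. }
  rewrite E in H.
  assert (Ek : forall k, (npow (S n) (s - 1) * (cbin (s - 1) k * RtoC (x ^ k)))%C
      = (cbin (s - 1) k * npow (S n) (s - 1 + RtoC (INR k)))%C).
  { intros k. rewrite npow_plus, npow_INR by lia. unfold x. ring. }
  assert (E2 : (csum (fun k => npow (S n) (s - 1) * (cbin (s - 1) k * RtoC (x ^ k))) 2
       + telescope_term n s)%C = npow n (s - 1)).
  { unfold telescope_term.
    change (csum (fun k => npow (S n) (s - 1) * (cbin (s - 1) k * RtoC (x ^ k))) 2)%C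
      with (0 + npow (S n) (s - 1) * (cbin (s - 1) 0 * RtoC (x ^ 0))
          + npow (S n) (s - 1) * (cbin (s - 1) 1 * RtoC (x ^ 1)))%C.
    rewrite !Ek. simpl. rewrite Rinv_1.
    replace (s - 1 + 1)%C with s by ring.
    replace (s - 1 + 0)%C with (s - 1)%C by ring. ring. }
  rewrite <- E2 in H. apply csums_shift in H.
  eapply csums_ext; [|exact H]. intros k. cbv beta. rewrite Ek. f_equal. f_equal.
  change (2 + k)%nat with (S (S k)). rewrite (S_INR (S k)), RtoC_plus. ring.
Qed.

(** One double series summed in two orders: rows give the telescoping terms, columns give Landau's
    series. Absolute convergence needs only Re s > 0, since the expansion starts at n^(-s-1). *)
Lemma landau_1_telescope s : 0 < Re s -> exists l,
  csums (fun n => telescope_term (S n) s) l /\ landau 1 s = (1 - l)%C.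
Proof.
  intros Hs. set (b := Cmod (s - 1)). set (B := 4 * exp (- b * ln (1 - 1 / 2))).
  assert (Hb : 0 <= b) by apply Cmod_ge_0.
  assert (HB : 0 <= B) by (unfold B; pose proof (exp_pos (- b * ln (1 - 1 / 2))); lra).
  destruct (csums_double
    (fun n k => cbin (s - 1) (2 + k) * npow (n + 2) (s + RtoC (INR (S k))))%C
    (fun n => B * rp (n + 2) (Re s + 1)) (B * (rp 1 (Re s) / Re s)))
    as [r [c [l [Hr [Hc [Hl1 [Hl2 _]]]]]]].
  - intros n K.
    apply Rle_trans with (rsum (fun k => 4 * rp (n + 2) (Re s + 1) * (rbin b (2 + k) * (1 / 2) ^ (2 + k))) K).
    + apply rsum_le. intros k _. rewrite Cmod_mult, Cmod_npow, re_plus, re_RtoC, S_INR.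
      replace (Re s + (INR k + 1)) with ((Re s + 1) + INR k) by ring.
      rewrite rp_plus.
      replace (4 * rp (n + 2) (Re s + 1) * (rbin b (2 + k) * (1 / 2) ^ (2 + k)))
        with (rbin b (2 + k) * (rp (n + 2) (Re s + 1) * (1 / 2) ^ k))
        by (rewrite (pow_add (1 / 2) 2 k); field).
      apply Rmult_le_compat; [apply Cmod_ge_0| | |].
      * left. apply Rmult_lt_0_compat; apply rp_pos.
      * apply cbin_le. unfold b. lra.
      * apply Rmult_le_compat_l; [left; apply rp_pos|].
        rewrite rp_INR by lia. apply pow_incr.
        assert (2 <= INR (n + 2)) by (rewrite plus_INR; simpl; pose proof (pos_INR n); lra).
        split; [left; apply Rinv_0_lt_compat; lra|].
        unfold Rdiv. rewrite Rmult_1_l. apply Rinv_le_contravar; lra.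
    + rewrite rsum_scal. unfold B.
      replace (4 * exp (- b * ln (1 - 1 / 2)) * rp (n + 2) (Re s + 1))
        with (4 * rp (n + 2) (Re s + 1) * exp (- b * ln (1 - 1 / 2))) by ring.
      apply Rmult_le_compat_l; [pose proof (rp_pos (n + 2) (Re s + 1)); lra|].
      pose proof (rbin_partial_le b (1 / 2) (2 + K) Hb ltac:(lra)) as H.
      rewrite rsum_split in H.
      pose proof (rsum_nonneg (fun k => rbin b k * (1 / 2) ^ k) 2) as H2.
      assert (forall k, 0 <= rbin b k * (1 / 2) ^ k).
      { intros k. apply Rmult_le_pos; [apply rbin_nonneg, Hb|apply pow_le; lra]. }
      specialize (H2 (fun k _ => H0 k)). lra.
  - intros N. rewrite rsum_scal. apply Rmult_le_compat_l; [exact HB|].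
    eapply Rle_trans; [|apply (rp_tail 1 (Re s) N); [lia|lra]].
    right. apply rsum_ext. intros k _. f_equal. lia.
  - exists l. split.
    + eapply csums_ext; [|exact Hl1]. intros n. simpl. eapply csums_unique; [apply Hr|].
      replace (n + 2)%nat with (S (S n)) by lia. apply telescope_term_series. lia.
    + change (landau 1 s) with (1 - csum_lim (fun k => landau_term (landau 0) k s))%C.
      f_equal. f_equal. apply csum_lim_eq. eapply csums_ext; [|exact Hl2].
      intros k. simpl. apply (csums_unique _ _ _ (Hc k)). unfold landau_term.
      change (landau 0 (s + RtoC (INR (S k))))
        with ((s + RtoC (INR (S k)) - 1) * dirichlet_tail (s + RtoC (INR (S k))))%C.
      replace (cbin (s - 1) (S k) * RtoC (/ INR (S (S k))) *
        ((s + RtoC (INR (S k)) - 1) * dirichlet_tail (s + RtoC (INR (S k)))))%C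
        with (cbin (s - 1) (2 + k) * dirichlet_tail (s + RtoC (INR (S k))))%C.
      * apply csums_scal, dirichlet_tail_csums. rewrite re_plus, re_RtoC, S_INR.
        pose proof (pos_INR k). lra.
      * change (cbin (s - 1) (2 + k)) with
          (cbin (s - 1) (S k) * ((s - 1 + RtoC (INR (S k))) * RtoC (/ INR (S (S k)))))%C. ring.
Qed.

Lemma telescope_partial s N :
  csum (fun n => telescope_term (S n) s) N
    = (1 - npow (S N) (s - 1) - (s - 1) * csum (fun n => npow (n + 2) s) N)%C.
Proof.
  induction N as [|N IH]; simpl csum.
  - rewrite npow_1. ring.
  - rewrite IH. unfold telescope_term. replace (N + 2)%nat with (S (S N)) by lia. ring.
Qed.

Lemma rp_limit x eps : 0 < x -> 0 < eps -> exists N, forall n, (N <= n)%nat -> rp n x < eps.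
Proof.
  intros Hx He. destruct (INR_unbounded (exp (- ln eps / x))) as [N HN].
  exists N. intros n Hn. unfold rp. rewrite <- (exp_ln eps) by exact He.
  apply exp_increasing.
  assert (- ln eps / x < ln (INR n)).
  { rewrite <- (ln_exp (- ln eps / x)). apply ln_increasing; [apply exp_pos|].
    eapply Rlt_le_trans; [exact HN|]. apply le_INR, Hn. }
  apply Rmult_lt_compat_l with (r := x) in H; [|exact Hx].
  replace (x * (- ln eps / x)) with (- ln eps) in H by (field; lra). lra.
Qed.

(** For Re s > 1 the boundary term (N+1)^(1-s) of the telescoped sum vanishes, which leaves Landau's
    functional relation. *)
Lemma landau_step_0 s : 1 < Re s -> landau 1 s = landau 0 s.
Proof.
  intros Hs. destruct (landau_1_telescope s ltac:(lra)) as [l [Hl ->]].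
  assert (E : l = (1 - landau 0 s)%C).
  { apply (csums_unique _ _ _ Hl). intros eps He.
    destruct (rp_limit (Re s - 1) (eps / 2)) as [N1 H1]; [lra|lra|].
    assert (Hsc := csums_scal (s - 1) _ _ (dirichlet_tail_csums s Hs)).
    destruct (Hsc (eps / 2)) as [N2 H2]; [lra|].
    exists (N1 + N2)%nat. intros n Hn. specialize (H1 (S n) ltac:(lia)).
    specialize (H2 n ltac:(lia)). rewrite csum_scal in H2.
    rewrite telescope_partial. simpl landau.
    match goal with |- Cmod ?a < _ => replace a with
      (- (((s - 1) * csum (fun n => npow (n + 2) s) n - (s - 1) * dirichlet_tail s)
         + npow (S n) (s - 1)))%C by ring end.
    rewrite Cmod_opp. eapply Rle_lt_trans; [apply Cmod_triangle|].
    rewrite Cmod_npow. replace (Re (s - 1)%C) with (Re s - 1)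
      by (unfold Cminus; rewrite re_plus, re_opp, re_RtoC; ring). lra. }
  rewrite E. ring.
Qed.

(** The recursion evaluates the previous stage only at s + 1, s + 2, ..., so agreement on one
    half-plane moves one unit to the left. *)
Lemma landau_step m : forall s, 1 - INR m < Re s -> landau (S m) s = landau m s.
Proof.
  induction m as [|m IH]; intros s Hs.
  - apply landau_step_0. simpl in Hs. lra.
  - change (landau (S (S m)) s) with (1 - csum_lim (fun k => landau_term (landau (S m)) k s))%C.
    change (landau (S m) s) with (1 - csum_lim (fun k => landau_term (landau m) k s))%C.
    f_equal. f_equal. f_equal. apply functional_extensionality. intros k.
    unfold landau_term. f_equal. apply IH. rewrite re_plus, re_RtoC.
    rewrite S_INR in *. pose proof (pos_INR k). lra.
Qed.

Lemma landau_ge m n s : (m <= n)%nat -> 1 - INR m < Re s -> landau n s = landau m s.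
Proof.
  intros Hmn Hs. induction Hmn as [|n Hmn IH]; [reflexivity|].
  rewrite landau_step; [exact IH|]. apply le_INR in Hmn. lra.
Qed.

Lemma landau_indep m n s : 1 - INR m < Re s -> 1 - INR n < Re s -> landau m s = landau n s.
Proof.
  intros Hm Hn. destruct (Nat.le_ge_cases m n) as [H|H].
  - symmetry. apply landau_ge; assumption.
  - apply landau_ge; assumption.
Qed.

Lemma Cmod_Re_ge (h : C) r : Cmod h <= r -> - r <= Re h.
Proof. intros H. pose proof (re_le_Cmod h) as Hr. apply Rabs_le_between in Hr. lra. Qed.

(** Geometric decay along all integer shifts is carried in the induction because the next stage sums
    over exactly these shifts, against binomial coefficients. *)
Lemma maj_landau m : forall z0 r, 0 < r -> 1 - INR m < Re z0 - r ->
  exists A, forall k, maj (landau m) (z0 + RtoC (INR k))%C r (A * (3 / 4) ^ k).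
Proof.
  induction m as [|m IH]; intros z0 r Hr Hx.
  - apply maj_landau_0; [exact Hr|]. simpl in Hx. lra.
  - assert (Hex : forall z1, 1 - INR (S m) < Re z1 - r -> exists M, maj (landau (S m)) z1 r M).
    { intros z1 H1. destruct (IH (z1 + 1)%C r Hr) as [A HA].
      { rewrite S_INR in H1. rewrite re_plus, re_RtoC. lra. }
      set (b := Cmod (z1 - 1) + r).
      assert (Hb : 0 <= b) by (unfold b; pose proof (Cmod_ge_0 (z1 - 1)); lra).
      pose proof (maj_nonneg _ _ _ _ (HA O)) as HA0. simpl in HA0. rewrite Rmult_1_r in HA0.
      eexists.
      apply (maj_ext (fun s => 1 + (RtoC (-1)) * csum_lim (fun k => landau_term (landau m) k s))%C).
      { intros h _. simpl landau. ring. }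
      apply maj_plus; [lra|apply (maj_const (RtoC 1)); lra|]. apply maj_scal.
      apply (maj_csum_lim _ _ _ (fun k => 4 / 3 * A * (rbin b (S k) * (3 / 4) ^ (S k)))
         (4 / 3 * A * exp (- b * ln (1 - 3 / 4)))); [exact Hr| |].
      - intros k. apply (maj_le _ _ _ (rbin b (S k) * Cmod (RtoC (/ INR (S (S k)))) * (A * (3 / 4) ^ k))).
        + assert (H2 : 1 <= INR (S (S k))) by (change 1 with (INR 1); apply le_INR; lia).
          assert (0 < / INR (S (S k)) <= 1).
          { split; [apply Rinv_0_lt_compat; lra|]. rewrite <- Rinv_1. apply Rinv_le_contravar; lra. }
          rewrite Cmod_R, Rabs_pos_eq by lra.
          replace (4 / 3 * A * (rbin b (S k) * (3 / 4) ^ (S k)))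
            with (rbin b (S k) * 1 * (A * (3 / 4) ^ k)) by (rewrite <- tech_pow_Rmult; field).
          apply Rmult_le_compat_r; [apply Rmult_le_pos; [exact HA0|apply pow_le; lra]|].
          apply Rmult_le_compat_l; [apply rbin_nonneg, Hb|lra].
        + unfold landau_term.
          apply (maj_mult (fun s => cbin (s - 1) (S k) * RtoC (/ INR (S (S k))))%C
             (fun s => landau m (s + RtoC (INR (S k))))%C); [exact Hr| |].
          * apply maj_mult; [exact Hr|apply maj_cbin; exact Hr|apply maj_const; lra].
          * apply maj_translate. specialize (HA k).
            replace (z1 + RtoC (INR (S k)))%C with (z1 + 1 + RtoC (INR k))%C; [exact HA|].
            rewrite S_INR, RtoC_plus. ring.
      - intros N. rewrite rsum_scal. apply Rmult_le_compat_l; [lra|].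
        pose proof (rbin_partial_le b (3 / 4) (S N) Hb ltac:(lra)) as H.
        rewrite rsum_S_head in H. cbv beta in H.
        change (rbin b 0 * (3 / 4) ^ 0) with (1 * 1) in H. lra. }
    (* The recursion alone gives a majorant at each shift but no decay. Decay is recovered far to
       the right, where the new stage coincides with stage 0. *)
    destruct (INR_unbounded (2 - (Re z0 - r))) as [K HK].
    apply (maj_geometric_extend (landau (S m)) z0 r (3 / 4) ltac:(lra)) with (K := K).
    + intros k. apply Hex. rewrite re_plus, re_RtoC. pose proof (pos_INR k). lra.
    + destruct (maj_landau_0 (z0 + RtoC (INR K))%C r Hr) as [A HA].
      { rewrite re_plus, re_RtoC. lra. }
      exists A. intros k. specialize (HA k).
      replace (z0 + RtoC (INR (K + k)))%C with (z0 + RtoC (INR K) + RtoC (INR k))%C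
        by (rewrite plus_INR, RtoC_plus; ring).
      eapply maj_ext; [|exact HA]. intros h Hh. symmetry. apply landau_ge; [lia|].
      rewrite !re_plus, !re_RtoC. pose proof (pos_INR k). apply Cmod_Re_ge in Hh. simpl. lra.
Qed.

(** The stage is chosen large enough for the half-plane containing s; all valid stages agree, so
    locally one fixed stage can be used. *)
Definition zeta0 (s : C) : C :=
  (1 + landau (Z.to_nat (up (1 - Re s))) s * / (s - 1))%C.

Lemma up_nat_gt x : x < INR (Z.to_nat (up x)).
Proof.
  destruct (archimed x) as [H _]. destruct (Z_le_gt_dec 0 (up x)) as [H0|H0].
  - rewrite INR_IZR_INZ, Z2Nat.id by exact H0. lra.
  - assert (IZR (up x) < 0) by (apply IZR_lt; lia). pose proof (pos_INR (Z.to_nat (up x))). lra.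
Qed.

Lemma zeta0_landau m s : 1 - INR m < Re s -> zeta0 s = (1 + landau m s * / (s - 1))%C.
Proof.
  intros Hm. unfold zeta0. do 2 f_equal. apply landau_indep; [|exact Hm].
  pose proof (up_nat_gt (1 - Re s)). lra.
Qed.

Lemma zeta0_is_zeta : is_riemann_zeta zeta0.
Proof.
  split.
  - intros s Hs. apply csums_is_series.
    change (csums (fun n => npow (S n) s) (zeta0 s)).
    rewrite (zeta0_landau 0) by (simpl; lra). simpl landau.
    assert (Hn : (s - 1)%C <> 0).
    { intros E. assert (s = 1) as ->.
      { replace s with ((s - 1) + 1)%C by ring. rewrite E. ring. } simpl in Hs. lra. }
    replace (1 + (s - 1) * dirichlet_tail s * / (s - 1))%C
      with (csum (fun n => npow (S n) s) 1 + dirichlet_tail s)%C.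
    + apply csums_shift. eapply csums_ext; [|apply dirichlet_tail_csums, Hs].
      intros k. cbv beta. replace (k + 2)%nat with (S (1 + k)) by lia. reflexivity.
    + simpl csum. rewrite npow_1. field. exact Hn.
  - intros s Hs.
    assert (Hn : 0 < Cmod (s - 1)).
    { apply Cmod_gt_0. intros E. apply Hs. replace s with ((s - 1) + 1)%C by ring. rewrite E. ring. }
    set (r := Rmin (1 / 2) (Cmod (s - 1) / 2)).
    assert (Hr : 0 < r /\ r <= 1 / 2 /\ r <= Cmod (s - 1) / 2).
    { unfold r. split; [apply Rmin_pos; lra|split; [apply Rmin_l|apply Rmin_r]]. }
    (* One unit more than s itself requires, so that a single stage is valid on the whole disc of
       radius at most 1/2. *)
    set (m := Z.to_nat (up (2 - Re s))). pose proof (up_nat_gt (2 - Re s)) as Hm. fold m in Hm.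
    destruct (maj_landau m s r ltac:(lra) ltac:(lra)) as [A HA]. specialize (HA O).
    replace (s + RtoC (INR 0))%C with s in HA by (simpl; ring).
    eapply (maj_analytic _ _ r); [lra|].
    apply (maj_ext (fun s => 1 + landau m s * / (s - 1))%C).
    { intros h Hh. symmetry. apply zeta0_landau. rewrite re_plus. apply Cmod_Re_ge in Hh. lra. }
    apply maj_plus; [lra|apply (maj_const (RtoC 1)); lra|].
    apply maj_mult; [lra|exact HA|]. apply maj_inv; lra.
Qed.

Lemma riemann_zeta_spec : is_riemann_zeta riemann_zeta.
Proof. unfold riemann_zeta. apply epsilon_spec. exists zeta0. apply zeta0_is_zeta. Qed.

(** * The identity theorem *)

Lemma csums_terms_bounded f l : csums f l -> exists A, 0 <= A /\ forall k, Cmod (f k) <= A.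
Proof.
  intros H. destruct (H 1 ltac:(lra)) as [N HN].
  assert (H0 : 0 <= rsum (fun k => Cmod (f k)) N) by (apply rsum_nonneg; intros; apply Cmod_ge_0).
  exists (rsum (fun k => Cmod (f k)) N + 2). split; [lra|]. intros k.
  destruct (Nat.lt_ge_cases k N) as [Hk|Hk].
  - assert (Cmod (f k) <= rsum (fun k => Cmod (f k)) N); [|lra].
    apply Rle_trans with (rsum (fun k => Cmod (f k)) (S k)).
    + simpl. pose proof (rsum_nonneg (fun k => Cmod (f k)) k (fun j _ => Cmod_ge_0 _)). lra.
    + apply rsum_mono; [intros; apply Cmod_ge_0|lia].
  - pose proof (HN k Hk) as A. pose proof (HN (S k) ltac:(lia)) as B. simpl in B.
    pose proof (Cmod_triangle3 (csum f k + f k) l (csum f k)) as T.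
    rewrite (Cmod_sub_sym l) in T.
    replace (csum f k + f k - csum f k)%C with (f k) in T by ring. lra.
Qed.

Definition has_ps (f : C -> C) (z0 : C) (a : nat -> C) (r : R) : Prop :=
  forall h, Cmod h < r -> csums (fun k => a k * h ^ k)%C (f (z0 + h)%C).

Lemma analytic_has_ps f z0 : analytic_at f z0 -> exists a r, 0 < r /\ has_ps f z0 a r.
Proof.
  intros [a [r [Hr H]]]. exists a, r. split; [exact Hr|]. intros h Hh.
  specialize (H (z0 + h)%C). replace (z0 + h - z0)%C with h in H by ring.
  specialize (H Hh). unfold is_pseries in H. apply csums_is_series in H.
  eapply csums_ext; [|exact H]. intros k.
  change (h ^ k * a k = a k * h ^ k)%C. ring.
Qed.

Lemma has_ps_coef_bound f z0 a r : 0 < r -> has_ps f z0 a r ->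
  exists A, 0 <= A /\ forall k, Cmod (a k) * (r / 2) ^ k <= A.
Proof.
  intros Hr H.
  assert (Hm : Cmod (RtoC (r / 2)) = r / 2) by (rewrite Cmod_R; apply Rabs_pos_eq; lra).
  destruct (csums_terms_bounded _ _ (H (RtoC (r / 2)) ltac:(lra))) as [A [HA Hb]].
  exists A. split; [exact HA|]. intros k. specialize (Hb k).
  rewrite Cmod_mult, Cmod_pow, Hm in Hb. exact Hb.
Qed.

(** Beyond index k the series is dominated by a geometric one of ratio at most 1/2, hence the factor
    2. Index 0 yields the Lipschitz bound, general k the identity theorem. *)
Lemma ps_leading_term a rho A h l k : 0 < rho -> 0 <= A ->
  (forall j, Cmod (a j) * rho ^ j <= A) -> Cmod h <= rho / 2 ->
  (forall j, (j < k)%nat -> a j = RtoC 0) ->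
  csums (fun j => a j * h ^ j)%C l ->
  Cmod (l - a k * h ^ k) <= 2 * A * (Cmod h / rho) ^ (S k).
Proof.
  intros Hr HA Ha Hh H0 Hl.
  pose proof (Cmod_ge_0 h) as Hh0.
  set (q := Cmod h / rho).
  assert (Hq : 0 <= q <= 1 / 2).
  { unfold q. split; [apply Rdiv_le_0_compat; lra|].
    apply Rmult_le_reg_r with rho; [lra|]. replace (Cmod h / rho * rho) with (Cmod h) by (field; lra). lra. }
  assert (E : csum (fun j => a j * h ^ j)%C (S k) = (a k * h ^ k)%C).
  { simpl csum. rewrite (csum_ext _ (fun _ => RtoC 0)), csum_0; [ring|].
    intros j Hj. rewrite H0 by exact Hj. ring. }
  apply (csums_Cmod_le (fun j => a (S k + j)%nat * h ^ (S k + j))%C).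
  - apply (csums_shift (S k) (fun j => a j * h ^ j)%C). rewrite E.
    replace (a k * h ^ k + (l - a k * h ^ k))%C with l by ring. exact Hl.
  - intros N. apply Rle_trans with (rsum (fun j => A * q ^ (S k) * q ^ j) N).
    + apply rsum_le. intros j _. rewrite Cmod_mult, Cmod_pow.
      replace (A * q ^ S k * q ^ j) with (A * q ^ (S k + j)) by (rewrite pow_add; ring).
      unfold q, Rdiv. rewrite Rpow_mult_distr, pow_inv.
      pose proof (pow_lt rho (S k + j) Hr) as Hp.
      apply Rmult_le_reg_r with (rho ^ (S k + j)); [exact Hp|].
      specialize (Ha (S k + j)%nat).
      replace (A * (Cmod h ^ (S k + j) * / rho ^ (S k + j)) * rho ^ (S k + j))
        with (A * Cmod h ^ (S k + j)) by (field; lra).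
      pose proof (pow_le (Cmod h) (S k + j) Hh0).
      replace (Cmod (a (S k + j)%nat) * Cmod h ^ (S k + j) * rho ^ (S k + j))
        with (Cmod (a (S k + j)%nat) * rho ^ (S k + j) * Cmod h ^ (S k + j)) by ring.
      apply Rmult_le_compat_r; assumption.
    + rewrite rsum_scal. pose proof (rsum_geom_le q N ltac:(lra)) as Hg.
      assert (/ (1 - q) <= 2).
      { rewrite <- (Rinv_inv 2). apply Rinv_le_contravar; lra. }
      assert (0 <= A * q ^ S k) by (apply Rmult_le_pos; [exact HA|apply pow_le; lra]).
      apply Rle_trans with (A * q ^ S k * 2);
        [apply Rmult_le_compat_l; [assumption|eapply Rle_trans; [exact Hg|assumption]]|right; ring].
Qed.

Lemma analytic_lipschitz f z0 : analytic_at f z0 ->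
  exists L r, 0 < r /\ 0 <= L /\ forall h, Cmod h < r -> Cmod (f (z0 + h)%C - f z0) <= L * Cmod h.
Proof.
  intros H. destruct (analytic_has_ps f z0 H) as [a [r [Hr Hps]]].
  destruct (has_ps_coef_bound f z0 a r Hr Hps) as [A [HA Hb]].
  exists (2 * A / (r / 2)), (r / 4).
  split; [lra|]. split; [apply Rdiv_le_0_compat; lra|]. intros h Hh.
  assert (E : a O = f z0).
  { pose proof (Hps 0 ltac:(rewrite Cmod_0; lra)) as H0.
    replace (z0 + 0)%C with z0 in H0 by ring.
    apply (csums_unique (fun k => a k * 0 ^ k)%C); [|exact H0].
    replace (a O) with (csum (fun k => a k * 0 ^ k)%C 1) by (simpl; ring).
    apply csums_fin. intros k Hk. destruct k; [lia|]. simpl. ring. }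
  pose proof (ps_leading_term a (r / 2) A h (f (z0 + h)%C) 0 ltac:(lra) HA Hb ltac:(lra)) as HL.
  specialize (HL ltac:(intros; lia) (Hps h ltac:(lra))).
  rewrite E in HL. simpl in HL. rewrite Cmult_1_r, Rmult_1_r in HL.
  unfold Rdiv in *. lra.
Qed.

(** If the lower coefficients vanish, a zero at distance y gives |a_k| y^k <= B y^(k+1); let y tend
    to 0. *)
Lemma ps_zero_of_ray f z0 a r (u : C) d : 0 < r -> has_ps f z0 a r -> Cmod u = 1 -> 0 < d ->
  (forall y, 0 < y < d -> f (z0 + u * RtoC y)%C = 0) -> forall k, a k = RtoC 0.
Proof.
  intros Hr Hps Hu Hd H0.
  destruct (has_ps_coef_bound f z0 a r Hr Hps) as [A [HA Hb]].
  intros k. induction k as [k IH] using (well_founded_induction lt_wf).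
  apply Cmod_small_0. intros eps He.
  set (B := 2 * A * (/ (r / 2)) ^ S k).
  assert (HB : 0 <= B).
  { unfold B. apply Rmult_le_pos; [lra|]. apply pow_le. left. apply Rinv_0_lt_compat; lra. }
  set (y := Rmin (r / 4) (Rmin (d / 2) (eps / (2 * (B + 1))))).
  assert (Hy : 0 < y /\ y <= r / 4 /\ y <= d / 2 /\ y <= eps / (2 * (B + 1))).
  { unfold y. repeat split.
    - repeat apply Rmin_pos; try lra. apply Rdiv_lt_0_compat; lra.
    - apply Rmin_l.
    - eapply Rle_trans; [apply Rmin_r|apply Rmin_l].
    - eapply Rle_trans; [apply Rmin_r|apply Rmin_r]. }
  destruct Hy as [Hy0 [Hy1 [Hy2 Hy3]]].
  assert (Hm : Cmod (u * RtoC y) = y).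
  { rewrite Cmod_mult, Hu, Cmod_R, Rabs_pos_eq; lra. }
  pose proof (ps_leading_term a (r / 2) A (u * RtoC y) (f (z0 + u * RtoC y)%C) k
    ltac:(lra) HA Hb ltac:(lra) IH (Hps (u * RtoC y)%C ltac:(lra))) as HL.
  rewrite H0 in HL by lra.
  replace (0 - a k * (u * RtoC y) ^ k)%C with (- (a k * (u * RtoC y) ^ k))%C in HL by ring.
  rewrite Cmod_opp, Cmod_mult, Cmod_pow, Hm in HL.
  assert (HL2 : Cmod (a k) <= B * y).
  { apply Rmult_le_reg_r with (y ^ k); [apply pow_lt; exact Hy0|].
    eapply Rle_trans; [exact HL|]. right. unfold B, Rdiv at 1. rewrite Rpow_mult_distr. simpl. ring. }
  apply Rle_lt_trans with (B * (eps / (2 * (B + 1)))).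
  - eapply Rle_trans; [exact HL2|]. apply Rmult_le_compat_l; assumption.
  - apply Rmult_lt_reg_r with (2 * (B + 1)); [lra|].
    replace (B * (eps / (2 * (B + 1))) * (2 * (B + 1))) with (B * eps) by (field; lra). nra.
Qed.

Lemma has_ps_zero f z0 a r : has_ps f z0 a r -> (forall k, a k = RtoC 0) ->
  forall h, Cmod h < r -> f (z0 + h)%C = 0.
Proof.
  intros Hps Ha h Hh. apply (csums_unique _ _ _ (Hps h Hh)).
  apply (csums_fin _ 0). intros k _. rewrite Ha. ring.
Qed.

(** Continuation along a half-line through the supremum m of the initial zero segments: looking back
    from m all coefficients vanish, so the zeros extend beyond m. *)
Lemma line_identity f z0 (u : C) : Cmod u = 1 ->
  (forall x, 0 <= x -> analytic_at f (z0 + u * RtoC x)%C) ->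
  (exists d, 0 < d /\ forall x, 0 <= x < d -> f (z0 + u * RtoC x)%C = 0) ->
  forall x, 0 <= x -> f (z0 + u * RtoC x)%C = 0.
Proof.
  intros Hu Han [d [Hd H0]] x Hx. apply NNPP. intros Hx0.
  set (E := fun y => 0 <= y /\ forall t, 0 <= t < y -> f (z0 + u * RtoC t)%C = 0).
  assert (HE : E d) by (split; [lra|exact H0]).
  destruct (completeness E) as [m [Hm1 Hm2]].
  - exists x. intros y [Hy Hy0]. apply Rnot_lt_le. intros Hlt. apply Hx0, Hy0. lra.
  - exists d. exact HE.
  - assert (Hdm : d <= m) by (apply Hm1; exact HE).
    assert (Hbelow : forall t, 0 <= t < m -> f (z0 + u * RtoC t)%C = 0).
    { intros t Ht. apply NNPP. intros Hn. apply (Rlt_irrefl m).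
      apply Rle_lt_trans with t; [|lra]. apply Hm2. intros y [Hy Hy0].
      apply Rnot_lt_le. intros Hlt. apply Hn, Hy0. lra. }
    destruct (analytic_has_ps _ _ (Han m ltac:(lra))) as [a [r [Hr Hps]]].
    assert (Ha : forall k, a k = RtoC 0).
    { apply (ps_zero_of_ray f (z0 + u * RtoC m)%C a r (- u)%C d Hr Hps); [rewrite Cmod_opp; exact Hu|exact Hd|].
      intros y Hy. rewrite <- (Hbelow (m - y)) by lra. f_equal. rewrite RtoC_minus. ring. }
    apply (Rlt_irrefl m). apply Rlt_le_trans with (m + r / 2); [lra|].
    apply Hm1. split; [lra|]. intros t Ht. destruct (Rlt_or_le t m) as [Htm|Htm]; [apply Hbelow; lra|].
    rewrite <- (has_ps_zero _ _ _ _ Hps Ha (u * RtoC (t - m))%C).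
    + f_equal. rewrite RtoC_minus. ring.
    + rewrite Cmod_mult, Hu, Cmod_R, Rabs_pos_eq; lra.
Qed.

Lemma analytic_minus f g z0 : analytic_at f z0 -> analytic_at g z0 ->
  analytic_at (fun s => f s - g s)%C z0.
Proof.
  intros Hf Hg. destruct Hf as [a [r [Hr Ha]]], Hg as [b [r' [Hr' Hb]]].
  exists (PS_minus a b), (Rmin r r'). split; [apply Rmin_pos; assumption|].
  intros z Hz.
  apply (is_pseries_minus a b).
  - apply Ha. eapply Rlt_le_trans; [exact Hz|apply Rmin_l].
  - apply Hb. eapply Rlt_le_trans; [exact Hz|apply Rmin_r].
Qed.

Lemma Im_pos_neq_1 (s : C) : 0 < Im s -> s <> RtoC 1.
Proof. intros H ->. simpl in H. lra. Qed.

Lemma riemann_zeta_analytic s : s <> RtoC 1 -> analytic_at riemann_zeta s.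
Proof. apply riemann_zeta_spec. Qed.

Lemma riemann_zeta_csums s : 1 < Re s -> csums (fun n => npow (S n) s) (riemann_zeta s).
Proof.
  intros Hs. apply csums_is_series. exact (proj1 riemann_zeta_spec s Hs).
Qed.

Lemma riemann_zeta_eq_zeta0 s : 0 < Im s -> riemann_zeta s = zeta0 s.
Proof.
  intros Hs. apply Ceq_minus.
  (* The leftward ray starts here: its first unit stays in Re > 1, where both functions equal the
     Dirichlet series, and its positive height avoids the pole. *)
  set (z0 := (Rabs (Re s) + 2, Im s) : C).
  assert (E : forall x, (z0 + - (1) * RtoC x)%C = (Rabs (Re s) + 2 - x, Im s)).
  { intros x. unfold z0. apply Ceq; simpl; ring. }
  pose proof (line_identity (fun s => riemann_zeta s - zeta0 s)%C z0 (- (1))%C) as H.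
  rewrite Cmod_m1 in H. specialize (H eq_refl).
  pose proof (Rle_abs (Re s)) as Hab. pose proof (Rabs_pos (Re s)) as Hab0.
  assert (E2 : s = (z0 + - (1) * RtoC (Rabs (Re s) + 2 - Re s))%C).
  { rewrite E. apply Ceq; simpl; ring. }
  rewrite E2. apply H; [| |lra].
  - intros x Hx. rewrite E. apply analytic_minus.
    + apply riemann_zeta_analytic, Im_pos_neq_1. exact Hs.
    + apply (proj2 zeta0_is_zeta), Im_pos_neq_1. exact Hs.
  - exists 1. split; [lra|]. intros x Hx. rewrite E. apply (proj1 (Ceq_minus _ _)).
    apply (csums_unique (fun n => npow (S n) (Rabs (Re s) + 2 - x, Im s))).
    + apply riemann_zeta_csums. simpl. lra.
    + apply csums_is_series. apply (proj1 zeta0_is_zeta). simpl. lra.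
Qed.

Lemma riemann_zeta_lower s : 3 <= Re s -> 1 / 2 <= Cmod (riemann_zeta s).
Proof.
  intros Hs. pose proof (riemann_zeta_csums s ltac:(lra)) as H.
  assert (Ht : csums (fun k => npow (S (1 + k)) s) (riemann_zeta s - 1)%C).
  { apply (csums_shift 1 (fun n => npow (S n) s)). simpl csum. rewrite npow_1.
    replace (0 + 1 + (riemann_zeta s - 1))%C with (riemann_zeta s) by ring. exact H. }
  assert (Hb : Cmod (riemann_zeta s - 1) <= 1 / 2).
  { apply (csums_Cmod_le _ _ _ Ht). intros N.
    apply Rle_trans with (rp 1 (Re s - 1) / (Re s - 1)).
    - eapply Rle_trans; [|apply (rp_tail 1 (Re s - 1) N); [lia|lra]].
      right. apply rsum_ext. intros k _. rewrite Cmod_npow. f_equal. ring.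
    - rewrite rp_1. unfold Rdiv. rewrite !Rmult_1_l. apply Rinv_le_contravar; lra. }
  pose proof (Cmod_triangle_minus 1 (riemann_zeta s - 1)) as T. rewrite Cmod_1 in T.
  replace (1 + (riemann_zeta s - 1))%C with (riemann_zeta s) in T by ring. lra.
Qed.

(** Zeros on a vertical segment would kill every coefficient at its midpoint, hence zeta on the
    horizontal ray to the right, against the lower bound for Re s >= 3. *)
Lemma riemann_zeta_nonzero_on_segment sigma t1 t2 : 0 < t1 < t2 ->
  exists t, t1 < t < t2 /\ riemann_zeta (sigma, t) <> 0.
Proof.
  intros Ht. apply NNPP. intros Hno.
  assert (H0 : forall t, t1 < t < t2 -> riemann_zeta (sigma, t) = 0).
  { intros t Htt. apply NNPP. intros Hn. apply Hno. exists t. split; assumption. }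
  set (t0 := (t1 + t2) / 2). set (z0 := (sigma, t0) : C).
  assert (Han : forall x, analytic_at riemann_zeta (z0 + 1 * RtoC x)%C).
  { intros x. apply riemann_zeta_analytic, Im_pos_neq_1. simpl. unfold t0. lra. }
  destruct (analytic_has_ps riemann_zeta z0) as [a [r [Hr Hps]]].
  { replace z0 with (z0 + 1 * RtoC 0)%C by ring. apply Han. }
  assert (Ha : forall k, a k = RtoC 0).
  { apply (ps_zero_of_ray riemann_zeta z0 a r Ci ((t2 - t1) / 2) Hr Hps); [|lra|].
    - unfold Ci, Cmod; simpl. replace (0 * (0 * 1) + 1 * (1 * 1)) with 1 by ring. apply sqrt_1.
    - intros y Hy. replace (z0 + Ci * RtoC y)%C with ((sigma, t0 + y) : C)
        by (apply Ceq; simpl; ring).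
      apply H0. unfold t0. lra. }
  assert (Hz : riemann_zeta (z0 + 1 * RtoC (Rabs sigma + 3))%C = 0).
  { apply line_identity; [apply Cmod_1|intros; apply Han| |pose proof (Rabs_pos sigma); lra].
    exists r. split; [exact Hr|]. intros x Hx. apply (has_ps_zero _ _ _ _ Hps Ha).
    rewrite Cmod_mult, Cmod_1, Cmod_R, Rabs_pos_eq; lra. }
  pose proof (riemann_zeta_lower (z0 + 1 * RtoC (Rabs sigma + 3))%C) as HL.
  rewrite Hz, Cmod_0 in HL.
  assert (3 <= Re (z0 + 1 * RtoC (Rabs sigma + 3))%C); [|lra].
  simpl. pose proof (Rle_abs (- sigma)). rewrite Rabs_Ropp in H. lra.
Qed.

(** * Approximation by partial sums *)

Lemma rbin_le_pow a k : 1 <= a -> rbin a k <= a ^ k.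
Proof.
  intros Ha. induction k as [|k IH]; [simpl; lra|].
  change (rbin a k * ((a + INR k) * / INR (S k)) <= a * a ^ k).
  assert (HS : 0 < INR (S k)) by (apply lt_0_INR; lia).
  assert (Hq : (a + INR k) * / INR (S k) <= a).
  { apply Rmult_le_reg_r with (INR (S k)); [exact HS|].
    rewrite Rmult_assoc, Rinv_l, Rmult_1_r by lra. rewrite S_INR. pose proof (pos_INR k). nra. }
  rewrite Rmult_comm. apply Rmult_le_compat; [|apply rbin_nonneg; lra|exact Hq|exact IH].
  apply Rmult_le_pos; [pose proof (pos_INR k); lra|left; apply Rinv_0_lt_compat, HS].
Qed.

(** The coefficients are at most a^k, so for n + 1 >= 2a the expansion is geometric of ratio at most
    1/2 and its first term dominates. *)
Lemma telescope_term_bound s a n : 1 <= a -> Cmod (s - 1) <= a -> (1 <= n)%nat ->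
  2 * a <= INR (S n) -> Cmod (telescope_term n s) <= 2 * a ^ 2 * rp (S n) (Re s + 1).
Proof.
  intros Ha Hs Hn Hna. apply (csums_Cmod_le _ _ _ (telescope_term_series s n Hn)).
  intros N. set (q := a * / INR (S n)).
  assert (Hq : 0 <= q <= 1 / 2).
  { unfold q. split; [apply Rmult_le_pos; [lra|left; apply Rinv_0_lt_compat; lra]|].
    apply Rmult_le_reg_r with (INR (S n)); [lra|]. rewrite Rmult_assoc, Rinv_l by lra. lra. }
  apply Rle_trans with (rsum (fun k => a ^ 2 * rp (S n) (Re s + 1) * q ^ k) N).
  - apply rsum_le. intros k _. rewrite Cmod_mult, Cmod_npow, re_plus, re_RtoC, S_INR.
    replace (Re s + (INR k + 1)) with ((Re s + 1) + INR k) by ring.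
    rewrite rp_plus, rp_INR by lia.
    replace (a ^ 2 * rp (S n) (Re s + 1) * q ^ k)
      with (a ^ (2 + k) * (rp (S n) (Re s + 1) * (/ INR (S n)) ^ k))
      by (unfold q; rewrite Rpow_mult_distr, pow_add; ring).
    apply Rmult_le_compat_r.
    + apply Rmult_le_pos; [left; apply rp_pos|]. apply pow_le. left. apply Rinv_0_lt_compat; lra.
    + eapply Rle_trans; [apply cbin_le; exact Hs|]. apply rbin_le_pow. exact Ha.
  - rewrite rsum_scal. pose proof (rsum_geom_le q N ltac:(lra)) as Hg.
    assert (/ (1 - q) <= 2).
    { rewrite <- (Rinv_inv 2). apply Rinv_le_contravar; lra. }
    assert (0 <= a ^ 2 * rp (S n) (Re s + 1)).
    { apply Rmult_le_pos; [apply pow_le; lra|left; apply rp_pos]. }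
    apply Rle_trans with (a ^ 2 * rp (S n) (Re s + 1) * 2);
      [apply Rmult_le_compat_l; [assumption|eapply Rle_trans; [exact Hg|assumption]]|right; ring].
Qed.

(** After telescoping up to N, what remains is the boundary term N^(1-s) and the tail of the
    telescoping series, divided by s - 1, whose modulus is at least Im s. *)
Lemma riemann_zeta_approx s a N : 0 < Re s -> 0 < Im s -> 1 <= a -> Cmod (s - 1) <= a ->
  (1 <= N)%nat -> 2 * a <= INR N ->
  Cmod (riemann_zeta s - csum (fun n => npow (S n) s) N)
    <= (rp N (Re s - 1) + 2 * a ^ 2 * (rp N (Re s) / Re s)) / Im s.
Proof.
  intros Hs Hi Ha Hsa HN HaN. destruct N as [|N]; [lia|].
  rewrite riemann_zeta_eq_zeta0 by exact Hi.
  rewrite (zeta0_landau 1) by (simpl; lra).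
  destruct (landau_1_telescope s Hs) as [l [Hl E]]. rewrite E.
  assert (Hn : (s - 1)%C <> 0).
  { intros E1. apply (Im_pos_neq_1 s Hi). replace s with ((s - 1) + 1)%C by ring. rewrite E1. ring. }
  set (tl := (l - csum (fun n => telescope_term (S n) s) N)%C).
  assert (Htl : Cmod tl <= 2 * a ^ 2 * (rp (S N) (Re s) / Re s)).
  { apply (csums_Cmod_le (fun k => telescope_term (S (N + k)) s)).
    - apply (csums_shift N (fun n => telescope_term (S n) s)).
      unfold tl.
      replace (csum (fun n => telescope_term (S n) s) N + (l - csum (fun n => telescope_term (S n) s) N))%C
        with l by ring. exact Hl.
    - intros K. apply Rle_trans with
        (2 * a ^ 2 * rsum (fun k => rp (S (S N + k)) (Re s + 1)) K).
      + rewrite <- rsum_scal. apply rsum_le. intros k _. apply telescope_term_bound; auto; [lia|].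
        eapply Rle_trans; [exact HaN|]. apply le_INR. lia.
      + apply Rmult_le_compat_l; [pose proof (pow_le a 2 ltac:(lra)); lra|].
        apply rp_tail; [lia|exact Hs]. }
  assert (Eq : (1 + (1 - l) * / (s - 1) - csum (fun n => npow (S n) s) (S N))%C
     = ((npow (S N) (s - 1) - tl) * / (s - 1))%C).
  { assert (El : l = (csum (fun n => telescope_term (S n) s) N + tl)%C) by (unfold tl; ring).
    rewrite El, telescope_partial, csum_S_head, npow_1.
    rewrite (csum_ext (fun k => npow (S (S k)) s) (fun n => npow (n + 2) s)).
    - field. exact Hn.
    - intros k _. f_equal. lia. }
  rewrite Eq, Cmod_mult, Cmod_inv by exact Hn.
  assert (Him : Im s <= Cmod (s - 1)).
  { eapply Rle_trans; [apply Rle_abs|]. eapply Rle_trans; [|apply Rmax_Cmod].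
    eapply Rle_trans; [|apply Rmax_r]. right. f_equal. destruct s; simpl. ring. }
  unfold Rdiv at 1.
  apply Rmult_le_compat; [apply Cmod_ge_0|left; apply Rinv_0_lt_compat; lra| |].
  - unfold Cminus at 1. eapply Rle_trans; [apply Cmod_triangle|]. rewrite Cmod_opp, Cmod_npow.
    replace (Re (s - 1)%C) with (Re s - 1)
      by (unfold Cminus; rewrite re_plus, re_opp, re_RtoC; ring).
    lra.
  - apply Rinv_le_contravar; assumption.
Qed.

(** * A two-constants theorem for exponential sums *)

Lemma maj_shrink f z0 r r' M : 0 <= r' <= r -> maj f z0 r M -> maj f z0 r' M.
Proof.
  intros Hr [a [H1 H2]]. exists a. split.
  - intros N. eapply Rle_trans; [|apply (H1 N)]. apply rsum_le. intros k _.
    apply Rmult_le_compat_l; [apply Cmod_ge_0|]. apply pow_incr. exact Hr.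
  - intros h Hh. apply H2. lra.
Qed.

Definition holo (f : C -> C) (z : C) : Prop := exists r M, 0 < r /\ maj f z r M.

Lemma holo_const c z : holo (fun _ => c) z.
Proof. exists 1, (Cmod c). split; [lra|]. apply maj_const. lra. Qed.

Lemma holo_id_minus c z : holo (fun s => s - c)%C z.
Proof. exists 1, (Cmod (z - c) + 1). split; [lra|]. apply maj_id_minus. lra. Qed.

Lemma holo_Cexp c z : holo (fun s => Cexp (c * s)) z.
Proof. exists 1. eexists. split; [lra|]. apply maj_Cexp. lra. Qed.

Lemma holo_inv c z : z <> c -> holo (fun s => / (s - c))%C z.
Proof.
  intros H. assert (Hn : 0 < Cmod (z - c)).
  { apply Cmod_gt_0. intros E. apply H, Ceq_minus, E. }
  exists (Cmod (z - c) / 2). eexists. split; [lra|]. apply maj_inv; lra.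
Qed.

Lemma holo_common f g z : holo f z -> holo g z ->
  exists r M M', 0 < r /\ maj f z r M /\ maj g z r M'.
Proof.
  intros [r [M [Hr HM]]] [r' [M' [Hr' HM']]].
  exists (Rmin r r'), M, M'.
  assert (0 < Rmin r r') by (apply Rmin_pos; assumption).
  pose proof (Rmin_l r r'). pose proof (Rmin_r r r').
  split; [assumption|]. split; eapply maj_shrink; try eassumption; lra.
Qed.

Lemma holo_plus f g z : holo f z -> holo g z -> holo (fun s => f s + g s)%C z.
Proof.
  intros Hf Hg. destruct (holo_common f g z Hf Hg) as [r [M [M' [Hr [H H']]]]].
  exists r. eexists. split; [exact Hr|]. apply maj_plus; [lra|exact H|exact H'].
Qed.

Lemma holo_mult f g z : holo f z -> holo g z -> holo (fun s => f s * g s)%C z.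
Proof.
  intros Hf Hg. destruct (holo_common f g z Hf Hg) as [r [M [M' [Hr [H H']]]]].
  exists r. eexists. split; [exact Hr|]. apply maj_mult; [lra|exact H|exact H'].
Qed.

Lemma holo_pow f z n : holo f z -> holo (fun s => f s ^ n)%C z.
Proof.
  intros Hf. induction n as [|n IH]; simpl; [apply holo_const|apply holo_mult; assumption].
Qed.

Lemma holo_csum (f : nat -> C -> C) z N : (forall n, holo (f n) z) ->
  holo (fun s => csum (fun n => f n s) N) z.
Proof.
  intros Hf. induction N as [|N IH]; simpl; [apply holo_const|apply holo_plus; auto].
Qed.

Lemma maj_second_order f z r M : 0 < r -> maj f z r M ->
  exists a0 a1 a2, f z = a0 /\ forall h, Cmod h <= r ->
    Cmod (f (z + h)%C - (a0 + a1 * h + a2 * (h * h)))%C <= M * (Cmod h / r) ^ 3.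
Proof.
  intros Hr [a [H1 H2]]. exists (a 0%nat), (a 1%nat), (a 2%nat). split.
  - pose proof (H2 0 ltac:(rewrite Cmod_0; lra)) as H0.
    replace (z + 0)%C with z in H0 by ring. apply (csums_unique _ _ _ H0).
    replace (a O) with (csum (fun k => a k * 0 ^ k)%C 1) by (simpl; ring).
    apply csums_fin. intros k Hk. destruct k; [lia|]. simpl. ring.
  - intros h Hh. pose proof (Cmod_ge_0 h) as Hh0.
    assert (Hq : 0 <= Cmod h / r <= 1).
    { split; [apply Rdiv_le_0_compat; lra|].
      apply Rmult_le_reg_r with r; [lra|]. field_simplify; lra. }
    apply (csums_Cmod_le (fun k => a (3 + k)%nat * h ^ (3 + k))%C).
    + apply (csums_shift 3 (fun k => a k * h ^ k)%C).
      match goal with |- csums _ ?l => replace l with (f (z + h)%C) by (simpl; ring) end.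
      apply H2, Hh.
    + intros N.
      apply Rle_trans with ((Cmod h / r) ^ 3 * rsum (fun k => Cmod (a (3 + k)%nat) * r ^ (3 + k)) N).
      * rewrite <- rsum_scal. apply rsum_le. intros k _. rewrite Cmod_mult, Cmod_pow.
        replace ((Cmod h / r) ^ 3 * (Cmod (a (3 + k)%nat) * r ^ (3 + k)))
          with (Cmod (a (3 + k)%nat) * (Cmod h ^ 3 * r ^ k))
          by (rewrite (pow_add r 3 k); field; lra).
        rewrite pow_add. apply Rmult_le_compat_l; [apply Cmod_ge_0|].
        apply Rmult_le_compat_l; [apply pow_le; exact Hh0|]. apply pow_incr. lra.
      * rewrite Rmult_comm. apply Rmult_le_compat_r; [apply pow_le; lra|].
        specialize (H1 (3 + N)%nat). rewrite rsum_split in H1.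
        pose proof (rsum_nonneg (fun k => Cmod (a k) * r ^ k) 3) as H3.
        specialize (H3 (fun k _ => Rmult_le_pos _ _ (Cmod_ge_0 _) (pow_le r k ltac:(lra)))). lra.
Qed.

(* The linear and quadratic terms cancel in the sum over the four points z +- t, z +- it. *)
Lemma four_point f z r M t : 0 < t <= r -> maj f z r M ->
  4 * Cmod (f z) - 4 * (M * (t / r) ^ 3) <=
    Cmod (f (z + RtoC t)%C) + Cmod (f (z - RtoC t)%C)
    + Cmod (f (z + Ci * RtoC t)%C) + Cmod (f (z - Ci * RtoC t)%C).
Proof.
  intros Ht Hf. destruct (maj_second_order f z r M ltac:(lra) Hf) as [a0 [a1 [a2 [E H]]]].
  assert (Hci : Cmod Ci = 1).
  { unfold Ci, Cmod; simpl. replace (0 * (0 * 1) + 1 * (1 * 1)) with 1 by ring. apply sqrt_1. }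
  assert (Hi2 : (Ci * Ci)%C = (- (1))%C) by (apply Ceq; simpl; ring).
  assert (Hcases : forall u : C, Cmod u = 1 ->
    Cmod (f (z + u * RtoC t)%C - (a0 + a1 * (u * RtoC t) + a2 * ((u * RtoC t) * (u * RtoC t))))%C
      <= M * (t / r) ^ 3).
  { intros u Hu. assert (Hm : Cmod (u * RtoC t) = t).
    { rewrite Cmod_mult, Hu, Cmod_R, Rabs_pos_eq; lra. }
    pose proof (H (u * RtoC t)%C ltac:(lra)) as H1. rewrite Hm in H1. exact H1. }
  pose proof (Hcases 1 Cmod_1) as A1. pose proof (Hcases (- (1))%C Cmod_m1) as A2.
  pose proof (Hcases Ci Hci) as A3.
  pose proof (Hcases (- Ci)%C ltac:(rewrite Cmod_opp; exact Hci)) as A4. clear Hcases H.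
  replace (z + 1 * RtoC t)%C with (z + RtoC t)%C in A1 by ring.
  replace (z + - (1) * RtoC t)%C with (z - RtoC t)%C in A2 by ring.
  replace (z + - Ci * RtoC t)%C with (z - Ci * RtoC t)%C in A4 by ring.
  replace (Ci * RtoC t * (Ci * RtoC t))%C with ((Ci * Ci) * (RtoC t * RtoC t))%C in A3 by ring.
  replace (- Ci * RtoC t * (- Ci * RtoC t))%C with ((Ci * Ci) * (RtoC t * RtoC t))%C in A4 by ring.
  rewrite Hi2 in A3, A4. rewrite <- E in A1, A2, A3, A4.
  set (f1 := f (z + RtoC t)%C) in *. set (f2 := f (z - RtoC t)%C) in *.
  set (f3 := f (z + Ci * RtoC t)%C) in *. set (f4 := f (z - Ci * RtoC t)%C) in *.
  match type of A1 with Cmod ?e <= _ => set (e1 := e) in * end.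
  match type of A2 with Cmod ?e <= _ => set (e2 := e) in * end.
  match type of A3 with Cmod ?e <= _ => set (e3 := e) in * end.
  match type of A4 with Cmod ?e <= _ => set (e4 := e) in * end.
  assert (S : (f1 + f2 + f3 + f4 = RtoC 4 * f z + (e1 + e2 + e3 + e4))%C)
    by (unfold e1, e2, e3, e4; ring).
  pose proof (Cmod_triangle (f1 + f2 + f3) f4). pose proof (Cmod_triangle (f1 + f2) f3).
  pose proof (Cmod_triangle f1 f2).
  pose proof (Cmod_triangle (e1 + e2 + e3) e4). pose proof (Cmod_triangle (e1 + e2) e3).
  pose proof (Cmod_triangle e1 e2).
  pose proof (Cmod_triangle_minus (RtoC 4 * f z) (e1 + e2 + e3 + e4)) as T.
  rewrite <- S, Cmod_mult, Cmod_R, Rabs_pos_eq in T by lra. lra.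
Qed.

(** Upper semicontinuity suffices. Compactness is used twice through a gauge: first its reciprocal
    bounds u, then a gauge measuring the gap to an unattained supremum contradicts that supremum.
    [compactness_value_2d] concludes under a double negation, so each use refutes an inequality. *)
Lemma max_on_rectangle (u : R -> R -> R) a b a' b' : a <= b -> a' <= b' ->
  (forall x y, a <= x <= b -> a' <= y <= b' -> forall eps, 0 < eps -> exists d, 0 < d /\
     forall x' y', a <= x' <= b -> a' <= y' <= b' -> Rabs (x' - x) < d -> Rabs (y' - y) < d ->
       u x' y' < u x y + eps) ->
  exists x y, a <= x <= b /\ a' <= y <= b' /\
    forall x' y', a <= x' <= b -> a' <= y' <= b' -> u x' y' <= u x y.
Proof.
  intros Hab Hab' Hu.
  assert (Hbd : exists S, forall x y, a <= x <= b -> a' <= y <= b' -> u x y <= S).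
  { assert (Hch : forall x y, exists d : posreal, a <= x <= b -> a' <= y <= b' ->
       forall x' y', a <= x' <= b -> a' <= y' <= b' -> Rabs (x' - x) < d -> Rabs (y' - y) < d ->
         u x' y' < / d).
    { intros x y. destruct (classic (a <= x <= b /\ a' <= y <= b')) as [[Hx Hy]|Hn].
      - destruct (Hu x y Hx Hy 1 ltac:(lra)) as [d [Hd H]].
        assert (Hd' : 0 < Rmin d (/ (Rabs (u x y) + 1))).
        { apply Rmin_pos; [exact Hd|apply Rinv_0_lt_compat]. pose proof (Rabs_pos (u x y)); lra. }
        exists (mkposreal _ Hd'). simpl. intros _ _ x' y' Hx' Hy' H1 H2.
        pose proof (Rmin_l d (/ (Rabs (u x y) + 1))). pose proof (Rmin_r d (/ (Rabs (u x y) + 1))).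
        apply Rlt_le_trans with (u x y + 1); [apply H; auto; lra|].
        apply Rle_trans with (Rabs (u x y) + 1); [pose proof (Rle_abs (u x y)); lra|].
        rewrite <- (Rinv_inv (Rabs (u x y) + 1)) at 1. apply Rinv_le_contravar; assumption.
      - exists (mkposreal 1 Rlt_0_1). tauto. }
    set (delta := fun x y => proj1_sig (constructive_indefinite_description _ (Hch x y))).
    destruct (compactness_value_2d a b a' b' delta) as [d Hd].
    exists (/ d). intros x y Hx Hy. apply Rnot_lt_le. intros Hlt.
    apply (Hd x y Hx Hy). intros [p [q [Hp [Hq [H1 [H2 H3]]]]]].
    unfold delta in *. destruct (constructive_indefinite_description _ (Hch p q)) as [e He]. simpl in *.
    specialize (He Hp Hq x y Hx Hy H1 H2).
    assert (/ e <= / d); [|lra].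
    apply Rinv_le_contravar; [apply cond_pos|exact H3]. }
  destruct Hbd as [S0 HS0].
  destruct (completeness (fun v => exists x y, a <= x <= b /\ a' <= y <= b' /\ v = u x y)) as [S [HS1 HS2]].
  { exists S0. intros v [x [y [Hx [Hy ->]]]]. auto. }
  { exists (u a a'), a, a'. repeat split; lra. }
  apply NNPP. intros Hno.
  assert (Hlt : forall x y, a <= x <= b -> a' <= y <= b' -> u x y < S).
  { intros x y Hx Hy. assert (Hle : u x y <= S) by (apply HS1; exists x, y; auto).
    destruct Hle as [H|H]; [exact H|].
    exfalso. apply Hno. exists x, y. split; [exact Hx|split; [exact Hy|]]. intros x' y' Hx' Hy'.
    rewrite H. apply HS1. exists x', y'. auto. }
  assert (Hch : forall x y, exists d : posreal, a <= x <= b -> a' <= y <= b' ->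
       forall x' y', a <= x' <= b -> a' <= y' <= b' -> Rabs (x' - x) < d -> Rabs (y' - y) < d ->
         u x' y' <= S - d).
  { intros x y. destruct (classic (a <= x <= b /\ a' <= y <= b')) as [[Hx Hy]|Hn].
    - pose proof (Hlt x y Hx Hy) as HL.
      destruct (Hu x y Hx Hy ((S - u x y) / 2) ltac:(lra)) as [d [Hd H]].
      assert (Hd' : 0 < Rmin d ((S - u x y) / 2)) by (apply Rmin_pos; lra).
      exists (mkposreal _ Hd'). simpl. intros _ _ x' y' Hx' Hy' H1 H2.
      pose proof (Rmin_l d ((S - u x y) / 2)). pose proof (Rmin_r d ((S - u x y) / 2)).
      specialize (H x' y' Hx' Hy' ltac:(lra) ltac:(lra)). lra.
    - exists (mkposreal 1 Rlt_0_1). tauto. }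
  set (delta := fun x y => proj1_sig (constructive_indefinite_description _ (Hch x y))).
  destruct (compactness_value_2d a b a' b' delta) as [d Hd].
  assert (S <= S - d); [|pose proof (cond_pos d); lra].
  apply HS2. intros v [x [y [Hx [Hy ->]]]]. apply Rnot_lt_le. intros Hc.
  apply (Hd x y Hx Hy). intros [p [q [Hp [Hq [H1 [H2 H3]]]]]].
  unfold delta in *. destruct (constructive_indefinite_description _ (Hch p q)) as [e He]. simpl in *.
  specialize (He Hp Hq x y Hx Hy H1 H2). lra.
Qed.

Lemma Cmod_le_Rabs (z : C) : Cmod z <= Rabs (Re z) + Rabs (Im z).
Proof.
  apply Rsqr_incr_0_var; [|pose proof (Rabs_pos (Re z)); pose proof (Rabs_pos (Im z)); lra].
  unfold Rsqr. rewrite Cmod_sqr.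
  pose proof (Rabs_pos (Re z)). pose proof (Rabs_pos (Im z)).
  assert (E1 : Re z * Re z = Rabs (Re z) * Rabs (Re z)).
  { rewrite <- Rabs_mult, Rabs_pos_eq; [reflexivity|]. apply Rle_0_sqr. }
  assert (E2 : Im z * Im z = Rabs (Im z) * Rabs (Im z)).
  { rewrite <- Rabs_mult, Rabs_pos_eq; [reflexivity|]. apply Rle_0_sqr. }
  rewrite E1, E2. nra.
Qed.

(** Adding eps x^2 to |f| makes it strictly subharmonic, so a maximum above B cannot be interior:
    over four points at distance t the quadratic gains 2 eps t^2, while [four_point] loses only
    O(t^3). *)
Lemma maximum_principle (f : C -> C) (B L : R) :
  (forall z, 0 <= Im z -> holo f z) ->
  (forall x : R, Cmod (f (RtoC x)) <= B) ->
  (forall z, 0 <= Im z -> L <= Cmod z -> Cmod (f z) <= B) ->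
  forall z, 0 <= Im z -> Cmod (f z) <= B.
Proof.
  intros Hf HR HL z0 Hz0. apply Rnot_lt_le. intros Hlt.
  set (K := Rabs L + Cmod z0 + 1).
  assert (HK : 0 < K /\ L < K /\ Cmod z0 < K).
  { unfold K. pose proof (Rle_abs L). pose proof (Rabs_pos L). pose proof (Cmod_ge_0 z0). lra. }
  (* On the rectangle eps x^2 is at most half the excess of |f(z0)| over B, so |f| itself still
     exceeds B where the perturbed function is maximal. *)
  set (eps := (Cmod (f z0) - B) / (2 * (K * K))).
  assert (HKK : 0 < K * K) by nra.
  assert (He : 0 < eps) by (unfold eps; apply Rdiv_lt_0_compat; lra).
  assert (HeK : eps * (K * K) = (Cmod (f z0) - B) / 2) by (unfold eps; field; lra).
  set (u := fun x y => Cmod (f (x, y)) + eps * (x * x)).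
  destruct (max_on_rectangle u (- K) K 0 K) as [x [y [Hx [Hy Hmax]]]]; [lra|lra| |].
  { intros x y Hx Hy e Hee.
    destruct (Hf (x, y) ltac:(simpl; lra)) as [r [M [Hr HM]]].
    destruct (analytic_lipschitz f (x, y) (maj_analytic _ _ _ _ Hr HM)) as [A [r' [Hr' [HA Hlip]]]].
    set (d := Rmin (r' / 4) (e / (4 * (A + eps * K + 1)))).
    assert (Hden : 0 < A + eps * K + 1) by nra.
    assert (Hd : 0 < d /\ d <= r' / 4 /\ d <= e / (4 * (A + eps * K + 1))).
    { unfold d. split; [apply Rmin_pos; [lra|apply Rdiv_lt_0_compat; lra]|].
      split; [apply Rmin_l|apply Rmin_r]. }
    exists d. split; [lra|]. intros x' y' Hx' Hy' H1 H2.
    assert (Hh : Cmod (x' - x, y' - y) <= 2 * d).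
    { eapply Rle_trans; [apply Cmod_le_Rabs|]. simpl. lra. }
    specialize (Hlip (x' - x, y' - y) ltac:(lra)).
    replace (Cplus (x, y) (x' - x, y' - y)) with ((x', y') : C) in Hlip
      by (apply Ceq; simpl; ring).
    pose proof (Cmod_triangle (f (x', y') - f (x, y)) (f (x, y))) as T.
    replace (f (x', y') - f (x, y) + f (x, y))%C with (f (x', y')) in T by ring.
    assert (Hsq : x' * x' - x * x <= 2 * K * d).
    { replace (x' * x' - x * x) with ((x' - x) * (x' + x)) by ring.
      eapply Rle_trans; [apply Rle_abs|]. rewrite Rabs_mult.
      assert (Rabs (x' + x) <= 2 * K) by (apply Rabs_le; lra).
      pose proof (Rabs_pos (x' - x)). pose proof (Rabs_pos (x' + x)). nra. }
    assert (Hd4 : d * (4 * (A + eps * K + 1)) <= e).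
    { apply Rle_trans with (e / (4 * (A + eps * K + 1)) * (4 * (A + eps * K + 1))).
      - apply Rmult_le_compat_r; lra.
      - right. field. lra. }
    unfold u.
    assert (A * Cmod (x' - x, y' - y) <= A * (2 * d)) by (apply Rmult_le_compat_l; assumption).
    assert (eps * (x' * x' - x * x) <= eps * (2 * K * d)) by (apply Rmult_le_compat_l; lra).
    nra. }
  assert (Hz0K : u (Re z0) (Im z0) <= u x y).
  { pose proof (re_le_Cmod z0) as Hre. apply Rabs_le_between in Hre.
    assert (Him : Im z0 <= Cmod z0).
    { eapply Rle_trans; [apply Rle_abs|]. eapply Rle_trans; [|apply Rmax_Cmod]. apply Rmax_r. }
    apply Hmax; lra. }
  assert (Hgt : B < Cmod (f (x, y))).
  { unfold u in Hz0K. replace (Re z0, Im z0) with z0 in Hz0K by (destruct z0; reflexivity).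
    assert (0 <= eps * (Re z0 * Re z0)) by (apply Rmult_le_pos; [lra|apply Rle_0_sqr]).
    assert (eps * (x * x) <= eps * (K * K)) by (apply Rmult_le_compat_l; nra). lra. }
  assert (Hy0 : 0 < y).
  { destruct Hy as [[Hy|Hy] _]; [exact Hy|]. exfalso. subst y. specialize (HR x).
    unfold RtoC in HR. lra. }
  assert (HinL : Cmod (x, y) < K).
  { apply Rnot_le_lt. intros Hc. specialize (HL (x, y) ltac:(simpl; lra) ltac:(lra)). lra. }
  assert (HxK : - K < x < K).
  { pose proof (re_le_Cmod (x, y)) as Hre. simpl in Hre. apply Rabs_le_between in Hre. lra. }
  assert (HyK : y < K).
  { eapply Rle_lt_trans; [|exact HinL]. eapply Rle_trans; [apply (Rle_abs y)|].
    eapply Rle_trans; [|apply Rmax_Cmod]. apply Rmax_r. }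
  destruct (Hf (x, y) ltac:(simpl; lra)) as [r [M [Hr HM]]].
  pose proof (maj_nonneg _ _ _ _ HM) as HM0.
  (* The step keeps all four points in the rectangle and the disc, and forces the cubic error below
     eps t^2. *)
  set (t := Rmin (Rmin r y) (Rmin (Rmin (K - x) (K + x)) (Rmin (K - y) (eps * r ^ 3 / (4 * (M + 1)))))).
  assert (Hr3 : 0 < r ^ 3) by (apply pow_lt; exact Hr).
  assert (Ht : 0 < t /\ t <= r /\ t <= y /\ t <= K - x /\ t <= K + x /\ t <= K - y
      /\ t <= eps * r ^ 3 / (4 * (M + 1))).
  { unfold t. split.
    - repeat apply Rmin_pos; try lra. apply Rdiv_lt_0_compat; [|lra]. apply Rmult_lt_0_compat; lra.
    - repeat split.
      + eapply Rle_trans; [apply Rmin_l|apply Rmin_l].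
      + eapply Rle_trans; [apply Rmin_l|apply Rmin_r].
      + eapply Rle_trans; [apply Rmin_r|]. eapply Rle_trans; [apply Rmin_l|apply Rmin_l].
      + eapply Rle_trans; [apply Rmin_r|]. eapply Rle_trans; [apply Rmin_l|apply Rmin_r].
      + eapply Rle_trans; [apply Rmin_r|]. eapply Rle_trans; [apply Rmin_r|apply Rmin_l].
      + eapply Rle_trans; [apply Rmin_r|]. eapply Rle_trans; [apply Rmin_r|apply Rmin_r]. }
  destruct Ht as [Ht0 [Ht1 [Ht2 [Ht3 [Ht4 [Ht5 Ht6]]]]]].
  pose proof (four_point f (x, y) r M t ltac:(lra) HM) as HF.
  replace ((x, y) + RtoC t)%C with ((x + t, y) : C) in HF by (apply Ceq; simpl; ring).
  replace ((x, y) - RtoC t)%C with ((x - t, y) : C) in HF by (apply Ceq; simpl; ring).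
  replace ((x, y) + Ci * RtoC t)%C with ((x, y + t) : C) in HF by (apply Ceq; simpl; ring).
  replace ((x, y) - Ci * RtoC t)%C with ((x, y - t) : C) in HF by (apply Ceq; simpl; ring).
  pose proof (Hmax (x + t) y ltac:(lra) ltac:(lra)) as M1.
  pose proof (Hmax (x - t) y ltac:(lra) ltac:(lra)) as M2.
  pose proof (Hmax x (y + t) ltac:(lra) ltac:(lra)) as M3.
  pose proof (Hmax x (y - t) ltac:(lra) ltac:(lra)) as M4.
  unfold u in M1, M2, M3, M4.
  assert (H1 : 2 * (eps * (t * t)) <= 4 * (M * (t / r) ^ 3)) by nra.
  assert (H2 : 4 * (M * (t / r) ^ 3) = 4 * M * t / r ^ 3 * (t * t)) by (field; lra).
  assert (Htt : 0 < t * t) by nra.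
  assert (H3 : 2 * eps <= 4 * M * t / r ^ 3).
  { apply Rmult_le_reg_r with (t * t); [exact Htt|]. lra. }
  assert (H4 : 4 * M * t / r ^ 3 <= eps).
  { apply Rmult_le_reg_r with (r ^ 3); [exact Hr3|].
    replace (4 * M * t / r ^ 3 * r ^ 3) with (4 * M * t) by (field; lra).
    apply Rle_trans with (4 * (M + 1) * t); [nra|].
    apply Rle_trans with (4 * (M + 1) * (eps * r ^ 3 / (4 * (M + 1)))).
    - apply Rmult_le_compat_l; lra.
    - right. field. lra. }
  lra.
Qed.

Lemma Cmod_le_scaled (u v : C) k : 0 <= k ->
  Re u * Re u + Im u * Im u <= k * k * (Re v * Re v + Im v * Im v) -> Cmod u <= k * Cmod v.
Proof.
  intros Hk H. apply Rsqr_incr_0_var; [|apply Rmult_le_pos; [exact Hk|apply Cmod_ge_0]].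
  unfold Rsqr. rewrite Cmod_sqr.
  replace (k * Cmod v * (k * Cmod v)) with (k * k * (Cmod v * Cmod v)) by ring.
  rewrite Cmod_sqr. exact H.
Qed.

Definition imag (y : R) : C := (0, y).

Lemma Cmod_imag y : 0 <= y -> Cmod (imag y) = y.
Proof.
  intros Hy. unfold imag. unfold Cmod; simpl. replace (0 * (0 * 1) + y * (y * 1)) with (Rsqr y) by (unfold Rsqr; ring).
  apply sqrt_Rsqr, Hy.
Qed.

(* A Moebius factor, bounded by 2 on the closed upper half-plane and by 1 on the real
   line off [-a,a], but larger than 1 at iY: its powers play the role of exp (k w) with
   w the harmonic measure of [-a,a]. *)
Lemma moebius_weight a Y : 0 < a -> 0 < Y -> exists q : C -> C,
  (forall z, 0 <= Im z -> holo q z) /\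
  (forall z, 0 <= Im z -> Cmod (q z) <= 2) /\
  (forall x : R, a <= Rabs x -> Cmod (q (RtoC x)) <= 1) /\
  1 < Cmod (q (imag Y)).
Proof.
  intros Ha HY.
  (* Both bounds on b serve the last claim: they make 3 b Y^2 + 4 b^2 Y at most 2 a^2 Y, which gives
     modulus above 1 at iY. *)
  set (b := Rmin (a / 2) (a * a / (3 * Y))).
  assert (Hb : 0 < b /\ b <= a / 2 /\ 3 * b * Y <= a * a).
  { assert (0 < a * a / (3 * Y)) by (apply Rdiv_lt_0_compat; nra).
    unfold b. split; [apply Rmin_pos; lra|]. split; [apply Rmin_l|].
    apply Rle_trans with (3 * (a * a / (3 * Y)) * Y); [|right; field; lra].
    apply Rmult_le_compat_r; [lra|]. apply Rmult_le_compat_l; [lra|]. apply Rmin_r. }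
  destruct Hb as [Hb0 [Hb1 Hb2]].
  (* For q(z) = c (z + 2ib) / (z + ib) the modulus on the real line decreases with |x|; this c
     normalizes it to 1 at x = a and x = -a. *)
  set (c := sqrt ((a * a + b * b) / (a * a + 4 * (b * b)))).
  assert (Hc2 : c * c = (a * a + b * b) / (a * a + 4 * (b * b))).
  { unfold c. apply sqrt_sqrt. apply Rdiv_le_0_compat; nra. }
  assert (Hc0 : 0 < c).
  { unfold c. apply sqrt_lt_R0. apply Rdiv_lt_0_compat; nra. }
  assert (Hc1 : c * c * (a * a + 4 * (b * b)) = a * a + b * b) by (rewrite Hc2; field; nra).
  assert (Hcle : c <= 1).
  { apply Rsqr_incr_0_var; [|lra]. unfold Rsqr. rewrite Hc2.
    apply Rmult_le_reg_r with (a * a + 4 * (b * b)); [nra|].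
    unfold Rdiv. rewrite Rmult_assoc, Rinv_l by nra. nra. }
  exists (fun z => RtoC c * ((z - imag (- (2 * b))) * / (z - imag (- b))))%C.
  assert (Hne : forall z : C, 0 <= Im z -> z <> imag (- b)).
  { intros z Hz ->. simpl in Hz. lra. }
  assert (Hne0 : forall z : C, 0 <= Im z -> (z - imag (- b))%C <> 0).
  { intros z Hz E. apply (Hne z Hz), Ceq_minus, E. }
  assert (Hmod : forall z : C, 0 <= Im z -> forall k, 0 <= k ->
    c * c * (Re z * Re z + (Im z + 2 * b) * (Im z + 2 * b))
      <= k * k * (Re z * Re z + (Im z + b) * (Im z + b)) ->
    Cmod (RtoC c * ((z - imag (- (2 * b))) * / (z - imag (- b)))) <= k).
  { intros z Hz k Hk H. rewrite Cmult_assoc, Cmod_mult, Cmod_inv by (apply Hne0, Hz).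
    assert (Hp : 0 < Cmod (z - imag (- b))) by (apply Cmod_gt_0, Hne0, Hz).
    apply Rmult_le_reg_r with (Cmod (z - imag (- b))); [exact Hp|].
    rewrite Rmult_assoc, Rinv_l, Rmult_1_r by lra.
    apply Cmod_le_scaled; [exact Hk|]. destruct z as [x y]; simpl in *.
    eapply Rle_trans; [|eapply Rle_trans; [exact H|]]; right; ring. }
  split; [|split; [|split]].
  - intros z Hz. apply holo_mult; [apply holo_const|]. apply holo_mult; [apply holo_id_minus|].
    apply holo_inv, Hne, Hz.
  - intros z Hz. apply Hmod; [exact Hz|lra|].
    assert (c * c <= 1) by nra.
    assert (0 <= Re z * Re z) by apply Rle_0_sqr.
    assert (Re z * Re z + (Im z + 2 * b) * (Im z + 2 * b)
      <= 2 * 2 * (Re z * Re z + (Im z + b) * (Im z + b))) by nra.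
    assert (0 <= Re z * Re z + (Im z + 2 * b) * (Im z + 2 * b)) by nra. nra.
  - intros x Hx. apply Hmod; [simpl; lra|lra|]. simpl.
    assert (Hxx : a * a <= x * x).
    { replace (x * x) with (Rabs x * Rabs x); [nra|].
      rewrite <- Rabs_mult. apply Rabs_pos_eq, Rle_0_sqr. }
    rewrite Hc2. apply Rmult_le_reg_r with (a * a + 4 * (b * b)); [nra|].
    match goal with |- ?l * _ <= _ => replace (l * (a * a + 4 * (b * b)))
      with ((a * a + b * b) * (x * x + (0 + 2 * b) * (0 + 2 * b))) by (field; nra) end.
    nra.
  - apply Rnot_le_lt. intros Hle.
    rewrite Cmult_assoc, Cmod_mult, Cmod_inv in Hle by (apply Hne0; simpl; lra).
    assert (Hz : 0 <= Im (imag Y)) by (simpl; lra).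
    assert (Hp : 0 < Cmod ((imag Y) - imag (- b))) by (apply Cmod_gt_0, Hne0, Hz).
    assert (Hle2 : Cmod (RtoC c * ((imag Y) - imag (- (2 * b)))) <= Cmod ((imag Y) - imag (- b))).
    { apply Rmult_le_reg_r with (/ Cmod ((imag Y) - imag (- b))); [apply Rinv_0_lt_compat, Hp|].
      rewrite Rinv_r by lra. exact Hle. }
    replace ((imag Y) - imag (- b))%C with (imag (Y + b)) in Hle2 by (apply Ceq; simpl; ring).
    replace (RtoC c * ((imag Y) - imag (- (2 * b))))%C with (imag (c * (Y + 2 * b))) in Hle2
      by (apply Ceq; simpl; ring).
    rewrite !Cmod_imag in Hle2 by nra.
    assert (Hsq : c * c * ((Y + 2 * b) * (Y + 2 * b)) <= (Y + b) * (Y + b)).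
    { replace (c * c * ((Y + 2 * b) * (Y + 2 * b))) with ((c * (Y + 2 * b)) * (c * (Y + 2 * b))) by ring.
      apply Rmult_le_compat; nra. }
    assert (Hs2 : (a * a + b * b) * ((Y + 2 * b) * (Y + 2 * b))
       <= (a * a + 4 * (b * b)) * ((Y + b) * (Y + b))).
    { rewrite <- Hc1. replace (c * c * (a * a + 4 * (b * b)) * ((Y + 2 * b) * (Y + 2 * b)))
        with ((a * a + 4 * (b * b)) * (c * c * ((Y + 2 * b) * (Y + 2 * b)))) by ring.
      apply Rmult_le_compat_l; [nra|exact Hsq]. }
    assert (Hfac : b * (a * a * (2 * Y + 3 * b) - Y * (3 * b * Y + 4 * (b * b)))
      = (a * a + b * b) * ((Y + 2 * b) * (Y + 2 * b)) - (a * a + 4 * (b * b)) * ((Y + b) * (Y + b)))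
      by ring.
    assert (H1 : Y * (3 * b * Y) <= Y * (a * a)) by (apply Rmult_le_compat_l; lra).
    assert (H2 : Y * (4 * (b * b)) <= Y * (a * a)) by (apply Rmult_le_compat_l; nra).
    assert (H3 : 0 < a * a * (3 * b)) by (repeat apply Rmult_lt_0_compat; lra).
    assert (H4 : 0 < a * a * (2 * Y + 3 * b) - Y * (3 * b * Y + 4 * (b * b))) by lra.
    pose proof (Rmult_lt_0_compat _ _ Hb0 H4). lra.
Qed.

Definition expsum (b : nat -> C) (lam : nat -> R) (N : nat) (z : C) : C :=
  csum (fun n => b n * Cexp (Ci * RtoC (lam n) * z))%C N.

Lemma Cmod_Cexp_i l z : Cmod (Cexp (Ci * RtoC l * z)) = exp (- l * Im z).
Proof. rewrite Cmod_Cexp. f_equal. destruct z; simpl. ring. Qed.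

Lemma pow_unbounded q A : 1 < q -> exists k, A < q ^ k.
Proof.
  intros Hq. destruct (INR_unbounded (A / (q - 1))) as [k Hk]. exists k.
  pose proof (poly k (q - 1) ltac:(lra)) as H. replace (1 + (q - 1)) with q in H by ring.
  apply Rmult_lt_compat_r with (r := q - 1) in Hk; [|lra].
  replace (A / (q - 1) * (q - 1)) with A in Hk by (field; lra). lra.
Qed.

(** The constant depends only on [a] and [B], not on the sum. If the sum were small on [-a,a], its
    product with q^k and a decaying factor would be bounded by B + 1 on the real line, hence in the
    half-plane, but this fails at iY. *)
Lemma two_constants (a B : R) : 0 < a -> 0 <= B -> exists c, 0 < c /\
  forall (b : nat -> C) (lam : nat -> R) (N : nat), (1 <= N)%nat ->
    b O = RtoC 1 -> lam O = 0 -> (forall n, (1 <= n < N)%nat -> ln 2 <= lam n) ->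
    rsum (fun n => Cmod (b n)) N <= B ->
    exists x : R, Rabs x <= a /\ c <= Cmod (expsum b lam N (RtoC x)).
Proof.
  intros Ha HB.
  assert (Hln2 : 0 < ln 2) by (rewrite <- ln_1; apply ln_increasing; lra).
  (* At height Y every term after the first is damped by at least 1 / (2B + 2), so together they are
     at most 1/2 and the sum is at least 1/2. *)
  set (Y := ln (2 * B + 2) / ln 2).
  assert (HlnB : 0 < ln (2 * B + 2)) by (rewrite <- ln_1; apply ln_increasing; lra).
  assert (HY : 0 < Y) by (unfold Y; apply Rdiv_lt_0_compat; lra).
  destruct (moebius_weight a Y Ha HY) as [q [Hq1 [Hq2 [Hq3 Hq4]]]].
  destruct (pow_unbounded (Cmod (q (imag Y))) (4 * (B + 1)) Hq4) as [k Hk].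
  (* On [-a,a] smallness c against |q|^k <= 2^k gives B + 1. At iY the factors 1/2, |q|^k > 4 (B +
     1) and 1/2 exceed it. *)
  set (c := (B + 1) / 2 ^ k).
  assert (H2k : 0 < 2 ^ k) by (apply pow_lt; lra).
  exists c. split; [unfold c; apply Rdiv_lt_0_compat; lra|].
  intros b lam N HN Hb0 Hl0 Hl HbB. apply NNPP. intros Hno.
  assert (Hsmall : forall x : R, Rabs x <= a -> Cmod (expsum b lam N (RtoC x)) <= c).
  { intros x Hx. apply Rnot_lt_le. intros Hlt. apply Hno. exists x. split; [exact Hx|lra]. }
  assert (Hl' : forall n, (n < N)%nat -> 0 <= lam n).
  { intros n Hn. destruct n; [lra|]. specialize (Hl (S n) ltac:(lia)). lra. }
  assert (HH : forall z, 0 <= Im z -> Cmod (expsum b lam N z) <= B).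
  { intros z Hz. eapply Rle_trans; [apply csum_Cmod|]. eapply Rle_trans; [|exact HbB].
    apply rsum_le. intros n Hn. rewrite Cmod_mult, Cmod_Cexp_i.
    rewrite <- (Rmult_1_r (Cmod (b n))) at 2. apply Rmult_le_compat_l; [apply Cmod_ge_0|].
    rewrite <- exp_0. apply exp_mono. specialize (Hl' n Hn). nra. }
  (* The factor Y / (z + iY) is at most 1 in modulus, equals 1/2 at iY, and tends to 0 at infinity,
     which supplies the growth condition of the maximum principle. *)
  set (g := fun z : C => (RtoC Y * / (z - imag (- Y)))%C).
  assert (Hgne : forall z : C, 0 <= Im z -> z <> imag (- Y)).
  { intros z Hz ->. simpl in Hz. lra. }
  assert (Hgne0 : forall z : C, 0 <= Im z -> (z - imag (- Y))%C <> 0).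
  { intros z Hz E. apply (Hgne z Hz), Ceq_minus, E. }
  assert (Hg : forall z : C, 0 <= Im z -> forall m, 0 < m -> m <= Cmod (z - imag (- Y)) -> Cmod (g z) <= Y / m).
  { intros z Hz m Hm Hmz. unfold g. rewrite Cmod_mult, Cmod_inv by (apply Hgne0, Hz).
    rewrite Cmod_R, Rabs_pos_eq by lra. unfold Rdiv. apply Rmult_le_compat_l; [lra|].
    apply Rinv_le_contravar; lra. }
  assert (HgY : forall z : C, 0 <= Im z -> Y <= Cmod (z - imag (- Y))).
  { intros z Hz. eapply Rle_trans; [|apply Rmax_Cmod]. eapply Rle_trans; [|apply Rmax_r].
    eapply Rle_trans; [|apply Rle_abs]. destruct z; simpl in *. lra. }
  assert (Hgz : forall z : C, 0 <= Im z -> Cmod z <= Cmod (z - imag (- Y))).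
  { intros z Hz. rewrite <- (Rmult_1_l (Cmod (z - _))). apply Cmod_le_scaled; [lra|].
    destruct z as [x y]; simpl in *. nra. }
  assert (Hg1 : forall z : C, 0 <= Im z -> Cmod (g z) <= 1).
  { intros z Hz. eapply Rle_trans; [apply (Hg z Hz Y HY (HgY z Hz))|]. right. field. lra. }
  set (f := fun z => (expsum b lam N z * (q z ^ k * g z))%C).
  assert (Hqk : forall z : C, 0 <= Im z -> Cmod (q z) ^ k <= 2 ^ k).
  { intros z Hz. apply pow_incr. split; [apply Cmod_ge_0|auto]. }
  assert (Hmax : forall z, 0 <= Im z -> Cmod (f z) <= B + 1).
  { apply (maximum_principle f (B + 1) (2 ^ k * Y)).
    - intros z Hz. unfold f. apply holo_mult.
      + unfold expsum.
        apply (holo_csum (fun n z => (b n * Cexp (Ci * RtoC (lam n) * z))%C)). intros n.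
        apply holo_mult; [apply holo_const|apply holo_Cexp].
      + apply holo_mult; [apply holo_pow, Hq1, Hz|]. unfold g.
        apply holo_mult; [apply holo_const|apply holo_inv, Hgne, Hz].
    - intros x. unfold f. rewrite !Cmod_mult, Cmod_pow.
      assert (Hx0 : 0 <= Im (RtoC x)) by (simpl; lra).
      pose proof (Hg1 _ Hx0) as G1. pose proof (Cmod_ge_0 (g (RtoC x))) as G0.
      pose proof (HH _ Hx0) as H1. pose proof (Cmod_ge_0 (expsum b lam N (RtoC x))) as H0.
      pose proof (pow_le _ k (Cmod_ge_0 (q (RtoC x)))) as Q0.
      destruct (Rle_or_lt a (Rabs x)) as [Hx|Hx].
      + assert (Q1 : Cmod (q (RtoC x)) ^ k <= 1).
        { rewrite <- (pow1 k). apply pow_incr. split; [apply Cmod_ge_0|auto]. }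
        assert (Cmod (q (RtoC x)) ^ k * Cmod (g (RtoC x)) <= 1) by nra.
        assert (0 <= Cmod (q (RtoC x)) ^ k * Cmod (g (RtoC x))) by nra. nra.
      + pose proof (Hsmall x ltac:(lra)) as Hs. pose proof (Hqk _ Hx0) as Q1.
        assert (Cmod (q (RtoC x)) ^ k * Cmod (g (RtoC x)) <= 2 ^ k) by nra.
        apply Rle_trans with (c * 2 ^ k).
        * apply Rmult_le_compat; [exact H0|nra|exact Hs|assumption].
        * right. unfold c. field. lra.
    - intros z Hz Hlarge. unfold f. rewrite !Cmod_mult, Cmod_pow.
      assert (HkY : 0 < 2 ^ k * Y) by nra.
      pose proof (Hg z Hz (2 ^ k * Y) HkY ltac:(pose proof (Hgz z Hz); lra)) as G1.
      pose proof (Cmod_ge_0 (g z)) as G0. pose proof (Hqk z Hz) as Q1.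
      pose proof (HH z Hz) as H1. pose proof (Cmod_ge_0 (expsum b lam N z)) as H0.
      assert (Hle : Cmod (q z) ^ k * Cmod (g z) <= 1).
      { apply Rle_trans with (2 ^ k * (Y / (2 ^ k * Y))).
        - apply Rmult_le_compat; try assumption. apply pow_le, Cmod_ge_0.
        - right. field. lra. }
      assert (0 <= Cmod (q z) ^ k * Cmod (g z)).
      { apply Rmult_le_pos; [apply pow_le, Cmod_ge_0|exact G0]. }
      nra. }
  assert (HzY : 0 <= Im (imag Y)) by (simpl; lra).
  specialize (Hmax (imag Y) HzY). unfold f in Hmax. rewrite !Cmod_mult, Cmod_pow in Hmax.
  assert (HgiY : Cmod (g (imag Y)) = 1 / 2).
  { unfold g. rewrite Cmod_mult, Cmod_inv by (apply Hgne0, HzY).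
    rewrite Cmod_R, Rabs_pos_eq by lra.
    replace ((imag Y) - imag (- Y))%C with (imag (2 * Y)) by (apply Ceq; simpl; ring).
    rewrite Cmod_imag by lra. field. lra. }
  assert (HHY : 1 / 2 <= Cmod (expsum b lam N (imag Y))).
  { destruct N as [|N]; [lia|]. unfold expsum in *. rewrite csum_S_head, Hb0, Hl0.
    rewrite rsum_S_head in HbB. rewrite Hb0, Cmod_1 in HbB.
    eapply Rle_trans; [|apply Cmod_triangle_minus].
    replace (Ci * 0 * (imag Y))%C with (RtoC 0) by ring. rewrite Cexp_0, Cmult_1_l, Cmod_1.
    assert (Hrest : Cmod (csum (fun n => b (S n) * Cexp (Ci * RtoC (lam (S n)) * (imag Y)))%C N) <= 1 / 2); [|lra].
    eapply Rle_trans; [apply csum_Cmod|].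
    apply Rle_trans with (rsum (fun n => / (2 * B + 2) * Cmod (b (S n))) N).
    - apply rsum_le. intros n Hn. rewrite Cmod_mult, Cmod_Cexp_i, Rmult_comm.
      apply Rmult_le_compat_r; [apply Cmod_ge_0|].
      rewrite <- (exp_ln (2 * B + 2)) by lra. rewrite <- exp_Ropp. apply exp_mono. simpl.
      specialize (Hl (S n) ltac:(lia)).
      assert (ln 2 * Y = ln (2 * B + 2)) by (unfold Y; field; lra). nra.
    - rewrite rsum_scal. apply Rmult_le_reg_l with (2 * B + 2); [lra|].
      rewrite <- Rmult_assoc, Rinv_r, Rmult_1_l by lra.
      pose proof (rsum_nonneg (fun n => Cmod (b (S n))) N (fun n _ => Cmod_ge_0 _)). lra. }
  rewrite HgiY in Hmax.
  assert (1 / 2 * (4 * (B + 1) * (1 / 2)) < Cmod (expsum b lam N (imag Y)) * (Cmod (q (imag Y)) ^ k * (1 / 2))).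
  { apply Rlt_le_trans with (1 / 2 * (Cmod (q (imag Y)) ^ k * (1 / 2))); [lra|].
    apply Rmult_le_compat_r; lra. }
  lra.
Qed.

(** * Averaging operators *)

(** A mean over m equally spaced points of [t, t + rho], standing in for convolution with a box. The
    averaging is forward only, so the widths add up on the right of the interval. *)
Definition avg (m : nat) (rho : R) (f : R -> C) (t : R) : C :=
  (RtoC (/ INR m) * csum (fun j => f (t + INR j * (rho / INR m))%R) m)%C.

Fixpoint avgs (m : nat) (rho : nat -> R) (K : nat) (f : R -> C) : R -> C :=
  match K with
  | O => f
  | S k => avg m (rho k) (avgs m rho k f)
  end.

Definition osc (x t : R) : C := Cexp (- (Ci * RtoC x) * RtoC t)%C.

Definition avg_mult (m : nat) (rho x : R) : C :=
  (RtoC (/ INR m) * csum (fun j => osc x (INR j * (rho / INR m))) m)%C.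

Fixpoint avgs_mult (m : nat) (rho : nat -> R) (K : nat) (x : R) : C :=
  match K with
  | O => RtoC 1
  | S k => (avgs_mult m rho k x * avg_mult m (rho k) x)%C
  end.

Lemma osc_plus x s t : osc x (s + t) = (osc x s * osc x t)%C.
Proof. unfold osc. rewrite <- Cexp_plus, RtoC_plus. f_equal. ring. Qed.

Lemma Cmod_osc x t : Cmod (osc x t) = 1.
Proof.
  unfold osc. rewrite Cmod_Cexp, <- exp_0. f_equal. simpl. ring.
Qed.

Lemma avg_osc_sum m rho (c : nat -> C) (x : nat -> R) N t :
  avg m rho (fun t => csum (fun n => c n * osc (x n) t)%C N) t
    = csum (fun n => (c n * avg_mult m rho (x n)) * osc (x n) t)%C N.
Proof.
  unfold avg, avg_mult.
  rewrite (csum_swap (fun j n => c n * osc (x n) (t + INR j * (rho / INR m)))%C m N).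
  rewrite <- csum_scal. apply csum_ext. intros n _.
  rewrite (csum_ext _ (fun j => (c n * osc (x n) t) * osc (x n) (INR j * (rho / INR m)))%C).
  - rewrite csum_scal. ring.
  - intros j _. rewrite osc_plus. ring.
Qed.

(** Oscillations are eigenfunctions of translation, so each average acts on them as multiplication
    by its Fourier multiplier. *)
Lemma avgs_osc_sum m rho K (c : nat -> C) (x : nat -> R) N :
  avgs m rho K (fun t => csum (fun n => c n * osc (x n) t)%C N)
    = (fun t => csum (fun n => (c n * avgs_mult m rho K (x n)) * osc (x n) t)%C N).
Proof.
  induction K as [|K IH].
  - simpl. apply functional_extensionality. intros t. apply csum_ext. intros n _. ring.
  - simpl. rewrite IH. apply functional_extensionality. intros t.
    rewrite avg_osc_sum. apply csum_ext. intros n _. ring.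
Qed.

Lemma Cmod_avg_le m rho f t B : (1 <= m)%nat ->
  (forall j, (j < m)%nat -> Cmod (f (t + INR j * (rho / INR m))) <= B) ->
  Cmod (avg m rho f t) <= B.
Proof.
  intros Hm H. assert (0 < INR m) by (apply lt_0_INR; lia). unfold avg.
  rewrite Cmod_mult, Cmod_R, Rabs_pos_eq by (left; apply Rinv_0_lt_compat; lra).
  apply Rmult_le_reg_l with (INR m); [lra|]. rewrite <- Rmult_assoc, Rinv_r, Rmult_1_l by lra.
  rewrite <- rsum_const. eapply Rle_trans; [apply csum_Cmod|]. apply rsum_le. exact H.
Qed.

Lemma avg_minus m rho f g t :
  avg m rho (fun t => f t - g t)%C t = (avg m rho f t - avg m rho g t)%C.
Proof.
  unfold avg. rewrite (csum_ext _ (fun j => f (t + INR j * (rho / INR m))%R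
     + (- (1)) * g (t + INR j * (rho / INR m))%R)%C) by (intros; ring).
  rewrite csum_plus, csum_scal. ring.
Qed.

Lemma grid_point_bounds m rho j : 0 <= rho -> (j < m)%nat -> 0 <= INR j * (rho / INR m) <= rho.
Proof.
  intros Hr Hj. assert (0 < INR m) by (apply lt_0_INR; lia).
  assert (INR j <= INR m) by (apply le_INR; lia). pose proof (pos_INR j).
  assert (0 <= rho / INR m) by (apply Rdiv_le_0_compat; lra).
  split; [apply Rmult_le_pos; assumption|].
  replace rho with (INR m * (rho / INR m)) at 2 by (field; lra).
  apply Rmult_le_compat_r; assumption.
Qed.

Lemma avgs_close m rho K f g kap : (1 <= m)%nat -> (forall j, 0 <= rho j) -> forall t,
  (forall u, t <= u <= t + rsum rho K -> Cmod (f u - g u) <= kap) ->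
  Cmod (avgs m rho K f t - avgs m rho K g t) <= kap.
Proof.
  intros Hm Hr. induction K as [|K IH]; intros t H.
  - simpl in *. apply H. lra.
  - simpl. rewrite <- avg_minus. apply Cmod_avg_le; [exact Hm|]. intros j Hj.
    pose proof (grid_point_bounds m (rho K) j (Hr K) Hj).
    apply IH. intros u Hu. apply H. simpl. lra.
Qed.

(** * Continuity and mean-value bounds of the averages *)

Definition Ccont (f : R -> C) : Prop := forall t eps, 0 < eps -> exists d, 0 < d /\
  forall u, Rabs (u - t) < d -> Cmod (f u - f t) < eps.

Lemma Ccont_const c : Ccont (fun _ => c).
Proof.
  intros t eps He. exists 1. split; [lra|]. intros u _.
  replace (c - c)%C with (RtoC 0) by ring. rewrite Cmod_0. exact He.
Qed.

Lemma Ccont_plus f g : Ccont f -> Ccont g -> Ccont (fun t => f t + g t)%C.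
Proof.
  intros Hf Hg t eps He. destruct (Hf t (eps / 2)) as [d [Hd H1]]; [lra|].
  destruct (Hg t (eps / 2)) as [d' [Hd' H2]]; [lra|].
  exists (Rmin d d'). split; [apply Rmin_pos; assumption|]. intros u Hu.
  pose proof (Rmin_l d d'). pose proof (Rmin_r d d').
  specialize (H1 u ltac:(lra)). specialize (H2 u ltac:(lra)).
  replace (f u + g u - (f t + g t))%C with ((f u - f t) + (g u - g t))%C by ring.
  eapply Rle_lt_trans; [apply Cmod_triangle|lra].
Qed.

Lemma Ccont_scal c f : Ccont f -> Ccont (fun t => c * f t)%C.
Proof.
  intros Hf t eps He. pose proof (Cmod_ge_0 c).
  destruct (Hf t (eps / (Cmod c + 1))) as [d [Hd H1]]; [apply Rdiv_lt_0_compat; lra|].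
  exists d. split; [exact Hd|]. intros u Hu. specialize (H1 u Hu).
  replace (c * f u - c * f t)%C with (c * (f u - f t))%C by ring. rewrite Cmod_mult.
  pose proof (Cmod_ge_0 (f u - f t)).
  apply Rle_lt_trans with ((Cmod c + 1) * Cmod (f u - f t)); [nra|].
  apply Rmult_lt_reg_r with (/ (Cmod c + 1)); [apply Rinv_0_lt_compat; lra|].
  replace ((Cmod c + 1) * Cmod (f u - f t) * / (Cmod c + 1)) with (Cmod (f u - f t)) by (field; lra).
  exact H1.
Qed.

Lemma Ccont_shift f s : Ccont f -> Ccont (fun t => f (t + s)).
Proof.
  intros Hf t eps He. destruct (Hf (t + s) eps He) as [d [Hd H]]. exists d. split; [exact Hd|].
  intros u Hu. apply H. replace (u + s - (t + s)) with (u - t) by ring. exact Hu.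
Qed.

Lemma Ccont_csum (f : nat -> R -> C) N : (forall n, Ccont (f n)) -> Ccont (fun t => csum (fun n => f n t) N).
Proof.
  intros H. induction N as [|N IH]; simpl; [apply Ccont_const|apply Ccont_plus; auto].
Qed.

Lemma Ccont_avg m rho f : Ccont f -> Ccont (avg m rho f).
Proof.
  intros H. apply Ccont_scal.
  apply (Ccont_csum (fun j t => f (t + INR j * (rho / INR m)))). intros j. apply Ccont_shift, H.
Qed.

Lemma Ccont_avgs m rho K f : Ccont f -> Ccont (avgs m rho K f).
Proof. intros H. induction K as [|K IH]; simpl; [exact H|apply Ccont_avg, IH]. Qed.

Lemma Ccont_Cmod f : Ccont f -> forall t, continuous (fun t => Cmod (f t)) t.
Proof.
  intros Hf t. apply continuity_pt_filterlim. intros eps He.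
  destruct (Hf t eps He) as [d [Hd H]]. exists d. split; [exact Hd|]. intros u [_ Hu].
  simpl in *. unfold R_dist, Rdist in *. specialize (H u Hu).
  eapply Rle_lt_trans; [|exact H].
  pose proof (Cmod_triangle_minus (f u) (f t - f u)) as T1.
  pose proof (Cmod_triangle_minus (f t) (f u - f t)) as T2.
  replace (f u + (f t - f u))%C with (f t) in T1 by ring.
  replace (f t + (f u - f t))%C with (f u) in T2 by ring.
  rewrite (Cmod_sub_sym (f t)) in T1. apply Rabs_le. lra.
Qed.

Lemma Ccont_ex_RInt f a b : Ccont f -> ex_RInt (fun t => Cmod (f t)) a b.
Proof. intros H. apply (ex_RInt_continuous (V := R_CompleteNormedModule)). intros z _. apply Ccont_Cmod, H. Qed.

Lemma RInt_Cmod_mono f a b a' b' : Ccont f -> a' <= a -> a <= b -> b <= b' ->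
  RInt (fun t => Cmod (f t)) a b <= RInt (fun t => Cmod (f t)) a' b'.
Proof.
  intros Hf H1 H2 H3.
  rewrite <- (RInt_Chasles (fun t => Cmod (f t)) a' a b') by (apply Ccont_ex_RInt, Hf).
  rewrite <- (RInt_Chasles (fun t => Cmod (f t)) a b b') by (apply Ccont_ex_RInt, Hf).
  assert (P : forall x y, x <= y -> 0 <= RInt (fun t => Cmod (f t)) x y).
  { intros x y Hxy. apply RInt_ge_0; [exact Hxy|apply Ccont_ex_RInt, Hf|intros; apply Cmod_ge_0]. }
  pose proof (P a' a H1). pose proof (P b b' H3). unfold plus; simpl. lra.
Qed.

Lemma RInt_rsum (f : nat -> R -> R) a b N : (forall n, ex_RInt (f n) a b) ->
  ex_RInt (fun t => rsum (fun n => f n t) N) a b /\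
  RInt (fun t => rsum (fun n => f n t) N) a b = rsum (fun n => RInt (f n) a b) N.
Proof.
  intros H. induction N as [|N [IH1 IH2]]; simpl.
  - split; [apply ex_RInt_const|]. rewrite RInt_const. unfold scal; simpl. unfold mult; simpl. ring.
  - split; [apply @ex_RInt_plus; auto|].
    rewrite <- IH2. apply (RInt_plus (fun t => rsum (fun n => f n t) N) (f N)); auto.
Qed.

(** Averaging does not increase the integral of the modulus beyond that over the interval lengthened
    by rho, so a lower bound for averages descends to f. *)
Lemma RInt_avg m rho f a b : (1 <= m)%nat -> 0 <= rho -> Ccont f -> a <= b ->
  RInt (fun t => Cmod (avg m rho f t)) a b <= RInt (fun t => Cmod (f t)) a (b + rho).
Proof.
  intros Hm Hr Hf Hab. assert (Hm0 : 0 < INR m) by (apply lt_0_INR; lia).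
  assert (Hex : forall j, ex_RInt (fun t => / INR m * Cmod (f (t + INR j * (rho / INR m)))) a b).
  { intros j. apply (@ex_RInt_scal R_NormedModule (fun t => Cmod (f (t + INR j * (rho / INR m))))).
    apply (Ccont_ex_RInt (fun t => f (t + INR j * (rho / INR m)))), Ccont_shift, Hf. }
  destruct (RInt_rsum (fun j t => / INR m * Cmod (f (t + INR j * (rho / INR m)))) a b m Hex) as [E1 E2].
  apply Rle_trans with (RInt (fun t => rsum (fun j => / INR m * Cmod (f (t + INR j * (rho / INR m)))) m) a b).
  - apply RInt_le; [exact Hab|apply Ccont_ex_RInt, Ccont_avg, Hf|exact E1|].
    intros t _. rewrite rsum_scal. unfold avg.
    rewrite Cmod_mult, Cmod_R, Rabs_pos_eq by (left; apply Rinv_0_lt_compat; lra).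
    apply Rmult_le_compat_l; [left; apply Rinv_0_lt_compat; lra|apply csum_Cmod].
  - rewrite E2. apply Rle_trans with
      (rsum (fun _ => / INR m * RInt (fun t => Cmod (f t)) a (b + rho)) m).
    + apply rsum_le. intros j Hj. pose proof (grid_point_bounds m rho j Hr Hj) as Hg.
      set (s := INR j * (rho / INR m)) in *.
      replace (RInt (fun t => / INR m * Cmod (f (t + s))) a b)
        with (/ INR m * RInt (fun t => Cmod (f (t + s))) a b)
        by (symmetry; apply (RInt_scal (V := R_CompleteNormedModule) (fun t => Cmod (f (t + s))));
            apply (Ccont_ex_RInt (fun t => f (t + s))), Ccont_shift, Hf).
      apply Rmult_le_compat_l; [left; apply Rinv_0_lt_compat; lra|].
      assert (E : RInt (fun t => Cmod (f (t + s))) a b = RInt (fun t => Cmod (f t)) (a + s) (b + s)).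
      { pose proof (RInt_comp_lin (fun t => Cmod (f t)) 1 s a b) as H.
        rewrite !Rmult_1_l in H. rewrite <- H by (apply Ccont_ex_RInt, Hf).
        apply RInt_ext. intros x _. unfold scal; simpl. unfold mult; simpl.
        rewrite !Rmult_1_l. reflexivity. }
      rewrite E. apply RInt_Cmod_mono; [exact Hf|lra|lra|lra].
    + rewrite rsum_const. right. field. lra.
Qed.

Lemma RInt_avgs m rho K f : (1 <= m)%nat -> (forall j, 0 <= rho j) -> Ccont f ->
  forall a b, a <= b ->
  RInt (fun t => Cmod (avgs m rho K f t)) a b <= RInt (fun t => Cmod (f t)) a (b + rsum rho K).
Proof.
  intros Hm Hr Hf. induction K as [|K IH]; intros a b Hab.
  - simpl. rewrite Rplus_0_r. lra.
  - simpl. eapply Rle_trans; [apply RInt_avg; auto; apply Ccont_avgs, Hf|].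
    eapply Rle_trans; [apply IH; specialize (Hr K); lra|]. right. f_equal. ring.
Qed.

(** * Decay of the multipliers *)

Lemma sin_ge_half x : 0 <= x <= 1 -> x / 2 <= sin x.
Proof.
  intros Hx.
  assert (H : sin 0 - 0 / 2 <= sin x - x / 2).
  { apply (is_derive_nondecr (fun x => sin x - x / 2) (fun x => cos x - / 2)); [lra| |].
    - intros y _. auto_derive; [trivial|]. field.
    - intros y Hy. pose proof PI2_3_2.
      assert (cos (PI / 3) <= cos y) by (apply cos_decr_1; lra).
      rewrite cos_PI3 in H0. lra. }
  rewrite sin_0 in H. lra.
Qed.

Lemma avg_mult_le_1 m rho x : (1 <= m)%nat -> Cmod (avg_mult m rho x) <= 1.
Proof.
  intros Hm. pose proof (Cmod_avg_le m rho (osc x) 0 1 Hm) as H. unfold avg in H.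
  unfold avg_mult. rewrite (csum_ext _ (fun j => osc x (0 + INR j * (rho / INR m)))).
  - apply H. intros j _. rewrite Cmod_osc. lra.
  - intros j _. f_equal. ring.
Qed.

(** A geometric sum with numerator at most 2. The condition x rho <= m keeps the angle per grid step
    at most 1, where |1 - e^(-i u)| >= sin u >= u / 2; beyond it the grid could alias. *)
Lemma avg_mult_decay m rho x : (1 <= m)%nat -> 0 < x * rho <= INR m ->
  Cmod (avg_mult m rho x) <= 4 / (x * rho).
Proof.
  intros Hm Hx. assert (Hm0 : 0 < INR m) by (apply lt_0_INR; lia).
  set (th := rho / INR m).
  assert (Hth : 0 < x * th <= 1).
  { unfold th. replace (x * (rho / INR m)) with (x * rho / INR m) by (field; lra).
    split; [apply Rdiv_lt_0_compat; lra|].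
    apply Rmult_le_reg_r with (INR m); [lra|]. field_simplify; lra. }
  assert (Hgeo : forall N, (csum (fun j => osc x (INR j * th)) N * (1 - osc x th) = 1 - osc x (INR N * th))%C).
  { induction N as [|N IH].
    - simpl. rewrite Rmult_0_l. unfold osc. rewrite Cmult_0_r, Cexp_0. ring.
    - simpl csum. rewrite Cmult_plus_distr_r, IH, S_INR.
      replace ((INR N + 1) * th) with (INR N * th + th) by ring. rewrite osc_plus. ring. }
  assert (H1 : x * th / 2 <= Cmod (1 - osc x th)).
  { eapply Rle_trans; [apply sin_ge_half; lra|].
    eapply Rle_trans; [|apply Rmax_Cmod]. eapply Rle_trans; [|apply Rmax_r].
    eapply Rle_trans; [|apply Rle_abs]. unfold osc, Cexp; simpl.
    match goal with |- _ <= 0 + - (exp ?u * sin ?v) =>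
      replace u with 0 by ring; replace v with (- (x * th)) by ring end.
    rewrite exp_0, sin_neg. lra. }
  unfold avg_mult. fold th. rewrite Cmod_mult, Cmod_R, Rabs_pos_eq by (left; apply Rinv_0_lt_compat; lra).
  specialize (Hgeo m). apply (f_equal Cmod) in Hgeo. rewrite Cmod_mult in Hgeo.
  assert (H2 : Cmod (1 - osc x (INR m * th)) <= 2).
  { unfold Cminus. eapply Rle_trans; [apply Cmod_triangle|]. rewrite Cmod_opp, Cmod_1, Cmod_osc. lra. }
  set (S := Cmod (csum (fun j => osc x (INR j * th)) m)) in *.
  assert (H3 : S * (x * th / 2) <= 2).
  { rewrite <- Hgeo in H2. eapply Rle_trans; [|exact H2].
    apply Rmult_le_compat_l; [apply Cmod_ge_0|exact H1]. }
  apply Rmult_le_reg_r with (x * rho / 2); [lra|].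
  replace (4 / (x * rho) * (x * rho / 2)) with 2 by (field; nra).
  replace (/ INR m * S * (x * rho / 2)) with (S * (x * th / 2)) by (unfold th; field; lra).
  exact H3.
Qed.

Lemma avg_mult_0 m rho : (1 <= m)%nat -> avg_mult m rho 0 = 1.
Proof.
  intros Hm. unfold avg_mult.
  rewrite (csum_ext _ (fun _ => RtoC 1)).
  - rewrite csum_RtoC, rsum_const, <- RtoC_mult. f_equal. field. apply not_0_INR; lia.
  - intros j _. unfold osc.
    match goal with |- Cexp ?u = _ => replace u with (RtoC 0) by ring end. apply Cexp_0.
Qed.

Lemma avgs_mult_0 m rho K : (1 <= m)%nat -> avgs_mult m rho K 0 = 1.
Proof.
  intros Hm. induction K as [|K IH]; simpl; [reflexivity|]. rewrite IH, avg_mult_0 by exact Hm. ring.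
Qed.

(* Ingham's construction: with widths 12 e(i)/i, the first floor(x eta) factors are each
   at most 1/3 < exp(-1) at frequency x. *)
Lemma ingham_product m (e : nat -> R) n0 d K x eta :
  (1 <= m)%nat -> (8 <= n0)%nat -> 0 < d <= 1 ->
  (forall i, (n0 <= i)%nat -> 0 <= 12 * e i / INR i <= 1) ->
  0 < x <= INR m -> 0 <= eta <= 1 ->
  (forall i, (n0 <= i)%nat -> INR i <= x -> eta <= e i) ->
  x * eta <= INR K ->
  Cmod (avgs_mult m (fun j => if (j <? 3)%nat then d
                              else 12 * e (n0 + (j - 3))%nat / INR (n0 + (j - 3))) (3 + K) x)
    <= (4 / (x * d)) ^ 3 * exp (INR n0 - x * eta).
Proof.
  intros Hm Hn0 Hd He Hx Heta Hee HK.
  set (rho := fun j => if (j <? 3)%nat then d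
                              else 12 * e (n0 + (j - 3))%nat / INR (n0 + (j - 3))).
  assert (Hxd : 0 < x * d <= INR m) by nra.
  (* Here n - 1 <= x eta < n, so the indices i from n0 to n - 1 satisfy i <= x eta. Starting at n0
     loses at most n0 factors, hence exp(n0) in the bound. *)
  set (n := Z.to_nat (up (x * eta))).
  assert (Hn : x * eta < INR n) by apply up_nat_gt.
  assert (Hn1 : INR n <= x * eta + 1).
  { unfold n. destruct (archimed (x * eta)) as [_ H]. assert (0 <= x * eta) by nra.
    rewrite INR_IZR_INZ, Z2Nat.id; [lra|]. apply le_IZR. pose proof (archimed (x * eta)). lra. }
  assert (H3 : Cmod (avgs_mult m rho 3 x) <= (4 / (x * d)) ^ 3).
  { simpl. rewrite !Cmod_mult, Cmod_1. pose proof (avg_mult_decay m d x Hm Hxd) as H.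
    assert (E : forall j, (j < 3)%nat -> rho j = d).
    { intros j Hj. unfold rho. destruct (Nat.ltb_spec j 3); [reflexivity|lia]. }
    rewrite !E by lia. pose proof (Cmod_ge_0 (avg_mult m d x)).
    rewrite Rmult_1_l, Rmult_1_r.
    replace (4 / (x * d) * (4 / (x * d) * (4 / (x * d))))
      with (4 / (x * d) * (4 / (x * d)) * (4 / (x * d))) by ring.
    apply Rmult_le_compat; try assumption; [apply Rmult_le_pos; assumption|].
    apply Rmult_le_compat; assumption. }
  assert (HP : forall k, Cmod (avgs_mult m rho (3 + k) x)
      <= (4 / (x * d)) ^ 3 * exp (- INR (Nat.min k (n - n0)))).
  { assert (H0 : 0 <= (4 / (x * d)) ^ 3) by (apply pow_le, Rdiv_le_0_compat; lra).
    induction k as [|k IH].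
    - rewrite Nat.min_0_l. simpl INR. rewrite Ropp_0, exp_0, Rmult_1_r. exact H3.
    - replace (3 + S k)%nat with (S (3 + k)) by lia.
      change (avgs_mult m rho (S (3 + k)) x)
        with (avgs_mult m rho (3 + k) x * avg_mult m (rho (3 + k)%nat) x)%C.
      rewrite Cmod_mult.
      destruct (Nat.lt_ge_cases k (n - n0)) as [Hk|Hk].
      + rewrite Nat.min_l in * by lia. rewrite S_INR, Ropp_plus_distr, exp_plus, <- Rmult_assoc.
        apply Rmult_le_compat; [apply Cmod_ge_0|apply Cmod_ge_0|exact IH|].
        assert (Er : rho (3 + k)%nat = 12 * e (n0 + k)%nat / INR (n0 + k)).
        { unfold rho. destruct (Nat.ltb_spec (3 + k) 3); [lia|].
          replace (3 + k - 3)%nat with k by lia. reflexivity. }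
        assert (Hi : INR (n0 + k) <= x * eta).
        { assert (INR (n0 + k + 1) <= INR n) by (apply le_INR; lia).
          rewrite (plus_INR (n0 + k)) in H. simpl in H. lra. }
        assert (Hi0 : 0 < INR (n0 + k)) by (apply lt_0_INR; lia).
        assert (Hxe : 0 < x * eta) by lra.
        assert (Hix : INR (n0 + k) <= x) by nra.
        specialize (Hee (n0 + k)%nat ltac:(lia) Hix). specialize (He (n0 + k)%nat ltac:(lia)).
        (* From i <= x eta <= x e(i): the width 12 e(i) / i times x is at least 12, and 4 / 12 =
           1/3. The hypothesis on e applies because eta <= 1 forces i <= x. *)
        assert (H12 : 12 <= x * rho (3 + k)%nat).
        { rewrite Er. apply Rmult_le_reg_r with (INR (n0 + k)); [exact Hi0|].
          replace (x * (12 * e (n0 + k)%nat / INR (n0 + k)) * INR (n0 + k))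
            with (12 * (x * e (n0 + k)%nat)) by (field; lra).
          assert (x * eta <= x * e (n0 + k)%nat) by (apply Rmult_le_compat_l; lra). lra. }
        assert (Hxr : 0 < x * rho (3 + k)%nat <= INR m).
        { split; [lra|]. rewrite Er in *. apply Rle_trans with (x * 1); [|lra].
          apply Rmult_le_compat_l; lra. }
        eapply Rle_trans; [apply avg_mult_decay; [exact Hm|exact Hxr]|].
        apply Rle_trans with (/ 3).
        * apply Rmult_le_reg_r with (x * rho (3 + k)%nat); [lra|].
          unfold Rdiv. rewrite Rmult_assoc, Rinv_l by lra. lra.
        * rewrite exp_Ropp. apply Rinv_le_contravar; [apply exp_pos|apply exp_le_3].
      + rewrite Nat.min_r in * by lia.
        rewrite <- (Rmult_1_r (_ * exp _)).
        apply Rmult_le_compat; [apply Cmod_ge_0|apply Cmod_ge_0|exact IH|].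
        apply avg_mult_le_1, Hm. }
  eapply Rle_trans; [apply HP|].
  apply Rmult_le_compat_l; [apply pow_le, Rdiv_le_0_compat; lra|].
  apply exp_mono.
  assert (Hmin : x * eta - INR n0 <= INR (Nat.min K (n - n0))); [|lra].
  assert (Hn0' : 0 <= INR n0) by apply pos_INR.
  (* Truncated subtraction is harmless: for n < n0 the left side is negative. *)
  destruct (Nat.min_spec K (n - n0)) as [[_ ->]|[_ ->]]; [lra|].
  destruct (Nat.le_ge_cases n0 n) as [H|H]; [rewrite minus_INR by exact H; lra|].
  apply le_INR in H. pose proof (pos_INR (n - n0)). lra.
Qed.

(** * The weight omega *)

Lemma RInt_gen_tail (F : R -> R) : @ex_RInt_gen R_NormedModule F (at_point 2) (Rbar_locally p_infty) ->
  forall eps, 0 < eps -> exists b0, 2 <= b0 /\ forall x y, b0 <= x -> x <= y ->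
    ex_RInt F x y /\ RInt F x y <= eps.
Proof.
  intros [l Hl] eps He.
  assert (Hp : 0 < eps / 2) by lra.
  destruct (Hl (fun y => Rabs (y - l) < eps / 2)) as [Q R HQ [M HR] H].
  { exists (mkposreal _ Hp). intros y Hy. exact Hy. }
  unfold at_point in HQ.
  assert (Hb : forall b, M < b -> exists y, is_RInt F 2 b y /\ Rabs (y - l) < eps / 2).
  { intros b Hb. apply (H 2 b HQ (HR b Hb)). }
  exists (Rmax 2 (M + 1)). split; [apply Rmax_l|]. intros x y Hx Hxy.
  pose proof (Rmax_l 2 (M + 1)). pose proof (Rmax_r 2 (M + 1)).
  destruct (Hb x ltac:(lra)) as [vx [Hvx1 Hvx2]]. destruct (Hb y ltac:(lra)) as [vy [Hvy1 Hvy2]].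
  assert (Hex : ex_RInt F x y).
  { apply (ex_RInt_Chasles_2 (V := R_CompleteNormedModule) F 2 x y); [lra|eexists; exact Hvy1]. }
  split; [exact Hex|].
  assert (E : vx + RInt F x y = vy).
  { pose proof (RInt_Chasles (V := R_CompleteNormedModule) F 2 x y) as HC.
    rewrite (is_RInt_unique _ _ _ _ Hvx1), (is_RInt_unique _ _ _ _ Hvy1) in HC.
    apply HC; [eexists; exact Hvx1|exact Hex]. }
  apply Rabs_def2 in Hvx2. apply Rabs_def2 in Hvy2. lra.
Qed.

Lemma ln_pos t : 1 < t -> 0 < ln t.
Proof. intros H. rewrite <- ln_1. apply ln_increasing; lra. Qed.

(** Monotonicity bounds 1 - omega(t) below by its value at the right end, and 1 / (t log t) has
    antiderivative log log t. *)
Lemma weight_integral_lower (omega : R -> R) x y :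
  (forall x y : R, 2 <= x -> x <= y -> omega x <= omega y) -> 2 <= x <= y ->
  ex_RInt (fun t => (1 - omega t) / (t * ln t)) x y ->
  (1 - omega y) * (ln (ln y) - ln (ln x)) <= RInt (fun t => (1 - omega t) / (t * ln t)) x y.
Proof.
  intros Hinc Hxy Hex.
  assert (HI : is_RInt (fun t => (1 - omega y) * / (t * ln t)) x y
     ((1 - omega y) * ln (ln y) - (1 - omega y) * ln (ln x))).
  { apply (is_RInt_derive (V := R_CompleteNormedModule) (fun t => (1 - omega y) * ln (ln t))).
    - intros t Ht. rewrite Rmin_left, Rmax_right in Ht by lra.
      pose proof (ln_pos t ltac:(lra)). auto_derive; [split; [lra|split; [lra|trivial]]|].
      field. lra.
    - intros t Ht. rewrite Rmin_left, Rmax_right in Ht by lra.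
      pose proof (ln_pos t ltac:(lra)).
      apply @ex_derive_continuous. auto_derive. split; [lra|split; [nra|trivial]]. }
  rewrite Rmult_minus_distr_l, <- (is_RInt_unique _ _ _ _ HI).
  apply RInt_le; [lra|eexists; exact HI|exact Hex|].
  intros t Ht. pose proof (ln_pos t ltac:(lra)). unfold Rdiv.
  apply Rmult_le_compat_r.
  - left. apply Rinv_0_lt_compat. nra.
  - specialize (Hinc t y ltac:(lra) ltac:(lra)). lra.
Qed.

(** The 8 matches the cutoff: frequencies log n with n <= (T+1)^4 <= T^8 are at most 8 log T, so i
    <= log n gives exp(i/8) <= T and the weight is at least 1 - omega(T). *)
Definition weight (omega : R -> R) (i : nat) : R := 1 - omega (exp (INR i / 8)).

(** Between consecutive sample points log log t grows by log((i+1)/i) >= 1/(i+1). From i = 8 on, the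
    points lie beyond e > 2. *)
Lemma weight_le_integral omega i :
  (forall x y : R, 2 <= x -> x <= y -> omega x <= omega y) -> (8 <= i)%nat ->
  ex_RInt (fun t => (1 - omega t) / (t * ln t)) (exp (INR i / 8)) (exp (INR (S i) / 8)) ->
  0 <= weight omega (S i) ->
  weight omega (S i) / INR (S i)
    <= RInt (fun t => (1 - omega t) / (t * ln t)) (exp (INR i / 8)) (exp (INR (S i) / 8)).
Proof.
  intros Hinc Hi Hex Hw.
  assert (H8 : 8 <= INR i) by (replace 8 with (INR 8) by (simpl; ring); apply le_INR, Hi).
  assert (H2 : 2 <= exp (INR i / 8)).
  { apply Rle_trans with (exp 1); [pose proof (exp_ineq1_le 1); lra|apply exp_mono; lra]. }
  eapply Rle_trans; [|apply weight_integral_lower; [exact Hinc| |exact Hex]].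
  - rewrite !ln_exp. fold (weight omega (S i)). unfold Rdiv.
    rewrite !(ln_mult _ (/ 8)) by (try apply lt_0_INR; lia || lra).
    apply Rmult_le_compat_l; [exact Hw|].
    pose proof (ln_succ_ge i ltac:(lia)). lra.
  - split; [exact H2|]. apply exp_mono. rewrite S_INR. lra.
Qed.

Lemma weight_sum_small omega :
  (forall x y : R, 2 <= x -> x <= y -> omega x <= omega y) ->
  (forall t : R, 2 <= t -> omega t <= 1) ->
  @ex_RInt_gen R_NormedModule (fun t => (1 - omega t) / (t * ln t)) (at_point 2) (Rbar_locally p_infty) ->
  forall eps, 0 < eps -> exists n0, (8 <= n0)%nat /\
    (forall i, (n0 <= i)%nat -> 0 <= weight omega i) /\
    forall K, rsum (fun j => weight omega (n0 + j) / INR (n0 + j)) K <= eps.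
Proof.
  intros Hinc Hle Hint eps He.
  destruct (RInt_gen_tail _ Hint eps He) as [b0 [Hb0 Htail]].
  destruct (INR_unbounded (8 * ln b0)) as [i0 Hi0].
  (* A weight is compared with the integral over the window ending at its sample point, so the sum
     starts one index after the first window. *)
  set (n1 := (8 + i0)%nat). exists (S n1).
  assert (Hw : forall i, (8 <= i)%nat -> 0 <= weight omega i).
  { intros i Hi. unfold weight. assert (omega (exp (INR i / 8)) <= 1); [|lra]. apply Hle.
    assert (8 <= INR i) by (replace 8 with (INR 8) by (simpl; ring); apply le_INR, Hi).
    apply Rle_trans with (exp 1); [pose proof (exp_ineq1_le 1); lra|apply exp_mono; lra]. }
  assert (Hlow : forall k, b0 <= exp (INR (n1 + k) / 8)).
  { intros k. rewrite <- (exp_ln b0) by lra. apply exp_mono.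
    assert (INR i0 <= INR (n1 + k)) by (apply le_INR; unfold n1; lia). lra. }
  assert (Hup : forall j k, (j <= k)%nat -> exp (INR (n1 + j) / 8) <= exp (INR (n1 + k) / 8)).
  { intros j k Hjk. apply exp_mono. assert (INR (n1 + j) <= INR (n1 + k)) by (apply le_INR; lia). lra. }
  split; [unfold n1; lia|]. split; [intros i Hi; apply Hw; unfold n1 in Hi; lia|].
  intros K.
  assert (H : rsum (fun j => weight omega (S n1 + j) / INR (S n1 + j)) K
     <= RInt (fun t => (1 - omega t) / (t * ln t)) (exp (INR (n1 + 0) / 8)) (exp (INR (n1 + K) / 8))).
  { induction K as [|K IH].
    - simpl rsum. rewrite RInt_point. apply Rle_refl.
    - simpl rsum.
      rewrite <- (RInt_Chasles (V := R_CompleteNormedModule) _ _ (exp (INR (n1 + K) / 8)));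
        [|apply Htail; [apply Hlow|apply Hup; lia]|apply Htail; [apply Hlow|apply Hup; lia]].
      apply Rplus_le_compat; [exact IH|].
      replace (S (n1 + K)) with (S n1 + K)%nat by lia.
      replace (n1 + S K)%nat with (S (n1 + K)) by lia.
      change (S n1 + K)%nat with (S (n1 + K)).
      apply weight_le_integral; [exact Hinc|unfold n1; lia| |apply Hw; unfold n1; lia].
      replace (S (n1 + K)) with (n1 + S K)%nat by lia.
      apply Htail; [apply Hlow|apply Hup; lia]. }
  eapply Rle_trans; [exact H|]. apply Htail; [apply Hlow|apply Hup; lia].
Qed.

Lemma weight_limit omega :
  (forall x y : R, 2 <= x -> x <= y -> omega x <= omega y) ->
  (forall t : R, 2 <= t -> omega t <= 1) ->
  @ex_RInt_gen R_NormedModule (fun t => (1 - omega t) / (t * ln t)) (at_point 2) (Rbar_locally p_infty) ->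
  forall kap, 0 < kap -> exists T0, 2 <= T0 /\ forall T, T0 <= T -> 1 - omega T <= kap.
Proof.
  intros Hinc Hle Hint kap Hk.
  destruct (RInt_gen_tail _ Hint 1 ltac:(lra)) as [b0 [Hb0 Htail]].
  pose proof (ln_pos b0 ltac:(lra)) as Hl0.
  (* Past this point log log T exceeds log log b0 by 1/kap, while the integral from b0 to T is at
     most 1; hence 1 - omega(T) <= kap. *)
  set (T0 := exp (exp (ln (ln b0) + / kap))).
  assert (Hik : 0 < / kap) by (apply Rinv_0_lt_compat, Hk).
  assert (HbT : b0 <= T0).
  { unfold T0. rewrite <- (exp_ln b0) at 1 by lra. apply exp_mono.
    rewrite <- (exp_ln (ln b0)) at 1 by lra. apply exp_mono. lra. }
  exists T0. split; [lra|]. intros T HT.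
  destruct (Htail b0 T ltac:(lra) ltac:(lra)) as [Hex HI].
  pose proof (weight_integral_lower omega b0 T Hinc ltac:(lra) Hex) as HL.
  assert (Hll : / kap <= ln (ln T) - ln (ln b0)).
  { assert (ln (ln b0) + / kap <= ln (ln T)); [|lra].
    rewrite <- (ln_exp (ln (ln b0) + / kap)). apply ln_le; [apply exp_pos|].
    rewrite <- (ln_exp (exp (ln (ln b0) + / kap))). apply ln_le; [apply exp_pos|exact HT]. }
  specialize (Hle T ltac:(lra)).
  assert ((1 - omega T) * / kap <= 1).
  { apply Rle_trans with ((1 - omega T) * (ln (ln T) - ln (ln b0))); [|lra].
    apply Rmult_le_compat_l; lra. }
  apply Rmult_le_reg_r with (/ kap); [exact Hik|]. rewrite Rinv_r by lra. assumption.
Qed.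

Lemma ln2_ge_half : 1 / 2 <= ln 2.
Proof. pose proof ln_lt_2. lra. Qed.

Lemma ln_INR_ge n : 1 / 2 <= ln (INR (S (S n))).
Proof.
  eapply Rle_trans; [apply ln2_ge_half|]. apply ln_le; [lra|].
  rewrite !S_INR. pose proof (pos_INR n). lra.
Qed.

(** Telescoping: 1 / log n - 1 / log(n+1) is at least 1 / ((n+1) log^2(n+1)). The shifted indices
    start the sum at n = 2. *)
Lemma log_square_sum N : rsum (fun n => / (INR (S (S n)) * ln (INR (S (S n))) ^ 2)) N <= 4.
Proof.
  assert (H : forall N, rsum (fun n => / (INR (S (S n)) * ln (INR (S (S n))) ^ 2)) (S N)
     <= 4 - / ln (INR (S (S N)))).
  { clear N. induction N as [|N IH].
    - change (0 + / (INR 2 * ln (INR 2) ^ 2) <= 4 - / ln (INR 2)).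
      replace (INR 2) with 2 by (simpl; ring). pose proof ln2_ge_half as H2.
      assert (Hi : / ln 2 <= 2).
      { rewrite <- (Rinv_inv 2) at 2. apply Rinv_le_contravar; lra. }
      assert (/ (2 * ln 2 ^ 2) <= 2).
      { apply Rle_trans with (/ (1 / 2)); [apply Rinv_le_contravar; nra|lra]. }
      lra.
    - change (rsum (fun n => / (INR (S (S n)) * ln (INR (S (S n))) ^ 2)) (S N)
        + / (INR (S (S (S N))) * ln (INR (S (S (S N)))) ^ 2) <= 4 - / ln (INR (S (S (S N))))).
      pose proof (ln_INR_ge N) as H1. pose proof (ln_INR_ge (S N)) as H2.
      pose proof (ln_succ_ge (S (S N)) ltac:(lia)) as H3.
      set (u := ln (INR (S (S N)))) in *. set (v := ln (INR (S (S (S N))))) in *.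
      set (w := INR (S (S (S N)))) in *.
      assert (Hw : 0 < w) by (unfold w; apply lt_0_INR; lia).
      assert (Hiw : 0 < / w) by (apply Rinv_0_lt_compat, Hw).
      assert (/ (w * v ^ 2) <= / u - / v); [|lra].
      replace (/ u - / v) with ((v - u) / (u * v)) by (field; lra).
      apply Rle_trans with (/ w / (u * v)).
      + replace (/ (w * v ^ 2)) with (/ w * / (v * v)) by (field; lra).
        unfold Rdiv. apply Rmult_le_compat_l; [lra|]. apply Rinv_le_contravar; nra.
      + unfold Rdiv. apply Rmult_le_compat_r; [left; apply Rinv_0_lt_compat; nra|lra]. }
  destruct N as [|N]; [simpl; lra|]. specialize (H N).
  pose proof (ln_INR_ge N). assert (0 < / ln (INR (S (S N)))) by (apply Rinv_0_lt_compat; lra). lra.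
Qed.

(** * Lower bounds for the integral *)

(** Clamping the ordinate at 1 avoids the pole and makes the function continuous on all of R, so
    integrability needs no side conditions; for t >= 1 nothing changes. *)
Definition zline (sigma t : R) : C := riemann_zeta (sigma, Rmax t 1).

Lemma Rmax_1_lipschitz t u : Rabs (Rmax u 1 - Rmax t 1) <= Rabs (u - t).
Proof. unfold Rmax. destruct (Rle_dec u 1), (Rle_dec t 1); unfold Rabs; repeat destruct Rcase_abs; lra. Qed.

Lemma Ccont_zline sigma : Ccont (zline sigma).
Proof.
  intros t eps He.
  assert (Hi : 0 < Im (sigma, Rmax t 1)) by (simpl; pose proof (Rmax_r t 1); lra).
  destruct (analytic_lipschitz riemann_zeta (sigma, Rmax t 1)
    (riemann_zeta_analytic _ (Im_pos_neq_1 _ Hi))) as [L [r [Hr [HL H]]]].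
  exists (Rmin r (eps / (L + 1))). split; [apply Rmin_pos; [exact Hr|apply Rdiv_lt_0_compat; lra]|].
  intros u Hu. pose proof (Rmax_1_lipschitz t u) as Hm.
  assert (Hh : Cmod (0, Rmax u 1 - Rmax t 1) <= Rabs (u - t)).
  { eapply Rle_trans; [apply Cmod_le_Rabs|]. simpl. rewrite Rabs_R0. lra. }
  pose proof (Rmin_l r (eps / (L + 1))). pose proof (Rmin_r r (eps / (L + 1))).
  specialize (H (0, Rmax u 1 - Rmax t 1) ltac:(lra)).
  replace (Cplus (sigma, Rmax t 1) (0, Rmax u 1 - Rmax t 1)) with ((sigma, Rmax u 1) : C) in H
    by (apply Ceq; simpl; ring).
  unfold zline. eapply Rle_lt_trans; [exact H|].
  pose proof (Rabs_pos (u - t)).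
  apply Rle_lt_trans with ((L + 1) * Rabs (u - t)).
  - pose proof (Cmod_ge_0 (0, Rmax u 1 - Rmax t 1)). nra.
  - apply Rlt_le_trans with ((L + 1) * (eps / (L + 1))); [apply Rmult_lt_compat_l; lra|right; field; lra].
Qed.

Lemma RInt_zline sigma T d : 2 <= T -> 0 < d ->
  RInt (fun t => Cmod (riemann_zeta (sigma, t))) T (T + d) = RInt (fun t => Cmod (zline sigma t)) T (T + d).
Proof.
  intros HT Hd. apply RInt_ext. intros t Ht. rewrite Rmin_left, Rmax_right in Ht by lra.
  unfold zline. rewrite Rmax_left by lra. reflexivity.
Qed.

Lemma RInt_Cmod_lower f c a b a' b' : Ccont f -> a' <= a -> a <= b -> b <= b' ->
  (forall t, a <= t <= b -> c <= Cmod (f t)) -> c * (b - a) <= RInt (fun t => Cmod (f t)) a' b'.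
Proof.
  intros Hf H1 H2 H3 Hc. eapply Rle_trans; [|apply (RInt_Cmod_mono f a b); assumption].
  replace (c * (b - a)) with (RInt (fun _ => c) a b).
  - apply RInt_le; [exact H2|apply ex_RInt_const|apply Ccont_ex_RInt, Hf|]. intros t Ht. apply Hc. lra.
  - rewrite RInt_const. unfold scal; simpl. unfold mult; simpl. ring.
Qed.

(** A non-zero value in the middle half of the interval persists with half its size nearby, and that
    neighbourhood stays inside [T, T + delta] when T moves a little. One number serves as both gauge
    and lower bound, as the compactness argument requires. *)
Lemma lower_bound_local delta T0 s0 : 0 < delta -> 2 <= T0 -> exists d : posreal,
  forall T sigma, 2 <= T -> Rabs (T - T0) < d -> Rabs (sigma - s0) < d ->
    d <= RInt (fun t => Cmod (zline sigma t)) T (T + delta).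
Proof.
  intros Hd HT0.
  destruct (riemann_zeta_nonzero_on_segment s0 (T0 + delta / 4) (T0 + 3 * delta / 4)) as [t1 [Ht1 Hnz]]; [lra|].
  assert (HA : 0 < Cmod (riemann_zeta (s0, t1))) by (apply Cmod_gt_0, Hnz).
  set (A := Cmod (riemann_zeta (s0, t1))) in *.
  assert (Hi : 0 < Im (s0, t1)) by (simpl; lra).
  destruct (analytic_lipschitz riemann_zeta (s0, t1)
    (riemann_zeta_analytic _ (Im_pos_neq_1 _ Hi))) as [L [r [Hr [HL H]]]].
  set (r0 := Rmin (Rmin r (delta / 4)) (A / (2 * (L + 1)))).
  assert (Hr0 : 0 < r0 /\ r0 <= r /\ r0 <= delta / 4 /\ r0 <= A / (2 * (L + 1))).
  { unfold r0. split; [|split; [|split]].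
    - repeat apply Rmin_pos; try lra. apply Rdiv_lt_0_compat; lra.
    - eapply Rle_trans; [apply Rmin_l|apply Rmin_l].
    - eapply Rle_trans; [apply Rmin_l|apply Rmin_r].
    - apply Rmin_r. }
  assert (Hp : 0 < Rmin (r0 / 2) (r0 * A / 4)) by (apply Rmin_pos; nra).
  exists (mkposreal _ Hp). simpl. intros T sigma HT H1 H2.
  pose proof (Rmin_l (r0 / 2) (r0 * A / 4)). pose proof (Rmin_r (r0 / 2) (r0 * A / 4)).
  apply Rabs_def2 in H1.
  apply Rle_trans with (A / 2 * ((t1 + r0 / 4) - (t1 - r0 / 4))); [lra|].
  apply RInt_Cmod_lower; [apply Ccont_zline|lra|lra|lra|].
  intros t Ht. unfold zline. rewrite Rmax_left by lra.
  assert (Hh : Cmod (sigma - s0, t - t1) < r0).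
  { eapply Rle_lt_trans; [apply Cmod_le_Rabs|]. simpl.
    assert (Rabs (t - t1) <= r0 / 4) by (apply Rabs_le; lra). lra. }
  specialize (H (sigma - s0, t - t1) ltac:(lra)).
  replace (Cplus (s0, t1) (sigma - s0, t - t1)) with ((sigma, t) : C) in H
    by (apply Ceq; simpl; ring).
  pose proof (Cmod_triangle_minus (riemann_zeta (s0, t1)) (riemann_zeta (sigma, t) - riemann_zeta (s0, t1))) as Tr.
  replace (riemann_zeta (s0, t1) + (riemann_zeta (sigma, t) - riemann_zeta (s0, t1)))%C
    with (riemann_zeta (sigma, t)) in Tr by ring.
  fold A in Tr.
  assert (L * Cmod (sigma - s0, t - t1) <= A / 2); [|lra].
  apply Rle_trans with ((L + 1) * (A / (2 * (L + 1)))); [|right; field; lra].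
  apply Rmult_le_compat; try lra. apply Cmod_ge_0.
Qed.

Lemma lower_bound_compact delta T1 s1 s2 : 0 < delta -> exists d, 0 < d /\
  forall T sigma, 2 <= T <= T1 -> s1 <= sigma <= s2 ->
    d <= RInt (fun t => Cmod (zline sigma t)) T (T + delta).
Proof.
  intros Hd.
  assert (Hch : forall T0 s0, exists d : posreal, 2 <= T0 ->
    forall T sigma, 2 <= T -> Rabs (T - T0) < d -> Rabs (sigma - s0) < d ->
      d <= RInt (fun t => Cmod (zline sigma t)) T (T + delta)).
  { intros T0 s0. destruct (Rle_or_lt 2 T0) as [H|H].
    - destruct (lower_bound_local delta T0 s0 Hd H) as [d H']. exists d. intros _. exact H'.
    - exists (mkposreal 1 Rlt_0_1). intros. lra. }
  set (del := fun x y => proj1_sig (constructive_indefinite_description _ (Hch x y))).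
  destruct (compactness_value_2d 2 T1 s1 s2 del) as [d H].
  exists d. split; [apply cond_pos|]. intros T sigma HT Hs. apply Rnot_lt_le. intros Hlt.
  apply (H T sigma HT Hs). intros [u [v [Hu [Hv [H1 [H2 H3]]]]]].
  unfold del in *. destruct (constructive_indefinite_description _ (Hch u v)) as [e He]. simpl in *.
  specialize (He ltac:(lra) T sigma ltac:(lra) H1 H2). lra.
Qed.

(** With x = log n, n^(-sigma) <= e^(x eta) / n cancels the damping e^(-x eta) exactly. Since x >=
    1/2, the weight 1 + x is at most 3x, leaving 192 / (d^3 n x^2) times exp(n0), and 768 = 4 * 192.
    The weight controls total mass and Lipschitz constant at once. *)
Lemma damped_sum_bound d n0 N (M : nat -> C) sigma eta : 0 < d ->
  1 - eta <= sigma -> Cmod (M O) <= 1 ->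
  (forall n, (1 <= n < N)%nat ->
     Cmod (M n) <= (4 / (ln (INR (S n)) * d)) ^ 3 * exp (INR n0 - ln (INR (S n)) * eta)) ->
  rsum (fun n => Cmod (npow (S n) (RtoC sigma) * M n) * (1 + ln (INR (S n)))) N
    <= 1 + 768 * exp (INR n0) / d ^ 3.
Proof.
  intros Hd Hs HM0 HM.
  assert (Hd3 : 0 < d ^ 3) by (apply pow_lt, Hd).
  assert (HQ : 0 < 192 * exp (INR n0) / d ^ 3).
  { apply Rdiv_lt_0_compat; [|exact Hd3]. pose proof (exp_pos (INR n0)). lra. }
  destruct N as [|N].
  { simpl rsum. unfold Rdiv in *. lra. }
  rewrite rsum_S_head.
  apply Rplus_le_compat.
  - rewrite npow_1, Cmult_1_l. change (INR 1) with 1. rewrite ln_1. lra.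
  - apply Rle_trans with
      (rsum (fun n => 192 * exp (INR n0) / d ^ 3 * / (INR (S (S n)) * ln (INR (S (S n))) ^ 2)) N).
    + apply rsum_le. intros n Hn. specialize (HM (S n) ltac:(lia)).
      rewrite Cmod_mult, Cmod_npow, re_RtoC.
      pose proof (ln_INR_ge n) as Hx. set (x := ln (INR (S (S n)))) in *.
      set (nu := INR (S (S n))).
      assert (Hnu : 0 < nu) by (unfold nu; apply lt_0_INR; lia).
      assert (Hrp : rp (S (S n)) sigma <= / nu * exp (x * eta)).
      { eapply Rle_trans; [apply (rp_anti _ (1 - eta)); exact Hs|]. unfold rp. fold x.
        replace (- (1 - eta) * x) with (- x + x * eta) by ring.
        rewrite exp_plus, exp_Ropp. unfold x at 1. rewrite exp_ln by exact Hnu. right. reflexivity. }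
      apply Rle_trans with (/ nu * exp (x * eta) * ((4 / (x * d)) ^ 3 * exp (INR n0 - x * eta)) * (3 * x)).
      * apply Rmult_le_compat; [|lra| |lra].
        -- apply Rmult_le_pos; [left; apply rp_pos|apply Cmod_ge_0].
        -- apply Rmult_le_compat; [left; apply rp_pos|apply Cmod_ge_0|exact Hrp|exact HM].
      * replace (INR n0 - x * eta) with (INR n0 + - (x * eta)) by ring.
        rewrite exp_plus, exp_Ropp. right. pose proof (exp_pos (x * eta)). field. lra.
    + rewrite rsum_scal.
      replace (768 * exp (INR n0) / d ^ 3) with (192 * exp (INR n0) / d ^ 3 * 4) by (field; lra).
      apply Rmult_le_compat_l; [lra|apply log_square_sum].
Qed.

Lemma osc_lipschitz x s t : 0 <= x -> s <= t -> Cmod (osc x t - osc x s) <= x * (t - s).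
Proof.
  intros Hx Hst.
  replace (osc x t) with (osc x s * osc x (t - s))%C by (rewrite <- osc_plus; f_equal; ring).
  replace (osc x s * osc x (t - s) - osc x s)%C with (osc x s * (osc x (t - s) + - (1)))%C by ring.
  rewrite Cmod_mult, Cmod_osc, Rmult_1_l.
  apply (Cmod_le_of_derivative (fun h => osc x h + - (1))%C
    (fun h => - (Ci * RtoC x) * RtoC 1 * osc x h + 0)%C (fun h => x * h) (fun h => x)); [lra| | | |].
  - intros h _. apply Cderiv_plus; [|apply Cderiv_const].
    apply (Cderiv_Cexp (- (Ci * RtoC x)) (fun h => h)). apply @is_derive_id.
  - intros h _. auto_derive; [trivial|ring].
  - intros h _. replace (- (Ci * RtoC x) * 1 * osc x h + 0)%C with (- (RtoC x * (Ci * osc x h)))%C by ring.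
    rewrite Cmod_opp, !Cmod_mult, Cmod_osc, Cmod_R, Rabs_pos_eq by exact Hx.
    assert (Cmod Ci = 1) as ->; [|lra].
    unfold Ci, Cmod; simpl. replace (0 * (0 * 1) + 1 * (1 * 1)) with 1 by ring. apply sqrt_1.
  - unfold osc. replace (- (Ci * RtoC x) * 0)%C with (RtoC 0) by ring. rewrite Cexp_0.
    replace (1 + - (1))%C with (RtoC 0) by ring. rewrite Cmod_0. lra.
Qed.

Lemma osc_sum_lipschitz (c : nat -> C) (x : nat -> R) N B s t : (forall n, 0 <= x n) ->
  rsum (fun n => Cmod (c n) * x n) N <= B -> s <= t ->
  Cmod (csum (fun n => c n * osc (x n) t)%C N - csum (fun n => c n * osc (x n) s)%C N) <= B * (t - s).
Proof.
  intros Hx HB Hst.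
  replace (csum (fun n => c n * osc (x n) t)%C N - csum (fun n => c n * osc (x n) s)%C N)%C
    with (csum (fun n => c n * osc (x n) t + (- (1)) * (c n * osc (x n) s))%C N)
    by (rewrite csum_plus, csum_scal; ring).
  eapply Rle_trans; [apply csum_Cmod|].
  apply Rle_trans with (rsum (fun n => (t - s) * (Cmod (c n) * x n)) N).
  - apply rsum_le. intros n _.
    replace (c n * osc (x n) t + (- (1)) * (c n * osc (x n) s))%C
      with (c n * (osc (x n) t - osc (x n) s))%C by ring.
    rewrite Cmod_mult. pose proof (osc_lipschitz (x n) s t (Hx n) Hst).
    pose proof (Cmod_ge_0 (c n)). nra.
  - rewrite rsum_scal, Rmult_comm. apply Rmult_le_compat_r; lra.
Qed.

Lemma npow_osc n sigma t : npow (S n) (sigma, t) = (npow (S n) (RtoC sigma) * osc (ln (INR (S n))) t)%C.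
Proof.
  unfold npow, osc. rewrite <- Cexp_plus. f_equal. apply Ceq; simpl; ring.
Qed.

(** With N = m^4, 1 - sigma <= 1/16 and N <= T^8 give N^(1-sigma) <= T^(1/2); N >= T^4 outweighs the
    factor (4T)^2 and leaves 64 / T. Division by t >= T gives 65 T^(-1/2). *)
Lemma zline_approx T sigma m t : 2 <= T -> 15 / 16 <= sigma <= 3 ->
  T <= INR m <= T + 1 -> T <= t <= T + 1 ->
  Cmod (zline sigma t
     - csum (fun n => npow (S n) (RtoC sigma) * osc (ln (INR (S n))) t)%C (m ^ 4))
    <= 65 * exp (- (ln T / 2)).
Proof.
  intros HT Hs Hm Ht. unfold zline. rewrite Rmax_left by lra.
  rewrite (csum_ext _ (fun n => npow (S n) (sigma, t))) by (intros; symmetry; apply npow_osc).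
  set (N := (m ^ 4)%nat).
  pose proof (ln_pos T ltac:(lra)) as HlT.
  assert (HN : INR N = INR m ^ 4) by (unfold N; apply pow_INR).
  assert (HNT : T ^ 4 <= INR N) by (rewrite HN; apply pow_incr; lra).
  (* This is the condition 2a <= N of the approximation with a = 4T, the bound for |s - 1|. *)
  assert (HT4 : 8 * T <= T ^ 4).
  { replace (T ^ 4) with (T ^ 3 * T) by ring. apply Rmult_le_compat_r; [lra|].
    replace 8 with (2 ^ 3) by ring. apply pow_incr; lra. }
  assert (HN0 : (1 <= N)%nat).
  { destruct N; [simpl in *; lra|lia]. }
  assert (HlN : 4 * ln T <= ln (INR N) <= 8 * ln T).
  { split.
    - replace (4 * ln T) with (ln (T ^ 4)) by (rewrite ln_pow by lra; simpl; ring).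
      apply ln_le; [apply pow_lt; lra|exact HNT].
    - replace (8 * ln T) with (ln ((T * T) ^ 4)) by
        (rewrite ln_pow, ln_mult by nra; simpl; ring).
      apply ln_le; [pose proof (pow_lt T 4 ltac:(lra)); lra|].
      rewrite HN. apply pow_incr. split; [lra|nra]. }
  assert (Hsm : Cmod ((sigma, t) - 1) <= 4 * T).
  { eapply Rle_trans; [apply Cmod_le_Rabs|]. simpl.
    replace (sigma + - (1)) with (sigma - 1) by ring.
    assert (Rabs (sigma - 1) <= 2) by (apply Rabs_le; lra).
    replace (t + - 0) with t by ring. rewrite (Rabs_pos_eq t) by lra. lra. }
  eapply Rle_trans; [apply (riemann_zeta_approx (sigma, t) (4 * T) N); simpl; try lra; try assumption|].
  simpl Re. simpl Im.
  assert (H1 : rp N (sigma - 1) <= exp (ln T / 2)).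
  { unfold rp. apply exp_mono. nra. }
  assert (H2 : rp N sigma <= exp (- (3 * ln T))).
  { unfold rp. apply exp_mono. nra. }
  assert (HE : exp (ln T) = T) by (apply exp_ln; lra).
  set (v := exp (- (ln T / 2))).
  assert (Hv : 0 < v) by apply exp_pos.
  assert (Hv1 : exp (ln T / 2) = T * v).
  { rewrite <- HE at 2. unfold v. rewrite <- exp_plus. f_equal. field. }
  assert (Hv2 : T * (v * v) = 1).
  { unfold v. rewrite <- exp_plus, <- HE at 1. rewrite <- exp_plus, <- exp_0. f_equal. field. }
  assert (Hv3 : exp (- (3 * ln T)) = (v * v) * (v * v) * (v * v)).
  { unfold v. rewrite <- !exp_plus. f_equal. field. }
  assert (Hv4 : v <= 1).
  { unfold v. rewrite <- exp_0. apply exp_mono. lra. }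
  assert (H3 : rp N sigma / sigma <= 2 * ((v * v) * (v * v) * (v * v))).
  { rewrite <- Hv3. apply Rmult_le_reg_r with sigma; [lra|].
    replace (rp N sigma / sigma * sigma) with (rp N sigma) by (field; lra).
    pose proof (exp_pos (- (3 * ln T))). nra. }
  apply Rmult_le_reg_r with t; [lra|].
  match goal with |- ?a / t * t <= _ => replace (a / t * t) with a by (field; lra) end.
  apply Rle_trans with (65 * v * T); [|apply Rmult_le_compat_l; lra].
  assert (H4 : 2 * (4 * T) ^ 2 * (rp N sigma / sigma) <= 64 * (v * v)).
  { apply Rle_trans with (2 * (4 * T) ^ 2 * (2 * ((v * v) * (v * v) * (v * v)))).
    - apply Rmult_le_compat_l; [nra|exact H3].
    - right. replace (2 * (4 * T) ^ 2 * (2 * (v * v * (v * v) * (v * v))))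
        with (64 * (T * (v * v)) * (T * (v * v)) * (v * v)) by ring. rewrite Hv2. ring. }
  rewrite Hv1 in H1. assert (v * v <= v * T) by (apply Rmult_le_compat_l; lra). lra.
Qed.

(** The averaged partial sum is large at one point by two constants, near it by the Lipschitz bound,
    and so is averaged zeta by approximation; integration then removes the averages. *)
Lemma lower_bound_large_T (omega : R -> R) :
  (forall x y : R, 2 <= x -> x <= y -> omega x <= omega y) ->
  (forall t : R, 2 <= t -> omega t <= 1) ->
  @ex_RInt_gen R_NormedModule (fun t => (1 - omega t) / (t * ln t)) (at_point 2) (Rbar_locally p_infty) ->
  forall delta, 0 < delta <= 1 -> exists c T0, 0 < c /\ 2 <= T0 /\
    forall T sigma, T0 <= T -> omega T <= sigma <= 3 ->
      c <= RInt (fun t => Cmod (zline sigma t)) T (T + delta).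
Proof.
  intros Hinc Hle Hint delta Hdel.
  (* Width budget: 12 times delta / 48 for Ingham's factors and 3 times delta / 12 for the fixed
     ones give delta / 2 in total. *)
  destruct (weight_sum_small omega Hinc Hle Hint (delta / 48) ltac:(lra)) as [n0 [Hn0 [Hw0 Hwsum]]].
  set (d := delta / 12).
  set (B := 1 + 768 * exp (INR n0) / d ^ 3).
  assert (Hd : 0 < d <= 1) by (unfold d; lra).
  assert (HB : 1 < B).
  { unfold B. assert (0 < 768 * exp (INR n0) / d ^ 3); [|lra].
    apply Rdiv_lt_0_compat; [pose proof (exp_pos (INR n0)); lra|apply pow_lt; lra]. }
  destruct (two_constants (delta / 8) B ltac:(lra) ltac:(lra)) as [c [Hc Htc]].
  (* Within distance c / (2B) the Lipschitz constant B costs at most c / 2; the approximation error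
     [kap] costs at most another c / 4. *)
  set (w := Rmin (delta / 8) (c / (2 * B))).
  assert (Hw : 0 < w /\ w <= delta / 8 /\ w <= c / (2 * B)).
  { unfold w. split; [apply Rmin_pos; [lra|apply Rdiv_lt_0_compat; lra]|].
    split; [apply Rmin_l|apply Rmin_r]. }
  set (kap := Rmin (c / 4) 1).
  assert (Hkap : 0 < kap /\ kap <= c / 4 /\ kap <= 1).
  { unfold kap. split; [apply Rmin_pos; lra|split; [apply Rmin_l|apply Rmin_r]]. }
  (* This ensures sigma >= 15/16, the range of [zline_approx]. *)
  destruct (weight_limit omega Hinc Hle Hint (1 / 16) ltac:(lra)) as [T1 [HT1 Heta]].
  (* Solves 65 T^(-1/2) <= kap for T. *)
  set (T0 := Rmax T1 (exp (2 * ln (65 / kap)))).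
  exists (c / 4 * w), T0. split; [nra|]. split; [eapply Rle_trans; [exact HT1|apply Rmax_l]|].
  intros T sigma HT Hs.
  assert (HTT1 : T1 <= T) by (eapply Rle_trans; [apply Rmax_l|exact HT]).
  assert (HTk : exp (2 * ln (65 / kap)) <= T) by (eapply Rle_trans; [apply Rmax_r|exact HT]).
  assert (HT2 : 2 <= T) by lra.
  pose proof (ln_pos T ltac:(lra)) as HlT.
  set (eta := 1 - omega T).
  assert (Heta1 : 0 <= eta <= 1 / 16).
  { unfold eta. specialize (Heta T HTT1). specialize (Hle T HT2). lra. }
  assert (Hk65 : 65 * exp (- (ln T / 2)) <= kap).
  { assert (H65 : 0 < 65 / kap) by (apply Rdiv_lt_0_compat; lra).
    assert (H1 : ln (65 / kap) <= ln T / 2).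
    { assert (2 * ln (65 / kap) <= ln T); [|lra].
      rewrite <- (ln_exp (2 * ln (65 / kap))). apply ln_le; [apply exp_pos|exact HTk]. }
    apply Rle_trans with (65 * exp (- ln (65 / kap))).
    - apply Rmult_le_compat_l; [lra|]. apply exp_mono. lra.
    - rewrite exp_Ropp, exp_ln by exact H65. right. field. lra. }
  set (m := Z.to_nat (up T)).
  assert (Hm : T <= INR m <= T + 1).
  { split; [left; apply up_nat_gt|]. unfold m. destruct (archimed T) as [H1 H2].
    rewrite INR_IZR_INZ, Z2Nat.id; [lra|]. apply le_IZR. lra. }
  set (N := (m ^ 4)%nat).
  assert (HNm : INR N = INR m ^ 4) by (unfold N; apply pow_INR).
  assert (HN1 : 1 <= INR N) by (rewrite HNm; apply pow_R1_Rle; lra).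
  assert (HN : (1 <= N)%nat) by (apply INR_le; simpl; exact HN1).
  assert (HlN : ln (INR N) <= 8 * ln T).
  { replace (8 * ln T) with (ln ((T * T) ^ 4)) by
        (rewrite ln_pow, ln_mult by nra; simpl; ring).
    apply ln_le; [lra|]. rewrite HNm. apply pow_incr. split; [lra|nra]. }
  assert (HlNN : ln (INR N) <= INR N).
  { pose proof (ln_le_sub_1 (INR N) ltac:(lra)). lra. }
  set (x := fun n => ln (INR (S n))).
  assert (Hx0 : forall n, 0 <= x n) by (intros; apply ln_INR_nonneg).
  assert (HxN : forall n, (n < N)%nat -> x n <= ln (INR N)).
  { intros n Hn. apply ln_le; [apply lt_0_INR; lia|apply le_INR; lia]. }
  set (rho := fun j => if (j <? 3)%nat then d
                else 12 * weight omega (n0 + (j - 3))%nat / INR (n0 + (j - 3))).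
  assert (Hone : forall i, (n0 <= i)%nat -> 0 <= 12 * weight omega i / INR i <= 1).
  { intros i Hi. assert (0 < INR i) by (apply lt_0_INR; lia). specialize (Hw0 i Hi) as Hwi.
    split; [apply Rdiv_le_0_compat; lra|].
    pose proof (term_le_of_rsum_le (fun j => weight omega (n0 + j) / INR (n0 + j)) (delta / 48) (i - n0)) as H1.
    cbv beta in H1. replace (n0 + (i - n0))%nat with i in H1 by lia.
    assert (H2 : weight omega i / INR i <= delta / 48).
    { apply H1; [|exact Hwsum]. intros j. apply Rdiv_le_0_compat; [apply Hw0; lia|apply lt_0_INR; lia]. }
    unfold Rdiv in *. lra. }
  assert (Hrho : forall j, 0 <= rho j).
  { intros j. unfold rho. destruct (Nat.ltb_spec j 3); [lra|]. apply Hone. lia. }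
  assert (Hsum : rsum rho (3 + N) <= delta / 2).
  { rewrite rsum_split.
    assert (E3 : rsum rho 3 = 3 * d) by (simpl; unfold rho; simpl; ring).
    rewrite E3. rewrite (rsum_ext _ (fun j => 12 * (weight omega (n0 + j) / INR (n0 + j)))).
    - rewrite rsum_scal. specialize (Hwsum N). unfold d. lra.
    - intros j _. unfold rho. destruct (Nat.ltb_spec (3 + j) 3); [lia|].
      replace (3 + j - 3)%nat with j by lia. unfold Rdiv. ring. }
  (* [N] is both the number of grid points per average and the number of Ingham factors: since log N
     <= N, no frequency aliases and the factors do not run out. *)
  set (M := fun n => avgs_mult N rho (3 + N) (x n)).
  assert (HM0 : M O = 1).
  { unfold M, x. change (INR 1) with 1. rewrite ln_1. apply avgs_mult_0. exact HN. }
  assert (HM : forall n, (1 <= n < N)%nat ->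
     Cmod (M n) <= (4 / (x n * d)) ^ 3 * exp (INR n0 - x n * eta)).
  { intros n Hn. destruct n as [|n]; [lia|]. pose proof (ln_INR_ge n) as Hxn.
    change (ln (INR (S (S n)))) with (x (S n)) in Hxn.
    pose proof (HxN (S n) ltac:(lia)) as HxN'.
    apply ingham_product; auto; try lra; try lia.
    - intros i Hi Hix. unfold eta, weight.
      assert (omega (exp (INR i / 8)) <= omega T); [|lra]. apply Hinc.
      + apply Rle_trans with (exp 1); [pose proof (exp_ineq1_le 1); lra|]. apply exp_mono.
        assert (8 <= INR i) by (replace 8 with (INR 8) by (simpl; ring); apply le_INR; lia). lra.
      + rewrite <- (exp_ln T) by lra. apply exp_mono. lra.
    - apply Rle_trans with (x (S n) * 1); [apply Rmult_le_compat_l; lra|lra]. }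
  set (b := fun n => (npow (S n) (RtoC sigma) * M n)%C).
  assert (Hbsum : rsum (fun n => Cmod (b n) * (1 + x n)) N <= B).
  { apply (damped_sum_bound d n0 N M sigma eta); [lra|unfold eta; lra|rewrite HM0, Cmod_1; lra|exact HM]. }
  assert (Hb1 : rsum (fun n => Cmod (b n)) N <= B).
  { eapply Rle_trans; [|exact Hbsum]. apply rsum_le. intros n _.
    pose proof (Cmod_ge_0 (b n)). specialize (Hx0 n). nra. }
  assert (Hb2 : rsum (fun n => Cmod (b n) * x n) N <= B).
  { eapply Rle_trans; [|exact Hbsum]. apply rsum_le. intros n _.
    pose proof (Cmod_ge_0 (b n)). nra. }
  set (P := fun t => csum (fun n => npow (S n) (RtoC sigma) * osc (x n) t)%C N).
  set (F := avgs N rho (3 + N) P).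
  assert (HF : F = (fun t => csum (fun n => b n * osc (x n) t)%C N)).
  { unfold F, P, b, M. apply avgs_osc_sum. }
  (* Centre of [T, T + delta/2]: a point within delta / 8 of it, followed by w <= delta / 8, stays
     in that half. *)
  set (tc := T + delta / 4).
  (* Translation to tc is absorbed into the coefficients, with moduli unchanged and leading
     coefficient still 1. *)
  destruct (Htc (fun n => b n * osc (x n) tc)%C x N HN) as [y [Hy HcF]].
  { unfold b. rewrite HM0, npow_1. unfold x. change (INR 1) with 1. rewrite ln_1. unfold osc.
    match goal with |- (_ * _ * Cexp ?u)%C = _ => replace u with (RtoC 0) by ring end.
    rewrite Cexp_0. ring. }
  { unfold x. change (INR 1) with 1. apply ln_1. }
  { intros n Hn. apply ln_le; [lra|]. replace 2 with (INR 2) by (simpl; ring). apply le_INR. lia. }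
  { eapply Rle_trans; [|exact Hb1]. apply rsum_le. intros n _. rewrite Cmod_mult, Cmod_osc. lra. }
  (* The sign flips because [expsum] oscillates as e^(i x y) and [osc] as e^(-i x t). *)
  set (t0 := tc - y).
  assert (Ht0 : Rabs (t0 - tc) <= delta / 8).
  { unfold t0. replace (tc - y - tc) with (- y) by ring. rewrite Rabs_Ropp. exact Hy. }
  apply Rabs_le_between in Ht0.
  assert (HF0 : c <= Cmod (F t0)).
  { rewrite HF. eapply Rle_trans; [exact HcF|]. right. f_equal. unfold expsum.
    apply csum_ext. intros n _. unfold t0. replace (tc - y) with (tc + - y) by ring.
    rewrite osc_plus. unfold osc at 3. rewrite RtoC_opp, <- Cmult_assoc. do 3 f_equal. ring. }
  assert (HFlow : forall t, t0 <= t <= t0 + w -> c / 2 <= Cmod (F t)).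
  { intros t Ht.
    pose proof (osc_sum_lipschitz b x N B t0 t Hx0 Hb2 ltac:(lra)) as HL.
    rewrite HF in *.
    match type of HL with Cmod (?u - ?v) <= _ => pose proof (Cmod_triangle_minus v (u - v)) as Tr;
      replace (v + (u - v))%C with u in Tr by ring end.
    assert (B * (t - t0) <= c / 2).
    { apply Rle_trans with (B * (c / (2 * B))); [apply Rmult_le_compat_l; lra|right; field; lra]. }
    lra. }
  set (G := avgs N rho (3 + N) (zline sigma)).
  assert (HGF : forall t, T <= t <= T + delta / 2 -> Cmod (G t - F t) <= kap).
  { intros t Ht. unfold G, F. apply avgs_close; [exact HN|exact Hrho|].
    intros u Hu. eapply Rle_trans; [|exact Hk65]. unfold P, N.
    apply zline_approx; try lra. unfold eta in Heta1. lra. }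
  assert (HGlow : forall t, t0 <= t <= t0 + w -> c / 4 <= Cmod (G t)).
  { intros t Ht. specialize (HFlow t Ht). unfold tc in Ht0.
    specialize (HGF t ltac:(lra)).
    pose proof (Cmod_triangle_minus (F t) (G t - F t)) as Tr.
    replace (F t + (G t - F t))%C with (G t) in Tr by ring. lra. }
  assert (HcG : Ccont G) by (apply Ccont_avgs, Ccont_zline).
  unfold tc in Ht0.
  pose proof (RInt_Cmod_lower G (c / 4) t0 (t0 + w) T (T + delta / 2) HcG
    ltac:(lra) ltac:(lra) ltac:(lra) HGlow) as HI1.
  pose proof (RInt_avgs N rho (3 + N) (zline sigma) HN Hrho (Ccont_zline sigma)
    T (T + delta / 2) ltac:(lra)) as HI2.
  pose proof (RInt_Cmod_mono (zline sigma) T (T + delta / 2 + rsum rho (3 + N)) T (T + delta)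
    (Ccont_zline sigma)) as HI3.
  pose proof (rsum_nonneg rho (3 + N) (fun j _ => Hrho j)) as Hs0.
  specialize (HI3 ltac:(lra) ltac:(lra) ltac:(lra)).
  fold G in HI2. replace (t0 + w - t0) with w in HI1 by ring. lra.
Qed.

Theorem theorem7 (omega : R -> R)
  (omega_incr : forall x y : R, 2 <= x -> x <= y -> omega x <= omega y)
  (omega_le1 : forall t : R, 2 <= t -> omega t <= 1)
  (omega_int : @ex_RInt_gen R_NormedModule
                 (fun t : R => (1 - omega t) / (t * ln t))
                 (at_point 2) (Rbar_locally p_infty)) :
  forall delta : R, 0 < delta ->
    exists C_delta : R, 0 < C_delta /\
      forall T sigma : R, 2 <= T -> omega T <= sigma ->
        C_delta <= RInt (fun t : R => Cmod (riemann_zeta (sigma, t)))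
                        T (T + delta).
Proof.
  intros delta Hdel.
  assert (H1 : 0 < Rmin delta 1) by (apply Rmin_pos; lra).
  (* The length is capped at 1, since the partial sums approximate zeta only on [T, T + 1]; a longer
     interval only increases the integral. *)
  destruct (lower_bound_large_T omega omega_incr omega_le1 omega_int (Rmin delta 1))
    as [c [T0 [Hc [HT0 Hlarge]]]]; [split; [exact H1|apply Rmin_r]|].
  (* For T below T0, monotonicity gives sigma >= omega(2), so the remaining parameters lie in a
     compact rectangle. *)
  destruct (lower_bound_compact delta T0 (omega 2) 3 Hdel) as [d [Hd Hsmall]].
  (* The value delta / 2 covers sigma >= 3, where |zeta| >= 1/2. *)
  exists (Rmin (delta / 2) (Rmin c d)). split; [repeat apply Rmin_pos; lra|].
  intros T sigma HT Hs. rewrite RInt_zline by assumption.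
  destruct (Rle_or_lt 3 sigma) as [H3|H3].
  - eapply Rle_trans; [apply Rmin_l|].
    replace (delta / 2) with (1 / 2 * ((T + delta) - T)) by field.
    apply RInt_Cmod_lower; [apply Ccont_zline|lra|lra|lra|].
    intros t Ht. apply riemann_zeta_lower. exact H3.
  - eapply Rle_trans; [apply Rmin_r|]. destruct (Rle_or_lt T0 T) as [HT'|HT'].
    + eapply Rle_trans; [apply Rmin_l|].
      eapply Rle_trans; [apply (Hlarge T sigma HT'); lra|].
      pose proof (Rmin_l delta 1).
      apply RInt_Cmod_mono; [apply Ccont_zline|lra|lra|lra].
    + eapply Rle_trans; [apply Rmin_r|]. apply Hsmall; [lra|].
      pose proof (omega_incr 2 T ltac:(lra) HT). lra.
Qed.
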